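(* (Work in $\mathrm{ZF}+\mathrm{AC}_{\aleph_0}$.) Let $\mu>\aleph_0$ be a cardinal such that $\mathrm{hrtg}(\mathcal P(\chi))<\mu$ for every cardinal $\chi<\mu$. Then for every cardinal $\lambda>\mu$ there is a cardinal $\kappa<\mu$ such that: whenever $\theta\in(\kappa,\mu)$ is a cardinal and $D$ is a $\kappa$-complete filter on $\theta$, there is no $<_D$-increasing sequence $\langle f_\alpha:\alpha<\lambda^+\rangle$ of members of ${}^\theta\lambda$.
   Context: The axiom of choice is not assumed; only ZF together with $\mathrm{AC}_{\aleph_0}$ (choice for countable families). Cardinals are alephs (initial ordinals). For a set $A$, $\mathrm{hrtg}(A)$ is the least ordinal $\alpha>0$ such that there is no function from $A$ onto $\alpha$. Filters are proper. For functions $f,g$ from $\theta$ to the ordinals and a filter $D$ on $\theta$, $f<_D g$ means $\{i<\theta: f(i)<g(i)\}\in D$. ${}^\theta\lambda$ is the set of functions from $\theta$ to $\lambda$. *)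

(* Defs.v *)
(* Plain Rocq, no library.  "ZF + AC_{aleph_0} proves T" is rendered as "T holds
   in every model of ZF + AC_{aleph_0}".  The Separation and Replacement schemas
   range over first-order formulas with parameters only: if they ranged over all
   Rocq predicates, a choice principle of the metatheory would give the full
   axiom of choice inside every model.  All set-theoretic notions below are
   interpreted inside the model. *)

Set Implicit Arguments.
Unset Strict Implicit.

Record structure := Structure {
  dom :> Type;
  mem : dom -> dom -> Prop }.

Notation "x ∈ y" := (mem x y) (at level 70, no associativity).
Notation "x ∉ y" := (~ mem x y) (at level 70, no associativity).

(** * First-order formulas in the language of set theory *)

(* De Bruijn indices: [fAll] and [fEx] bind index 0. *)
Inductive form :=
| fMem (i j : nat)
| fEq (i j : nat)
| fBot
| fImp (p q : form)
| fAnd (p q : form)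
| fOr (p q : form)
| fAll (p : form)
| fEx (p : form).

Definition scons (A : Type) (x : A) (e : nat -> A) (n : nat) : A :=
  match n with 0 => x | S k => e k end.

Fixpoint sat (M : structure) (e : nat -> M) (p : form) : Prop :=
  match p with
  | fMem i j => e i ∈ e j
  | fEq i j => e i = e j
  | fBot => False
  | fImp p q => sat e p -> sat e q
  | fAnd p q => sat e p /\ sat e q
  | fOr p q => sat e p \/ sat e q
  | fAll p => forall x : M, sat (scons x e) p
  | fEx p => exists x : M, sat (scons x e) p
  end.

(** * Sets *)

Section SetNotions.
Context {M : structure}.
Implicit Types x y z a b c f g A B C D F G P S : M.

Definition subset A B := forall x, x ∈ A -> x ∈ B.
Definition is_empty A := forall x, x ∉ A.
Definition nonempty A := exists x, x ∈ A.
Definition is_upair c a b := forall x, x ∈ c <-> x = a \/ x = b.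
Definition is_union B A := forall x, x ∈ B <-> exists y, y ∈ A /\ x ∈ y.
Definition is_inter C A B := forall x, x ∈ C <-> x ∈ A /\ x ∈ B.
Definition is_power P A := forall x, x ∈ P <-> subset x A.
Definition is_succ b a := forall x, x ∈ b <-> x ∈ a \/ x = a.

(* Kuratowski pair {{a}, {a, b}} *)
Definition is_opair c a b :=
  exists s t, is_upair s a a /\ is_upair t a b /\ is_upair c s t.

(** * Functions, as sets of ordered pairs *)

Definition app f x y := exists c, is_opair c x y /\ c ∈ f.

Definition is_fun f A B :=
  (forall c, c ∈ f -> exists x y, x ∈ A /\ y ∈ B /\ is_opair c x y) /\
  (forall x, x ∈ A -> exists! y, app f x y).

Definition is_injective f :=
  forall x x' y, app f x y -> app f x' y -> x = x'.

Definition is_onto f A B :=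
  is_fun f A B /\ forall y, y ∈ B -> exists x, x ∈ A /\ app f x y.

Definition equinumerous A B := exists f, is_onto f A B /\ is_injective f.

Definition is_funset S A B := forall f, f ∈ S <-> is_fun f A B.

(** * Ordinals and cardinals; the order of ordinals is ∈ *)

Definition transitive_set a := forall x, x ∈ a -> subset x a.

Definition well_ordered_by_mem a :=
  (forall x, x ∈ a -> x ∉ x) /\
  (forall x y z, x ∈ a -> y ∈ a -> z ∈ a -> x ∈ y -> y ∈ z -> x ∈ z) /\
  (forall x y, x ∈ a -> y ∈ a -> x ∈ y \/ x = y \/ y ∈ x) /\
  (forall S, subset S a -> nonempty S ->
     exists m, m ∈ S /\ forall x, x ∈ S -> m = x \/ m ∈ x).

Definition is_ordinal a := transitive_set a /\ well_ordered_by_mem a.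

Definition is_limit a :=
  is_ordinal a /\ nonempty a /\
  forall x, x ∈ a -> exists y, is_succ y x /\ y ∈ a.

(* ω, i.e. ℵ₀: the least nonzero limit ordinal *)
Definition is_omega w := is_limit w /\ forall x, x ∈ w -> ~ is_limit x.

(* Cardinals are alephs: infinite initial ordinals. *)
Definition is_cardinal k :=
  is_ordinal k /\
  (exists w, is_omega w /\ subset w k) /\
  (forall a, a ∈ k -> ~ equinumerous a k).

(* b is the successor cardinal of the cardinal a *)
Definition is_succ_cardinal b a :=
  is_cardinal b /\ a ∈ b /\
  forall k, is_cardinal k -> a ∈ k -> b = k \/ b ∈ k.

(* h = hrtg(A) *)
Definition is_hrtg h A :=
  let not_image a :=
    is_ordinal a /\ nonempty a /\ ~ (exists f, is_onto f A a) in
  not_image h /\ forall a, not_image a -> h = a \/ h ∈ a.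

(** * Filters *)

Definition is_filter D A :=
  (forall S, S ∈ D -> subset S A) /\
  A ∈ D /\
  (forall S, is_empty S -> S ∉ D) /\
  (forall S T, S ∈ D -> subset S T -> subset T A -> T ∈ D) /\
  (forall S T, S ∈ D -> T ∈ D -> exists C, is_inter C S T /\ C ∈ D).

(* The intersection (within A) of any fewer than k members of D is in D. *)
Definition is_complete k D A :=
  forall g F, g ∈ k -> is_fun F g D ->
    exists C, C ∈ D /\
      forall i, i ∈ C <->
        i ∈ A /\ forall xi S, xi ∈ g -> app F xi S -> i ∈ S.

(* f <_D g, for functions f, g from A to the ordinals and D a filter on A *)
Definition lt_mod D A f g :=
  exists C, C ∈ D /\
    forall i, i ∈ C <->
      i ∈ A /\ exists a b, app f i a /\ app g i b /\ a ∈ b.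

(* F is a <_D-increasing sequence of length l of members of S, a set of
   functions from A to the ordinals *)
Definition is_increasing_seq D A F l S :=
  is_fun F l S /\
  forall a b f g, a ∈ l -> b ∈ l -> a ∈ b ->
    app F a f -> app F b g -> lt_mod D A f g.

End SetNotions.

(** * Axioms *)

Record ZF (M : structure) : Prop := {
  ax_extensionality :
    forall A B : M, (forall x, x ∈ A <-> x ∈ B) -> A = B;
  ax_foundation :
    forall A : M, nonempty A -> exists x, x ∈ A /\ forall y, y ∈ x -> y ∉ A;
  ax_pairing :
    forall a b : M, exists c, is_upair c a b;
  ax_union :
    forall A : M, exists B, is_union B A;
  ax_power :
    forall A : M, exists P, is_power P A;
  ax_infinity :
    exists I : M,
      (exists z, is_empty z /\ z ∈ I) /\
      (forall x, x ∈ I -> exists y, is_succ y x /\ y ∈ I);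
  ax_separation :
    forall (p : form) (e : nat -> M) (A : M),
      exists B, forall x, x ∈ B <-> x ∈ A /\ sat (scons x e) p;
  (* in p, index 0 is the argument and index 1 the value *)
  ax_replacement :
    forall (p : form) (e : nat -> M) (A : M),
      (forall x, x ∈ A -> exists! y, sat (scons x (scons y e)) p) ->
      exists B, forall y,
        y ∈ B <-> exists x, x ∈ A /\ sat (scons x (scons y e)) p }.

(* Every family of nonempty sets indexed by ω has a choice function. *)
Definition AC_aleph0 (M : structure) : Prop :=
  forall w B F : M, is_omega w -> is_fun F w B ->
    (forall n S, n ∈ w -> app F n S -> nonempty S) ->
    exists g C, is_fun g w C /\
      forall n S x, n ∈ w -> app F n S -> app g n x -> x ∈ S.

(* Main.v *)
From Stdlib Require Import Classical ClassicalEpsilon FunctionalExtensionality PropExtensionality Lia Arith List.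
Require Import Defs.

(** Suppose the theorem fails at lambda. Iterating hrtg(P(.)) along least counterexamples gives cardinals
    kappa_0 < theta_0 < kappa_1 < theta_1 < ... below mu with supremum m, and countable choice picks chains
    f^n of length lambda^+ in (theta_n -> lambda). Choice is recovered in the inner model W of the sets that
    are hereditarily definable from ordinals and the parameter p = (f^n, kappa_n)_n. In W, m is a strong limit
    of cofinality omega: the power set of theta_n in W is well ordered by definability, and its order type is
    an image of P(theta_n), hence below kappa_(n+1).

    In W a form of Shelah's revised GCH holds: for every ordinal a there is k < m such that for every
    theta < m some family of sets of size less than m, indexed by a, covers the range of each function
    theta -> a by k of its members. For a = lambda choose n with k < kappa_n. Then for each alpha some piece
    {i : f^n_alpha(i) in P_j} is positive for the kappa_n-complete filter, so alpha is determined by j and the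
    restriction of f^n_alpha to that piece. In W there are at most lambda such data, so lambda^+ injects into
    lambda, a contradiction. *)

Set Implicit Arguments.
Unset Strict Implicit.

(** * First-order definability *)

(** The covering theorem makes uncountably many choices, so it must be run in W, while the filters
    stay outside. The bridge is [separated], which records only that some part of every small cover
    tells all members of the chain apart. It speaks of every cover, hence also of those found in W;
    and each single f^n_alpha, a map from an ordinal to ordinals definable from p, n and alpha, lies
    in W. The kappa_n enter p so that W sees the cofinality of m: sizes below m then fall into
    countably many classes, which is why the ideals used are closed under countable unions. The
    covering theorem is proved for a least counterexample. Functions into it that avoid families of
    small sets are bounded, modulo an ideal, by functions b, and well-foundedness yields a b that
    cannot be lowered even on countably many parts. Under b lies a long sequence of almost disjoint
    functions, while minimality covers the ordinals under b; counting the functions by their traces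
    on the covers gives the contradiction. Separation and replacement being restricted to formulas,
    every predicate and term carries a proof of definability, with its constants tracked because
    membership in W depends on them. *)

Fixpoint ren (r : nat -> nat) (p : form) : form :=
  let up n := match n with 0 => 0 | S k => S (r k) end in
  match p with
  | fMem i j => fMem (r i) (r j)
  | fEq i j => fEq (r i) (r j)
  | fBot => fBot
  | fImp p q => fImp (ren r p) (ren r q)
  | fAnd p q => fAnd (ren r p) (ren r q)
  | fOr p q => fOr (ren r p) (ren r q)
  | fAll p => fAll (ren up p)
  | fEx p => fEx (ren up p)
  end.

Lemma sat_ren (M : structure) p : forall r (e : nat -> M),
  sat e (ren r p) <-> sat (fun n => e (r n)) p.
Proof.
  induction p; intros r e; simpl; try tauto;
    try (rewrite IHp1, IHp2; tauto);
    assert (H : forall x, (fun n => scons x e match n with 0 => 0 | S k => S (r k) end)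
                 = scons x (fun n => e (r n)))
      by (intro x; apply functional_extensionality; intros [|n]; reflexivity).
  - split; intros G x; specialize (G x); rewrite IHp, H in *; exact G.
  - split; intros [x G]; exists x; rewrite IHp, H in *; exact G.
Qed.

Section Definability.
Context {M : structure}.
Implicit Types (K : M -> Prop) (P Q : (nat -> M) -> Prop) (s t : (nat -> M) -> M).

Definition asg (v : nat -> nat + M) (e : nat -> M) (i : nat) : M :=
  match v i with inl k => e k | inr a => a end.

(* [v] sends each variable of [p] to a place of the environment or to a constant of [K]. *)
Definition D K P : Prop :=
  exists p v, (forall i a, v i = inr a -> K a) /\ forall e, P e <-> sat (asg v e) p.

Lemma D_ext K P Q : (forall e, P e <-> Q e) -> D K Q -> D K P.
Proof. intros H (p & v & Hv & HQ). exists p, v. split; auto. intro e. rewrite H. auto. Qed.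

Lemma D_K (K K' : M -> Prop) P : (forall a, K a -> K' a) -> D K P -> D K' P.
Proof. intros H (p & v & Hv & HQ). exists p, v. split; eauto. Qed.

(** The two formulas come with unrelated assignments. Moving the variables of the first to even
    indices and those of the second to odd ones lets the assignments be interleaved into one. *)
Lemma D_bin K P Q (c : form -> form -> form) (C : Prop -> Prop -> Prop) :
  (forall p q (e : nat -> M), sat e (c p q) <-> C (sat e p) (sat e q)) ->
  D K P -> D K Q -> D K (fun e => C (P e) (Q e)).
Proof.
  intros Hc (p & v & Hv & HP) (q & w & Hw & HQ).
  exists (c (ren (fun i => 2 * i) p) (ren (fun i => 2 * i + 1) q)).
  exists (fun i => if Nat.even i then v (Nat.div2 i) else w (Nat.div2 i)).
  split.
  - intros i a. destruct (Nat.even i); eauto.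
  - intro e. rewrite Hc. rewrite (propositional_extensionality _ _ (sat_ren p _ _)).
    rewrite (propositional_extensionality _ _ (sat_ren q _ _)).
    replace (P e) with (sat (asg v e) p) by (apply propositional_extensionality; symmetry; auto).
    replace (Q e) with (sat (asg w e) q) by (apply propositional_extensionality; symmetry; auto).
    match goal with |- C (sat ?a _) (sat ?b _) <-> C (sat ?a' _) (sat ?b' _) =>
      replace a' with a; [replace b' with b; [tauto|]|] end;
    apply functional_extensionality; intro i; unfold asg.
    + rewrite Nat.even_add, Nat.even_mul. simpl Nat.even. simpl xorb.
      replace (Nat.div2 (2 * i + 1)) with i; auto.
      rewrite Nat.add_1_r, Nat.div2_succ_double; auto.
    + rewrite Nat.even_mul. simpl Nat.even. simpl orb. rewrite Nat.div2_double. auto.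
Qed.

Lemma D_and K P Q : D K P -> D K Q -> D K (fun e => P e /\ Q e).
Proof. apply D_bin with (c := fAnd) (C := and). reflexivity. Qed.
Lemma D_or K P Q : D K P -> D K Q -> D K (fun e => P e \/ Q e).
Proof. apply D_bin with (c := fOr) (C := or). reflexivity. Qed.
Lemma D_imp K P Q : D K P -> D K Q -> D K (fun e => P e -> Q e).
Proof. apply D_bin with (c := fImp) (C := fun A B => A -> B). reflexivity. Qed.
Lemma D_iff K P Q : D K P -> D K Q -> D K (fun e => P e <-> Q e).
Proof. intros. apply D_and; apply D_imp; auto. Qed.

(** By excluded middle in the metatheory, a proposition that ignores the environment is defined by a
    true or a false closed formula. *)
Lemma D_const K (A : Prop) : D K (fun _ => A).
Proof.
  exists (if excluded_middle_informative A then fImp fBot fBot else fBot), (fun _ => inl 0).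
  split; [discriminate|]. intro e. destruct (excluded_middle_informative A); simpl; tauto.
Qed.
Lemma D_not K P : D K P -> D K (fun e => ~ P e).
Proof. intro H. apply D_imp; auto using D_const. Qed.

Lemma D_ren K P (r : nat -> nat) : D K P -> D K (fun e => P (fun n => e (r n))).
Proof.
  intros (p & v & Hv & HP).
  exists p, (fun i => match v i with inl k => inl (r k) | inr a => inr a end). split.
  - intros i a. destruct (v i) eqn:E; intro H; inversion H; subst; eauto.
  - intro e. rewrite HP.
    match goal with |- sat ?a _ <-> sat ?b _ => replace a with b; [tauto|] end.
    apply functional_extensionality; intro i; unfold asg. destruct (v i); auto.
Qed.

(** Several variables of the formula may be sent to place 0; the renaming merges them into the bound
    variable and shifts all others. *)
Lemma D_ex K (Q : M -> (nat -> M) -> Prop) :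
  D K (fun e => Q (e 0) (fun n => e (S n))) -> D K (fun e => exists x, Q x e).
Proof.
  intros (p & v & Hv & HP).
  exists (fEx (ren (fun i => match v i with inl 0 => 0 | _ => S i end) p)).
  exists (fun i => match v i with inl (S k) => inl k | inl 0 => inl 0 | inr a => inr a end).
  split.
  - intros i a. destruct (v i) as [[|k]|b] eqn:E; intro H; inversion H; subst; eauto.
  - intro e. simpl.
    assert (H : forall x, Q x e <-> sat (scons x
      (asg (fun i => match v i with inl (S k) => inl k | inl 0 => inl 0 | inr a => inr a end) e))
      (ren (fun i => match v i with inl 0 => 0 | _ => S i end) p)).
    { intro x. rewrite sat_ren. rewrite (HP (scons x e)).
      match goal with |- sat ?a _ <-> sat ?b _ => replace a with b; [tauto|] end.
      apply functional_extensionality; intro i; unfold asg.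
      destruct (v i) as [[|k]|b] eqn:E; simpl; auto; rewrite E; auto. }
    split; intros [x Hx]; exists x; apply H; auto.
Qed.

Lemma D_all K (Q : M -> (nat -> M) -> Prop) :
  D K (fun e => Q (e 0) (fun n => e (S n))) -> D K (fun e => forall x, Q x e).
Proof.
  intro H. apply D_ext with (fun e => ~ exists x, ~ Q x e).
  - intro e. split.
    + intros A [x Hx]. auto.
    + intros A x. apply NNPP. intro B. apply A. exists x. auto.
  - apply D_not. apply (D_ex (Q := fun x e => ~ Q x e)). apply D_not. auto.
Qed.

Lemma D_mem_var K i j : D K (fun e => e i ∈ e j).
Proof. exists (fMem 0 1), (fun n => match n with 0 => inl i | _ => inl j end).
  split; [intros [|n]; discriminate | reflexivity]. Qed.
Lemma D_eq_var K i j : D K (fun e => e i = e j).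
Proof. exists (fEq 0 1), (fun n => match n with 0 => inl i | _ => inl j end).
  split; [intros [|n]; discriminate | reflexivity]. Qed.

Lemma D_fix K (P : M -> (nat -> M) -> Prop) e :
  D K (fun e => P (e 0) (fun n => e (S n))) ->
  D (fun _ => True) (fun e' => P (e' 0) e).
Proof.
  intros (p & v & Hv & HP).
  exists p, (fun i => match v i with inl 0 => inl 0 | inl (S k) => inr (e k) | inr a => inr a end).
  split; auto.
  intro e'. rewrite (HP (scons (e' 0) e)).
  match goal with |- sat ?a _ <-> sat ?b _ => replace a with b; [tauto|] end.
  apply functional_extensionality; intro i; unfold asg. destruct (v i) as [[|k]|b]; auto.
Qed.

(** * Definable terms, given by their graphs, and substitution *)

Definition DT K t : Prop := D K (fun e => e 0 = t (fun n => e (S n))).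

Lemma DT_var K k : DT K (fun e => e k).
Proof. apply (D_eq_var K 0 (S k)). Qed.
Lemma DT_const K a : K a -> DT K (fun _ => a).
Proof.
  intro H. exists (fEq 0 1), (fun n => match n with 0 => inl 0 | _ => inr a end).
  split; [|reflexivity]. intros [|n] b E; inversion E; subst; auto.
Qed.
Lemma DT_ren K t (r : nat -> nat) : DT K t -> DT K (fun e => t (fun n => e (r n))).
Proof.
  intro H. apply (D_ren (fun n => match n with 0 => 0 | S k => S (r k) end) H).
Qed.
(** Formulas have no function symbols, so the value of the term enters through a quantifier over its
    graph. *)
Lemma D_let K t (Q : M -> (nat -> M) -> Prop) :
  DT K t -> D K (fun e => Q (e 0) (fun n => e (S n))) -> D K (fun e => Q (t e) e).
Proof.
  intros Ht HQ. apply D_ext with (fun e => exists x, x = t e /\ Q x e).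
  - intro e. split; [eauto|]. intros (x & -> & H); auto.
  - apply (D_ex (Q := fun x e => x = t e /\ Q x e)). apply D_and; auto.
Qed.

Lemma D_pred1 K (R : M -> Prop) s : D K (fun e => R (e 0)) -> DT K s -> D K (fun e => R (s e)).
Proof. intros H Hs. apply (D_let (Q := fun x _ => R x)); auto. Qed.

Lemma D_pred2 K (R : M -> M -> Prop) s t :
  D K (fun e => R (e 0) (e 1)) -> DT K s -> DT K t -> D K (fun e => R (s e) (t e)).
Proof.
  intros H Hs Ht. apply (D_let (Q := fun x e => R x (t e))); auto.
  apply (D_let (t := fun e => t (fun n => e (S n))) (Q := fun y e => R (e 0) y)).
  - apply DT_ren; auto.
  - apply (D_ren (fun n => match n with 0 => 1 | 1 => 0 | n => n end) H).
Qed.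

Lemma D_pred3 K (R : M -> M -> M -> Prop) s t u :
  D K (fun e => R (e 0) (e 1) (e 2)) -> DT K s -> DT K t -> DT K u ->
  D K (fun e => R (s e) (t e) (u e)).
Proof.
  intros H Hs Ht Hu. apply (D_let (Q := fun x e => R x (t e) (u e))); auto.
  apply (D_let (t := fun e => t (fun n => e (S n)))
           (Q := fun y e => R (e 0) y (u (fun n => e (S n))))).
  - apply DT_ren; auto.
  - apply (D_let (t := fun e => u (fun n => e (S (S n))))
           (Q := fun z e => R (e 1) (e 0) z)).
    + apply (DT_ren (fun n => S (S n))); auto.
    + apply (D_ren (fun n => match n with 0 => 2 | 1 => 1 | 2 => 0 | n => n end) H).
Qed.

Lemma D_pred4 K (R : M -> M -> M -> M -> Prop) s t u w :
  D K (fun e => R (e 0) (e 1) (e 2) (e 3)) -> DT K s -> DT K t -> DT K u -> DT K w ->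
  D K (fun e => R (s e) (t e) (u e) (w e)).
Proof.
  intros H Hs Ht Hu Hw. apply (D_let (Q := fun x e => R x (t e) (u e) (w e))); auto.
  apply (D_let (t := fun e => t (fun n => e (S n)))
           (Q := fun y e => R (e 0) y (u (fun n => e (S n))) (w (fun n => e (S n))))).
  - apply DT_ren; auto.
  - apply (D_let (t := fun e => u (fun n => e (S (S n))))
           (Q := fun z e => R (e 1) (e 0) z (w (fun n => e (S (S n)))))).
    + apply (DT_ren (fun n => S (S n))); auto.
    + apply (D_let (t := fun e => w (fun n => e (S (S (S n)))))
           (Q := fun z e => R (e 2) (e 1) (e 0) z)).
      * apply (DT_ren (fun n => S (S (S n)))); auto.
      * apply (D_ren (fun n => match n with 0 => 3 | 1 => 2 | 2 => 1 | 3 => 0 | n => n end) H).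
Qed.

Lemma D_mem K s t : DT K s -> DT K t -> D K (fun e => s e ∈ t e).
Proof. apply (D_pred2 (R := fun x y => x ∈ y)). apply D_mem_var. Qed.
Lemma D_eq K s t : DT K s -> DT K t -> D K (fun e => s e = t e).
Proof. apply (D_pred2 (R := fun x y => x = y)). apply D_eq_var. Qed.

Lemma DT_op1 K (F : M -> M) s :
  D K (fun e => e 0 = F (e 1)) -> DT K s -> DT K (fun e => F (s e)).
Proof. intros H Hs. apply (D_pred2 (R := fun v x => v = F x)); auto using DT_var.
  apply (DT_ren S); auto. Qed.
Lemma DT_op2 K (F : M -> M -> M) s t :
  D K (fun e => e 0 = F (e 1) (e 2)) -> DT K s -> DT K t -> DT K (fun e => F (s e) (t e)).
Proof. intros H Hs Ht. apply (D_pred3 (R := fun v x y => v = F x y)); auto using DT_var;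
  apply (DT_ren S); auto. Qed.
Lemma DT_if K P s t :
  D K P -> DT K s -> DT K t ->
  DT K (fun e => if excluded_middle_informative (P e) then s e else t e).
Proof.
  intros HP Hs Ht.
  apply D_ext with (fun e => (P (fun n => e (S n)) /\ e 0 = s (fun n => e (S n))) \/
                             (~ P (fun n => e (S n)) /\ e 0 = t (fun n => e (S n)))).
  - intro e. destruct (excluded_middle_informative _); tauto.
  - apply D_or; apply D_and; auto; try apply D_not; apply (D_ren S); auto.
Qed.

(** Definite description made total by the default [d]. The choice operator of the metatheory only
    names a unique witness, so definability is preserved. *)
Definition the (P : M -> Prop) (d : M) : M :=
  if excluded_middle_informative (exists! x, P x)
  then epsilon (inhabits d) P else d.

Lemma the_eq (P : M -> Prop) d x : P x -> (forall y, P y -> y = x) -> the P d = x.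
Proof.
  intros Hx Hu. unfold the. destruct (excluded_middle_informative _) as [H|H].
  - apply Hu. apply epsilon_spec. eauto.
  - exfalso. apply H. exists x. split; auto. intros; symmetry; auto.
Qed.
Lemma DT_the K (P : M -> (nat -> M) -> Prop) d :
  D K (fun e => P (e 0) (fun n => e (S n))) -> DT K d ->
  DT K (fun e => the (fun x => P x e) (d e)).
Proof.
  intros HP Hd.
  apply D_ext with (fun e =>
     (P (e 0) (fun n => e (S n)) /\ (forall y, P y (fun n => e (S n)) -> y = e 0)) \/
     (~ (exists x, P x (fun n => e (S n)) /\ forall y, P y (fun n => e (S n)) -> y = x) /\
       e 0 = d (fun n => e (S n)))).
  - intro e. split.
    + intro E. destruct (classic (exists x, P x (fun n => e (S n)) /\
        forall y, P y (fun n => e (S n)) -> y = x)) as [(x & Hx & Hu)|H].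
      * left. rewrite (the_eq _ Hx Hu) in E. rewrite E. auto.
      * right. split; auto. rewrite E. unfold the.
        destruct (excluded_middle_informative _) as [(x & Hx & Hu)|]; auto.
        exfalso. apply H. exists x. split; auto. intros; symmetry; auto.
    + intros [[Hx Hu]|[H E]].
      * symmetry. apply the_eq; auto.
      * rewrite E. unfold the.
        destruct (excluded_middle_informative _) as [(x & Hx & Hu)|]; auto.
        exfalso. apply H. exists x. split; auto. intros; symmetry; auto.
  - assert (H1 : D K (fun e => P (e 0) (fun n => e (S (S n))))) by
      apply (D_ren (fun n => match n with 0 => 0 | S k => S (S k) end) HP).
    assert (H2 : D K (fun e => P (e 0) (fun n => e (S (S (S n)))))) by
      apply (D_ren (fun n => match n with 0 => 0 | S k => S (S (S k)) end) HP).
    apply D_or; apply D_and; auto.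
    + apply (D_all (Q := fun y e => P y (fun n => e (S n)) -> y = e 0)).
      apply D_imp; auto. apply D_eq_var.
    + apply D_not. apply (D_ex (Q := fun x e => P x (fun n => e (S n)) /\
          forall y, P y (fun n => e (S n)) -> y = x)).
      apply D_and; auto.
      apply (D_all (Q := fun y e => P y (fun n => e (S (S n))) -> y = e 0)).
      apply D_imp; auto. apply D_eq_var.
Qed.
End Definability.

(* Automatic proofs of definability *)
Create HintDb df discriminated.
#[export] Hint Constants Opaque : df.
#[export] Hint Variables Opaque : df.
#[export] Hint Resolve D_and D_or D_imp D_iff D_not D_ex D_all D_mem D_eq DT_if DT_var : df.
#[export] Hint Extern 1 (DT _ (fun e => the _ _)) => apply DT_the : df.
#[export] Hint Extern 1 (D _ (fun _ => ?P)) => apply D_const : df.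
#[export] Hint Extern 1 (DT _ (fun _ => ?a)) => apply DT_const; first [exact I | assumption | auto] : df.

Ltac df := cbv beta in *; solve [typeclasses eauto 200 with df].

(** * Basic operations on sets *)

Existing Class ZF.

Notation Df P := (D (fun _ => True) (fun e => P (e 0))).
Notation DTf F := (DT (fun _ => True) (fun e => F (e 0))).

Section Basics.
Context {M : structure} {Z : ZF M}.
Implicit Types (K : M -> Prop) (a b c x y z A B C f g h : M) (P Q : M -> Prop) (F : M -> M).

Lemma ext A B : (forall x, x ∈ A <-> x ∈ B) -> A = B.
Proof. apply (ax_extensionality Z). Qed.

Lemma inhM : inhabited M.
Proof. destruct (ax_infinity Z) as [I _]. exact (inhabits I). Qed.

Lemma separation P A : Df P -> exists B, forall x, x ∈ B <-> x ∈ A /\ P x.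
Proof.
  intros (p & v & _ & H).
  pose (e := asg v (fun _ => A)).
  destruct (ax_separation Z (ren (fun i => match v i with inl 0 => 0 | _ => S i end) p) e A) as [B HB].
  exists B. intro x. rewrite HB, sat_ren. rewrite (H (scons x (fun _ => A))).
  match goal with |- _ /\ sat ?a _ <-> _ /\ sat ?b _ => replace a with b; [tauto|] end.
  apply functional_extensionality; intro i; unfold asg, e, asg. destruct (v i) as [[|k]|d] eqn:E; simpl; auto; rewrite E; auto.
Qed.

Lemma replacement F A : DTf F -> exists B, forall y, y ∈ B <-> exists x, x ∈ A /\ y = F x.
Proof.
  intros (p & v & _ & H).
  pose (e := asg v (fun _ => A)).
  pose (q := ren (fun i => match v i with inl 0 => 1 | inl 1 => 0 | _ => S (S i) end) p).
  assert (E : forall x y, sat (scons x (scons y e)) q <-> y = F x).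
  { intros x y. unfold q. rewrite sat_ren. rewrite (H (scons y (scons x (fun _ => A)))).
    match goal with |- sat ?a _ <-> sat ?b _ => replace a with b; [tauto|] end.
    apply functional_extensionality; intro i; unfold asg, e, asg.
    destruct (v i) as [[|[|k]]|d] eqn:E; simpl; auto; rewrite E; auto. }
  destruct (@ax_replacement M Z q e A) as [B HB].
  { intros x _. exists (F x). split; [apply E; auto|]. intros y Hy. symmetry. apply E; auto. }
  exists B. intro y. rewrite HB. split; intros (x & Hx & Hy); exists x; split; auto; apply E; auto.
Qed.

(** The choice operator of the metatheory is harmless here: extensionality makes each of these sets
    unique. For predicates or maps that are not definable, [sep] and [image] may be arbitrary sets,
    which is why their membership lemmas ask for definability. *)
Definition emp : M := epsilon inhM is_empty.
Definition upair a b : M := epsilon (inhabits a) (fun c => is_upair c a b).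
Definition Un A : M := epsilon (inhabits A) (fun c => is_union c A).
Definition Pw A : M := epsilon (inhabits A) (fun c => is_power c A).
Definition sep A P : M := epsilon (inhabits A) (fun B => forall x, x ∈ B <-> x ∈ A /\ P x).
Definition image A F : M := epsilon (inhabits A) (fun B => forall y, y ∈ B <-> exists x, x ∈ A /\ y = F x).

Lemma in_emp x : ~ x ∈ emp.
Proof.
  assert (H : is_empty emp); [|apply H].
  unfold emp. apply epsilon_spec. destruct (ax_infinity Z) as [I [[z [H _]] _]]. eauto.
Qed.
Lemma in_upair a b x : x ∈ upair a b <-> x = a \/ x = b.
Proof.
  assert (H : is_upair (upair a b) a b); [|apply H].
  unfold upair. apply epsilon_spec. apply (ax_pairing Z).
Qed.
Lemma in_Un A x : x ∈ Un A <-> exists y, y ∈ A /\ x ∈ y.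
Proof.
  assert (H : is_union (Un A) A); [|apply H].
  unfold Un. apply epsilon_spec. apply (ax_union Z).
Qed.
Lemma in_Pw A x : x ∈ Pw A <-> subset x A.
Proof.
  assert (H : is_power (Pw A) A); [|apply H].
  unfold Pw. apply epsilon_spec. apply (ax_power Z).
Qed.
Lemma in_sep A P x : Df P -> x ∈ sep A P <-> x ∈ A /\ P x.
Proof.
  intro HP.
  assert (H : forall x, x ∈ sep A P <-> x ∈ A /\ P x); [|apply H].
  unfold sep. apply epsilon_spec. apply separation; auto.
Qed.
Lemma in_image A F y : DTf F -> y ∈ image A F <-> exists x, x ∈ A /\ y = F x.
Proof.
  intro HP.
  assert (H : forall y, y ∈ image A F <-> exists x, x ∈ A /\ y = F x); [|apply H].
  unfold image. apply epsilon_spec. apply replacement; auto.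
Qed.

Lemma DT_char K (t : (nat -> M) -> M) (R : M -> (nat -> M) -> Prop) :
  (forall v e, v = t e <-> R v e) ->
  D K (fun e => R (e 0) (fun n => e (S n))) -> DT K t.
Proof. intros H HR. apply D_ext with (fun e => R (e 0) (fun n => e (S n))); auto. Qed.

(** By extensionality the graph of a set-valued term is definable once its membership relation
    is. *)
Lemma DT_set K (t : (nat -> M) -> M) (R : M -> (nat -> M) -> Prop) :
  (forall x e, x ∈ t e <-> R x e) ->
  D K (fun e => R (e 0) (fun n => e (S n))) -> DT K t.
Proof.
  intros H HR. apply (DT_char (R := fun v e => forall x, x ∈ v <-> R x e)).
  - intros v e. split; [intros ->; auto|]. intro G. apply ext. intro x. rewrite G, H. tauto.
  - apply (D_all (Q := fun x e => x ∈ e 0 <-> R x (fun n => e (S n)))).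
    apply D_iff; [apply D_mem_var|].
    apply (D_ren (fun n => match n with 0 => 0 | S k => S (S k) end) HR).
Qed.

Lemma DT_emp K : DT K (fun _ => emp).
Proof. apply (DT_set (R := fun x e => False)); [|df]. intros. split; [apply in_emp|tauto]. Qed.
Lemma DT_upair K s t : DT K s -> DT K t -> DT K (fun e => upair (s e) (t e)).
Proof. apply DT_op2. apply (DT_set (t := fun e => upair (e 0) (e 1)) (R := fun x e => x = e 0 \/ x = e 1)); [|df].
  intros. apply in_upair. Qed.
Lemma DT_Un K s : DT K s -> DT K (fun e => Un (s e)).
Proof. apply DT_op1. apply (DT_set (t := fun e => Un (e 0)) (R := fun x e => exists y, y ∈ e 0 /\ x ∈ y)); [|df].
  intros. apply in_Un. Qed.
Lemma D_subset K s t : DT K s -> DT K t -> D K (fun e => subset (s e) (t e)).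
Proof. apply D_pred2. unfold subset. df. Qed.
Hint Resolve DT_emp DT_upair DT_Un D_subset : df.
Lemma DT_Pw K s : DT K s -> DT K (fun e => Pw (s e)).
Proof. apply DT_op1. apply (DT_set (t := fun e => Pw (e 0)) (R := fun x e => subset x (e 0))); [|df].
  intros. apply in_Pw. Qed.
Lemma DT_sep K s (P : M -> (nat -> M) -> Prop) :
  DT K s -> D K (fun e => P (e 0) (fun n => e (S n))) -> DT K (fun e => sep (s e) (fun x => P x e)).
Proof.
  intros Hs HP. apply (DT_set (R := fun x e => x ∈ s e /\ P x e)).
  - intros x e. apply in_sep. apply (D_fix e HP).
  - apply D_and; auto. apply D_mem; [df|]. apply (DT_ren S); auto.
Qed.
Lemma DT_fix K (F : M -> (nat -> M) -> M) e :
  DT K (fun e => F (e 0) (fun n => e (S n))) -> DT (fun _ => True) (fun e' => F (e' 0) e).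
Proof.
  intros (p & v & Hv & HP).
  exists p, (fun i => match v i with inl 0 => inl 0 | inl 1 => inl 1 | inl (S (S k)) => inr (e k) | inr a => inr a end).
  split; auto.
  intro e'. rewrite (HP (scons (e' 0) (scons (e' 1) e))).
  match goal with |- sat ?a _ <-> sat ?b _ => replace a with b; [tauto|] end.
  apply functional_extensionality; intro i; unfold asg. destruct (v i) as [[|[|k]]|d]; auto.
Qed.
Lemma DT_image K s (F : M -> (nat -> M) -> M) :
  DT K s -> DT K (fun e => F (e 0) (fun n => e (S n))) -> DT K (fun e => image (s e) (fun x => F x e)).
Proof.
  intros Hs HP. apply (DT_set (R := fun y e => exists x, x ∈ s e /\ y = F x e)).
  - intros x e. apply in_image. apply (DT_fix e HP).
  - apply (D_ex (Q := fun x e => x ∈ s (fun n => e (S n)) /\ e 0 = F x (fun n => e (S n)))).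
    apply D_and.
    + apply D_mem; [df|]. apply (DT_ren (fun n => S (S n))); auto.
    + apply D_eq; [df|]. apply (DT_ren (fun n => match n with 0 => 0 | S k => S (S k) end) HP).
Qed.
Hint Resolve DT_Pw : df.
Hint Extern 1 (DT _ (fun e => sep _ _)) => apply DT_sep : df.
Hint Extern 1 (DT _ (fun e => image _ _)) => apply DT_image : df.

Definition sing a := upair a a.
Definition cup a b := Un (upair a b).
Definition suc a := cup a (sing a).
Definition opair a b := upair (sing a) (upair a b).
Definition diff a b := sep a (fun x => ~ x ∈ b).

Lemma DT_sing K s : DT K s -> DT K (fun e => sing (s e)).
Proof. unfold sing. intro. df. Qed.
Lemma DT_cup K s t : DT K s -> DT K t -> DT K (fun e => cup (s e) (t e)).
Proof. unfold cup. intros. df. Qed.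
Hint Resolve DT_sing DT_cup : df.
Lemma DT_suc K s : DT K s -> DT K (fun e => suc (s e)).
Proof. unfold suc. intros. df. Qed.
Lemma DT_opair K s t : DT K s -> DT K t -> DT K (fun e => opair (s e) (t e)).
Proof. unfold opair. intros. df. Qed.
Lemma DT_diff K s t : DT K s -> DT K t -> DT K (fun e => diff (s e) (t e)).
Proof. apply DT_op2. apply (DT_set (t := fun e => diff (e 0) (e 1)) (R := fun x e => x ∈ e 0 /\ ~ x ∈ e 1)); [|df].
  intros. apply in_sep. df. Qed.
Hint Resolve DT_suc DT_opair DT_diff : df.

Lemma in_sing a x : x ∈ sing a <-> x = a.
Proof. unfold sing. rewrite in_upair. tauto. Qed.
Lemma in_cup a b x : x ∈ cup a b <-> x ∈ a \/ x ∈ b.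
Proof.
  unfold cup. rewrite in_Un. split.
  - intros (y & Hy & Hx). apply in_upair in Hy. destruct Hy; subst; auto.
  - intros [H|H]; [exists a|exists b]; rewrite in_upair; auto.
Qed.
Lemma in_suc a x : x ∈ suc a <-> x ∈ a \/ x = a.
Proof. unfold suc. rewrite in_cup, in_sing. tauto. Qed.
Lemma in_diff a b x : x ∈ diff a b <-> x ∈ a /\ ~ x ∈ b.
Proof. apply in_sep. df. Qed.

Lemma sing_inj a b : sing a = sing b -> a = b.
Proof. intro H. apply in_sing. rewrite <- H. apply in_sing. auto. Qed.
Lemma opair_inj a b c d : opair a b = opair c d -> a = c /\ b = d.
Proof.
  unfold opair. intro H.
  assert (H1 : a = c).
  { assert (G : sing c ∈ upair (sing a) (upair a b)) by (rewrite H; apply in_upair; auto).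
    apply in_upair in G. destruct G as [G|G].
    - symmetry. apply sing_inj; auto.
    - apply in_sing. rewrite G. apply in_upair. auto. }
  subst c. split; auto.
  assert (G : upair a d ∈ upair (sing a) (upair a b)) by (rewrite H; apply in_upair; auto).
  assert (G' : upair a b ∈ upair (sing a) (upair a d)) by (rewrite <- H; apply in_upair; auto).
  apply in_upair in G. apply in_upair in G'.
  assert (Hd : d ∈ upair a d) by (apply in_upair; auto).
  assert (Hb : b ∈ upair a b) by (apply in_upair; auto).
  destruct G as [G|G]; rewrite G in Hd.
  - apply in_sing in Hd. subst d. destruct G' as [G'|G']; rewrite G' in Hb.
    + apply in_sing in Hb. auto.
    + apply in_upair in Hb. intuition.
  - apply in_upair in Hd. destruct Hd as [Hd|Hd]; [|auto].
    subst d. destruct G' as [G'|G']; rewrite G' in Hb.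
    + apply in_sing in Hb. auto.
    + apply in_upair in Hb. intuition.
Qed.

Lemma foundation A x : x ∈ A -> exists m, m ∈ A /\ forall y, y ∈ m -> ~ y ∈ A.
Proof. intro H. apply (ax_foundation Z). exists x; auto. Qed.
Lemma mem_irr x : ~ x ∈ x.
Proof.
  intro H. destruct (@foundation (sing x) x) as (m & Hm & G); [apply in_sing; auto|].
  apply in_sing in Hm. subst. apply (G x); auto. apply in_sing; auto.
Qed.
Lemma mem_asym x y : x ∈ y -> ~ y ∈ x.
Proof.
  intros H H'. destruct (@foundation (upair x y) x) as (m & Hm & G); [apply in_upair; auto|].
  apply in_upair in Hm. destruct Hm; subst.
  - apply (G y); auto. apply in_upair; auto.
  - apply (G x); auto. apply in_upair; auto.
Qed.

(** * Pairs, products and functions *)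

Definition fst z := the (fun a => exists b, z = opair a b) emp.
Definition snd z := the (fun b => exists a, z = opair a b) emp.
Lemma DT_fst K s : DT K s -> DT K (fun e => fst (s e)).
Proof. apply DT_op1. change (DT K (fun e => the (fun a => exists b, e 0 = opair a b) emp)); df. Qed.
Lemma DT_snd K s : DT K s -> DT K (fun e => snd (s e)).
Proof. apply DT_op1. change (DT K (fun e => the (fun b => exists a, e 0 = opair a b) emp)); df. Qed.
Hint Resolve DT_fst DT_snd : df.
Lemma fst_opair a b : fst (opair a b) = a.
Proof. apply the_eq; [eauto|]. intros y [c H]. apply opair_inj in H. intuition. Qed.
Lemma snd_opair a b : snd (opair a b) = b.
Proof. apply the_eq; [eauto|]. intros y [c H]. apply opair_inj in H. intuition. Qed.

Definition prod A B := sep (Pw (Pw (cup A B))) (fun z => exists x y, x ∈ A /\ y ∈ B /\ z = opair x y).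
Lemma in_prod A B z : z ∈ prod A B <-> exists x y, x ∈ A /\ y ∈ B /\ z = opair x y.
Proof.
  unfold prod. rewrite in_sep by df. split; [tauto|]. intro H. split; auto.
  destruct H as (x & y & Hx & Hy & ->). apply in_Pw. intros u Hu. apply in_Pw. intros v Hv.
  apply in_cup. apply in_upair in Hu. destruct Hu; subst.
  - apply in_sing in Hv. subst; auto.
  - apply in_upair in Hv. destruct Hv; subst; auto.
Qed.
Lemma opair_prod A B x y : opair x y ∈ prod A B <-> x ∈ A /\ y ∈ B.
Proof.
  rewrite in_prod. split; [|intros []; eauto 6].
  intros (x' & y' & Hx & Hy & E). apply opair_inj in E. destruct E; subst; auto.
Qed.
Lemma DT_prod K s t : DT K s -> DT K t -> DT K (fun e => prod (s e) (t e)).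
Proof. intros; apply (DT_set (R := fun z e => exists x y, x ∈ s e /\ y ∈ t e /\ z = opair x y)).
  intros; apply in_prod.
  apply (@DT_ren _ _ _ S) in H. apply (@DT_ren _ _ _ S) in H.
  apply (@DT_ren _ _ _ S) in H0. apply (@DT_ren _ _ _ S) in H0.
  apply (@DT_ren _ _ _ S) in H0. apply (@DT_ren _ _ _ S) in H. df. Qed.
Hint Resolve DT_prod : df.

(* Functions are applied and defined totally: [ap f x] is [emp] outside the domain. *)
Definition ap f x := the (fun y => opair x y ∈ f) emp.
Definition lam A F := image A (fun x => opair x (F x)).
Lemma DT_ap K s t : DT K s -> DT K t -> DT K (fun e => ap (s e) (t e)).
Proof. apply DT_op2. change (DT K (fun e => the (fun y => opair (e 1) y ∈ e 0) emp)); df. Qed.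
Hint Resolve DT_ap : df.
Lemma DT_lam K s (F : M -> (nat -> M) -> M) :
  DT K s -> DT K (fun e => F (e 0) (fun n => e (S n))) -> DT K (fun e => lam (s e) (fun x => F x e)).
Proof. unfold lam. intros. apply (DT_image (F := fun x e => opair x (F x e))); auto.
  apply DT_opair; auto. df. Qed.
Hint Extern 1 (DT _ (fun e => lam _ _)) => apply DT_lam : df.
Lemma ap_eq f x y : opair x y ∈ f -> (forall z, opair x z ∈ f -> z = y) -> ap f x = y.
Proof. intros. apply the_eq; auto. Qed.
Lemma in_lam A F z : DTf F -> z ∈ lam A F <-> exists x, x ∈ A /\ z = opair x (F x).
Proof. intro H. unfold lam. apply in_image. apply DT_opair; auto. df. Qed.
Lemma ap_lam A F x : DTf F -> x ∈ A -> ap (lam A F) x = F x.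
Proof.
  intros H Hx. apply the_eq.
  - apply in_lam; eauto.
  - intros y Hy. apply in_lam in Hy; auto. destruct Hy as (x' & _ & E).
    apply opair_inj in E. destruct E; subst; auto.
Qed.
Lemma ap_lam_out A F x : DTf F -> ~ x ∈ A -> ap (lam A F) x = emp.
Proof.
  intros H Hx. unfold ap, the. destruct (excluded_middle_informative _) as [(y & Hy & _)|]; auto.
  apply in_lam in Hy; auto. destruct Hy as (x' & Hx' & E). apply opair_inj in E. destruct E; subst; tauto.
Qed.
Lemma lam_ext A F G : (forall x, x ∈ A -> F x = G x) -> DTf F -> DTf G -> lam A F = lam A G.
Proof.
  intros H HF HG. apply ext. intro z. rewrite !in_lam by auto.
  split; intros (x & Hx & ->); exists x; rewrite H by auto; auto.
Qed.
Definition domf f := image f fst.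
Lemma DT_domf K s : DT K s -> DT K (fun e => domf (s e)).
Proof. unfold domf. intro. df. Qed.
Lemma domf_lam A F : DTf F -> domf (lam A F) = A.
Proof.
  intro H. apply ext. intro x. unfold domf. rewrite in_image by df. split.
  - intros (z & Hz & ->). apply in_lam in Hz; auto. destruct Hz as (y & Hy & ->). rewrite fst_opair; auto.
  - intro Hx. exists (opair x (F x)). rewrite fst_opair. split; auto. apply in_lam; eauto.
Qed.
End Basics.
#[export] Hint Resolve DT_emp DT_upair DT_Un D_subset DT_Pw DT_sing DT_cup
  DT_suc DT_opair DT_diff DT_fst DT_snd DT_prod DT_ap DT_domf : df.
#[export] Hint Extern 1 (DT _ (fun e => sep _ _)) => apply DT_sep : df.
#[export] Hint Extern 1 (DT _ (fun e => image _ _)) => apply DT_image : df.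
#[export] Hint Extern 1 (DT _ (fun e => lam _ _)) => apply DT_lam : df.

#[global] Opaque the emp upair Un Pw sep image prod fst snd ap lam domf.

(** * Ordinals, recursion and the cumulative hierarchy *)

Section Ordinals.
Context {M : structure} {Z : ZF M}.
Implicit Types (K : M -> Prop) (a b c x y z A B C f g h : M) (P Q : M -> Prop) (F : M -> M).

(** Under foundation this short form already gives the well-order by membership; [is_ordinal_iff]
    recovers the notion of the statement. *)
Definition Ord a := transitive_set a /\ forall x, x ∈ a -> transitive_set x.
Lemma D_transitive K s : DT K s -> D K (fun e => transitive_set (s e)).
Proof. apply D_pred1. unfold transitive_set. df. Qed.
Hint Resolve D_transitive : df.
Lemma D_Ord K s : DT K s -> D K (fun e => Ord (s e)).
Proof. apply D_pred1. unfold Ord. df. Qed.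
Hint Resolve D_Ord : df.

Lemma Ord_in a x : Ord a -> x ∈ a -> Ord x.
Proof. intros [H1 H2] Hx. split; auto. intros y Hy. apply H2. apply (H1 x); auto. Qed.
Lemma Ord_trans a x y : Ord a -> x ∈ y -> y ∈ a -> x ∈ a.
Proof. intros [H1 H2] Hx Hy. apply (H1 y); auto. Qed.

Lemma Ord_least P a : Df P -> Ord a -> P a ->
  exists b, Ord b /\ P b /\ forall c, c ∈ b -> ~ P c.
Proof.
  intros HP Ha Pa.
  destruct (@foundation _ _ (sep (suc a) P) a) as (m & Hm & Hmin).
  { apply in_sep; auto. split; auto. apply in_suc; auto. }
  apply in_sep in Hm; auto. destruct Hm as [Hm Pm].
  assert (Om : Ord m) by (apply in_suc in Hm; destruct Hm; subst; eauto using Ord_in).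
  exists m. split; [auto|split; [auto|]]. intros c Hc Pc. apply (Hmin c); auto.
  apply in_sep; auto. split; auto. apply in_suc in Hm. apply in_suc. left.
  destruct Hm; subst; eauto using Ord_trans.
Qed.

Lemma Ord_ind P : Df P -> (forall a, Ord a -> (forall b, b ∈ a -> P b) -> P a) -> forall a, Ord a -> P a.
Proof.
  intros HP H a Ha. apply NNPP. intro N.
  destruct (@Ord_least (fun x => ~ P x) a) as (b & Hb & Pb & Hmin); auto. { df. }
  apply Pb. apply H; auto. intros c Hc. apply NNPP. auto.
Qed.

Lemma Ord_tri a b : Ord a -> Ord b -> a ∈ b \/ a = b \/ b ∈ a.
Proof.
  intros Ha Hb. revert b Hb. revert a Ha.
  apply (Ord_ind (P := fun a => forall b, Ord b -> a ∈ b \/ a = b \/ b ∈ a)). { df. }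
  intros a Ha IHa. apply (Ord_ind (P := fun b => a ∈ b \/ a = b \/ b ∈ a)). { df. }
  intros b Hb IHb. apply NNPP. intro N. apply N. right. left. apply ext. intro x. split; intro Hx.
  - destruct (IHa x Hx b Hb) as [|[|]]; auto; exfalso; apply N; right; right; subst; eauto using Ord_trans.
  - destruct (IHb x Hx) as [|[|]]; auto; exfalso; apply N; left; subst; eauto using Ord_trans.
Qed.

Lemma Ord_emp : Ord emp.
Proof. split; intros x Hx; destruct (in_emp Hx). Qed.
Lemma Ord_suc a : Ord a -> Ord (suc a).
Proof.
  intro Ha. split.
  - intros x Hx y Hy. apply in_suc. left. apply in_suc in Hx. destruct Hx; subst; eauto using Ord_trans.
  - intros x Hx. apply in_suc in Hx. destruct Ha as [H1 H2]. destruct Hx; subst; auto.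
Qed.
Lemma Ord_Un A : (forall x, x ∈ A -> Ord x) -> Ord (Un A).
Proof.
  intro H. split.
  - intros x Hx y Hy. apply in_Un in Hx. destruct Hx as (z & Hz & Hx). apply in_Un.
    exists z; split; auto. apply (Ord_trans (H z Hz) Hy Hx).
  - intros x Hx. apply in_Un in Hx. destruct Hx as (z & Hz & Hx). apply (H z); auto.
Qed.
Lemma Ord_cup a b : Ord a -> Ord b -> Ord (cup a b).
Proof. intros. apply Ord_Un. intros x Hx. apply in_upair in Hx. destruct Hx; subst; auto. Qed.
Lemma Ord_sub a b : Ord a -> Ord b -> subset a b <-> a ∈ b \/ a = b.
Proof.
  intros Ha Hb. split.
  - intro H. destruct (Ord_tri Ha Hb) as [|[|G]]; auto. destruct (mem_irr (H _ G)).
  - intros [H|H] x Hx; subst; auto. eauto using Ord_trans.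
Qed.
Lemma Ord_nlt a b : Ord a -> Ord b -> ~ a ∈ b -> subset b a.
Proof. intros Ha Hb H. apply Ord_sub; auto. destruct (Ord_tri Ha Hb) as [|[|]]; auto; tauto. Qed.
Lemma Ord_sub_in a b c : Ord a -> Ord b -> Ord c -> subset a b -> b ∈ c -> a ∈ c.
Proof. intros Ha Hb Hc H H1. apply Ord_sub in H; auto. destruct H; subst; auto. eauto using Ord_trans. Qed.
Lemma suc_sub a b : Ord b -> a ∈ b -> subset (suc a) b.
Proof. intros Hb H x Hx. apply in_suc in Hx. destruct Hx; subst; auto. eauto using Ord_trans. Qed.
Lemma Ord_sup A : (forall x, x ∈ A -> Ord x) -> exists b, Ord b /\ forall x, x ∈ A -> x ∈ b.
Proof.
  intro H. exists (suc (Un A)). split; [apply Ord_suc, Ord_Un; auto|].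
  intros x Hx. apply in_suc. apply Ord_sub; auto using Ord_Un. intros y Hy. apply in_Un. eauto.
Qed.
Lemma no_Ord_set A : exists a, Ord a /\ ~ a ∈ A.
Proof.
  destruct (@Ord_sup (sep A Ord)) as (b & Hb & H). { intros x Hx. apply in_sep in Hx; [tauto|df]. }
  exists b. split; auto. intro N. apply (@mem_irr _ _ b). apply H. apply in_sep; [df|]. auto.
Qed.

(** Least ordinals are the definable substitute for choice throughout; the value is [emp] when no
    ordinal qualifies. *)
Definition mu P := the (fun a => Ord a /\ P a /\ forall b, b ∈ a -> ~ P b) emp.
Lemma mu_spec P a : Df P -> Ord a -> P a ->
  Ord (mu P) /\ P (mu P) /\ forall b, Ord b -> P b -> subset (mu P) b.
Proof.
  intros HP Ha Pa. destruct (Ord_least HP Ha Pa) as (b & Hb & Pb & Hmin).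
  assert (E : mu P = b).
  { apply the_eq; auto. intros y (Hy & Py & Hy').
    destruct (Ord_tri Hy Hb) as [H|[H|H]]; auto; exfalso; [apply (Hmin y)|apply (Hy' b)]; auto. }
  rewrite E. split; [auto|split; [auto|]].
  intros c Hc Pc. apply Ord_nlt; auto. intro H. apply (Hmin c); auto.
Qed.
Transparent the.
Lemma Ord_mu (P : M -> Prop) : Ord (mu P).
Proof.
  unfold mu, the. destruct (excluded_middle_informative _) as [E|]; [|apply Ord_emp].
  apply (@epsilon_spec _ (inhabits emp) (fun a : M => Ord a /\ P a /\ forall b, b ∈ a -> ~ P b)).
  destruct E as (x & Hx & _). eauto.
Qed.

Opaque the.
Lemma DT_mu K (P : M -> (nat -> M) -> Prop) :
  D K (fun e => P (e 0) (fun n => e (S n))) -> DT K (fun e => mu (fun x => P x e)).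
Proof.
  intro H. apply (DT_the (P := fun a e => Ord a /\ P a e /\ forall b, b ∈ a -> ~ P b e)); [|df].
  apply D_and; [df|]. apply D_and; auto.
  apply (D_all (Q := fun b e => b ∈ e 0 -> ~ P b (fun n => e (S n)))). apply D_imp; [df|]. apply D_not.
  apply (D_ren (fun n => match n with 0 => 0 | S k => S (S k) end) H).
Qed.
Hint Extern 1 (DT _ (fun e => mu _)) => apply DT_mu : df.

Lemma DT_let K (F : M -> (nat -> M) -> M) s :
  DT K (fun e => F (e 0) (fun n => e (S n))) -> DT K s -> DT K (fun e => F (s e) e).
Proof.
  intros HF Hs. apply (D_let (t := fun e => s (fun n => e (S n))) (Q := fun x e => e 0 = F x (fun n => e (S n)))).
  - apply (DT_ren S); auto.
  - apply (D_ren (fun n => match n with 0 => 1 | 1 => 0 | n => n end) HF).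
Qed.

(** * Transfinite recursion *)

Section Recursion.
Variable St : M -> M.
(** The step receives all earlier values as one function. Attempts on [a] are unique, so [Rec] can
    name the attempt by [the] and remains definable. *)
Definition isrec a h := h = lam a (ap h) /\ forall b, b ∈ a -> ap h b = St (lam b (ap h)).
Definition Rec a := St (the (isrec a) emp).
Hypothesis HSt : DTf St.
Lemma DT_St s : DT (fun _ => True) s -> DT (fun _ => True) (fun e => St (s e)).
Proof. apply (DT_let (F := fun x _ => St x)). exact HSt. Qed.
Hint Resolve DT_St : df.
Lemma D_isrec s t : DT (fun _ => True) s -> DT (fun _ => True) t -> D (fun _ => True) (fun e => isrec (s e) (t e)).
Proof. apply D_pred2. unfold isrec. df. Qed.
Hint Resolve D_isrec : df.
Lemma DT_Rec0 s : DT (fun _ => True) s -> DT (fun _ => True) (fun e => Rec (s e)).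
Proof. apply DT_op1. change (DT (fun _ => True) (fun e => St (the (isrec (e 0)) emp))). df. Qed.
Hint Resolve DT_Rec0 : df.

Lemma isrec_uniq a h h' : Ord a -> isrec a h -> isrec a h' -> h = h'.
Proof.
  intros Ha [E H] [E' H'].
  assert (G : forall b, Ord b -> b ∈ a -> ap h b = ap h' b).
  { apply (Ord_ind (P := fun b => b ∈ a -> ap h b = ap h' b)). { df. }
    intros b Hb IH Hba. rewrite H, H' by auto. f_equal. apply lam_ext; [|df|df].
    intros c Hc. apply IH; eauto using Ord_trans. }
  rewrite E, E'. apply lam_ext; [|df|df]. intros; apply G; eauto using Ord_in.
Qed.
Lemma isrec_the a h : Ord a -> isrec a h -> the (isrec a) emp = h.
Proof. intros Ha H. apply the_eq; auto. intros. eauto using isrec_uniq. Qed.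
Lemma isrec_ex a : Ord a -> isrec a (lam a Rec).
Proof.
  revert a. apply (Ord_ind (P := fun a => isrec a (lam a Rec))). { df. }
  intros a Ha IH. split.
  - apply lam_ext; [|df|df]. intros x Hx. rewrite ap_lam; auto. df.
  - intros b Hb. rewrite ap_lam; [|df|auto]. unfold Rec at 1. f_equal.
    rewrite (isrec_the (Ord_in Ha Hb) (IH b Hb)). apply lam_ext; [|df|df].
    intros x Hx. rewrite ap_lam; auto. df. eauto using Ord_trans.
Qed.
Lemma Rec_eq a : Ord a -> Rec a = St (lam a Rec).
Proof. intro Ha. unfold Rec at 1. f_equal. apply isrec_the; auto. apply isrec_ex; auto. Qed.
End Recursion.

Lemma DT_Rec K (St : M -> (nat -> M) -> M) s :
  DT K (fun e => St (e 0) (fun n => e (S n))) -> DT K s -> DT K (fun e => Rec (fun h => St h e) (s e)).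
Proof.
  intros HS Hs. apply (DT_let (F := fun a e => Rec (fun h => St h e) a)); auto. unfold Rec.
  assert (H2 : DT K (fun e => St (e 0) (fun n => e (S (S n))))) by
    apply (DT_ren (fun n => match n with 0 => 0 | S k => S (S k) end) HS).
  apply (DT_let (F := fun h e => St h (fun n => e (S n)))); auto.
  apply (DT_the (P := fun h e => isrec (fun h => St h (fun n => e (S n))) (e 0) h)); [|df].
  unfold isrec. apply D_and; [df|].
  apply (D_all (Q := fun b e => b ∈ e 1 -> ap (e 0) b = St (lam b (ap (e 0))) (fun n => e (S (S n))))).
  apply D_imp; [df|]. apply D_eq; [df|].
  apply (DT_let (F := fun h e => St h (fun n => e (S (S (S n))))) (s := fun e => lam (e 0) (ap (e 1)))); [|df].
  apply (DT_ren (fun n => match n with 0 => 0 | S k => S (S (S (S k))) end) HS).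
Qed.
Hint Extern 1 (DT _ (fun e => Rec _ _)) => apply DT_Rec : df.

(** Unfolds the unions over earlier values that occur in recursions such as those for [tcs] and
    [V]. *)
Lemma in_Un_lam a F G x : DTf F -> DTf G ->
  x ∈ Un (image (lam a F) (fun z => G (snd z))) <-> exists b, b ∈ a /\ x ∈ G (F b).
Proof.
  intros HF HG.
  assert (HG' : DTf (fun z => G (snd z))).
  { apply (DT_let (F := fun x _ => G x)); auto. df. }
  rewrite in_Un. split.
  - intros (y & Hy & Hx). apply in_image in Hy; auto. destruct Hy as (z & Hz & ->).
    apply in_lam in Hz; auto. destruct Hz as (b & Hb & ->). rewrite snd_opair in Hx. eauto.
  - intros (b & Hb & Hx). exists (G (F b)). split; auto. apply in_image; auto.
    exists (opair b (F b)). rewrite snd_opair. split; auto. apply in_lam; eauto.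
Qed.

Definition lim a := Ord a /\ nonempty a /\ forall x, x ∈ a -> suc x ∈ a.
Lemma D_nonempty K s : DT K s -> D K (fun e => nonempty (s e)).
Proof. apply D_pred1. unfold nonempty. df. Qed.
Hint Resolve D_nonempty : df.
Lemma D_lim K s : DT K s -> D K (fun e => lim (s e)).
Proof. apply D_pred1. unfold lim. df. Qed.
Hint Resolve D_lim : df.

Lemma lim_ex : exists a, lim a.
Proof.
  destruct (ax_infinity Z) as (I & (z & Hz & HzI) & HI).
  assert (Ez : z = emp) by (apply ext; intro x; split; intro H; [destruct (Hz x H)|destruct (in_emp H)]).
  subst z.
  assert (HS : forall x, x ∈ I -> suc x ∈ I).
  { intros x Hx. destruct (HI x Hx) as (y & Hy & Hy'). replace (suc x) with y; auto.
    apply ext. intro w. rewrite (Hy w), in_suc. tauto. }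
  destruct (no_Ord_set I) as (a & Ha & Na).
  destruct (@Ord_least (fun a => ~ a ∈ I) a) as (b & Hb & Nb & Hmin); auto. { df. }
  exists b. split; auto. split.
  - destruct (classic (nonempty b)) as [|N]; auto. exfalso. apply Nb. replace b with emp; auto.
    apply ext. intro x. split; intro H; [destruct (in_emp H)|]. exfalso. apply N. exists x; auto.
  - intros x Hx. assert (Hs : suc x ∈ I). { apply HS. apply NNPP. apply Hmin. auto. }
    assert (Os : Ord (suc x)) by eauto using Ord_suc, Ord_in.
    assert (subset (suc x) b) by auto using suc_sub.
    apply Ord_sub in H; auto. destruct H; auto. subst b. tauto.
Qed.

Definition omega := mu lim.
Lemma lim_omega : lim omega.
Proof. destruct lim_ex as (a & Ha). apply (@mu_spec lim a); auto. df. apply Ha. Qed.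
Lemma omega_least a : lim a -> subset omega a.
Proof. intro Ha. apply (@mu_spec lim a); auto. df. apply Ha. apply Ha. Qed.
Lemma DT_omega K : DT K (fun _ => omega).
Proof. unfold omega. df. Qed.
Lemma Ord_omega : Ord omega.
Proof. apply lim_omega. Qed.
Lemma emp_lim a : lim a -> emp ∈ a.
Proof.
  intros (Ha & (x & Hx) & _). destruct (Ord_tri Ord_emp Ha) as [|[E|E]]; auto.
  - subst. destruct (in_emp Hx).
  - destruct (in_emp E).
Qed.
Lemma omega_ind P : Df P -> P emp -> (forall n, n ∈ omega -> P n -> P (suc n)) -> forall n, n ∈ omega -> P n.
Proof.
  intros HP H0 HS n Hn. apply NNPP. intro N.
  assert (On : Ord n) by eauto using Ord_in, Ord_omega.
  destruct (@Ord_least (fun n => n ∈ omega /\ ~ P n) n) as (m & Om & [Hm Nm] & Hmin); auto. { df. }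
  assert (L : lim m).
  { split; auto. split.
    - destruct (classic (nonempty m)) as [|E]; auto. exfalso. apply Nm. replace m with emp; auto.
      apply ext. intro x. split; intro H; [destruct (in_emp H)|]. exfalso. apply E. exists x; auto.
    - intros x Hx. assert (subset (suc x) m) by auto using suc_sub.
      apply Ord_sub in H; eauto using Ord_suc, Ord_in. destruct H; auto. exfalso. subst m.
      assert (Hxo : x ∈ omega) by eauto using Ord_trans, Ord_omega.
      apply Nm. apply HS; auto. apply NNPP. intro. apply (Hmin x); auto. }
  apply (mem_irr (omega_least L Hm)).
Qed.

(** Stages of the transitive closure: each adds to [x] the members of members of earlier stages, and
    stage [omega] is closed. *)
Definition tcs x a := Rec (fun h => cup x (Un (image h (fun z => Un (snd z))))) a.
Definition tc x := tcs x omega.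
Lemma in_tcs x a y : Ord a -> y ∈ tcs x a <-> y ∈ x \/ exists b, b ∈ a /\ y ∈ Un (tcs x b).
Proof.
  intro Ha. unfold tcs at 1. rewrite Rec_eq; [|df|auto]. rewrite in_cup.
  rewrite (@in_Un_lam a _ Un); [|df|df]. reflexivity.
Qed.
Lemma tc_sub x : subset x (tc x).
Proof. intros y Hy. apply in_tcs; auto using Ord_omega. Qed.
Lemma tc_trans x : transitive_set (tc x).
Proof.
  intros y Hy z Hz. assert (G : exists n, n ∈ omega /\ y ∈ tcs x n).
  { apply in_tcs in Hy; [|apply Ord_omega]. destruct Hy as [Hy|(n & Hn & Hy)].
    - exists emp. split; [apply emp_lim, lim_omega|]. apply in_tcs; auto using Ord_emp.
    - exists (suc n). split; [apply lim_omega; auto|]. apply in_tcs; eauto using Ord_suc, Ord_in, Ord_omega.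
      right. exists n. rewrite in_suc. auto. }
  destruct G as (n & Hn & G). apply in_tcs; [apply Ord_omega|]. right. exists n. split; auto.
  apply in_Un. eauto.
Qed.
Lemma tc_min x P : Df P -> (forall y z, P y -> z ∈ y -> P z) -> (forall y, y ∈ x -> P y) ->
  forall y, y ∈ tc x -> P y.
Proof.
  intros HP Ht Hx.
  assert (G : forall a, Ord a -> forall y, y ∈ tcs x a -> P y).
  { assert (HP' : forall s, DT (fun _ => True) s -> D (fun _ => True) (fun e => P (s e))) by (intros; apply D_pred1; auto).
    apply (Ord_ind (P := fun a => forall y, y ∈ tcs x a -> P y)). { unfold tcs. df. }
    intros a Ha IH y Hy. apply in_tcs in Hy; auto. destruct Hy as [|(b & Hb & Hy)]; auto.
    apply in_Un in Hy. destruct Hy as (z & Hz & Hy). apply (Ht z); auto. apply (IH b); auto. }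
  apply G. apply Ord_omega.
Qed.

(** Foundation applies to sets only, so a minimal counterexample is sought inside the transitive
    closure of [sing x]. *)
Lemma mem_ind P : Df P -> (forall x, (forall y, y ∈ x -> P y) -> P x) -> forall x, P x.
Proof.
  intros HP H x. apply NNPP. intro N.
  destruct (@foundation _ _ (sep (tc (sing x)) (fun y => ~ P y)) x) as (m & Hm & Hmin).
  { apply in_sep; [df|]. split; auto. apply tc_sub. apply in_sing; auto. }
  apply in_sep in Hm; [|df]. destruct Hm as [Hm Nm]. apply Nm. apply H. intros y Hy.
  apply NNPP. intro Ny. apply (Hmin y Hy). apply in_sep; [df|]. split; auto.
  apply (tc_trans Hm Hy).
Qed.

(** * The cumulative hierarchy *)

Definition V a := Rec (fun h => Un (image h (fun z => Pw (snd z)))) a.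
Lemma DT_V K s : DT K s -> DT K (fun e => V (s e)).
Proof. unfold V. intro. df. Qed.
Hint Resolve DT_V : df.
Lemma in_V a x : Ord a -> x ∈ V a <-> exists b, b ∈ a /\ subset x (V b).
Proof.
  intro Ha. unfold V at 1. rewrite Rec_eq; [|df|auto].
  rewrite (@in_Un_lam a _ Pw); [|df|df].
  split; intros (b & Hb & H); exists b; split; auto; apply in_Pw; auto.
Qed.
Lemma V_mono a b : Ord b -> subset a b -> Ord a -> subset (V a) (V b).
Proof. intros Hb H Ha x Hx. apply in_V in Hx; auto. apply in_V; auto. destruct Hx as (c & Hc & Hx). eauto. Qed.
Lemma V_trans a : Ord a -> transitive_set (V a).
Proof.
  intros Ha x Hx y Hy. apply in_V in Hx; auto. destruct Hx as (b & Hb & Hx).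
  apply (V_mono Ha (a := b)); eauto using Ord_in. intros z Hz. eauto using Ord_trans.
Qed.
Lemma V_all x : exists a, Ord a /\ x ∈ V a.
Proof.
  revert x. apply (mem_ind (P := fun x => exists a, Ord a /\ x ∈ V a)). { df. }
  intros x IH. pose (rk := fun y => mu (fun a => y ∈ V a)).
  destruct (@Ord_sup (image x rk)) as (b & Hb & H).
  { intros r Hr. apply in_image in Hr; [|unfold rk; df]. destruct Hr as (y & Hy & ->).
    destruct (IH y Hy) as (a & Ha & Hya). apply (@mu_spec (fun a => y ∈ V a) a); auto. df. }
  exists (suc b). split; [apply Ord_suc; auto|]. apply in_V; [apply Ord_suc; auto|].
  exists b. split; [apply in_suc; auto|]. intros y Hy. destruct (IH y Hy) as (a & Ha & Hya).
  destruct (@mu_spec (fun a => y ∈ V a) a) as (O1 & O2 & _); auto. { df. }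
  assert (G : rk y ∈ b). { apply H. apply in_image; [unfold rk; df|eauto]. }
  apply (V_mono Hb (a := rk y)); auto. intros z Hz. eauto using Ord_trans.
Qed.
Lemma V_lim_pair a x y : lim a -> x ∈ V a -> y ∈ V a -> upair x y ∈ V a.
Proof.
  intros (Ha & _ & HS) Hx Hy. apply in_V in Hx; auto. apply in_V in Hy; auto.
  destruct Hx as (b & Hb & Hx). destruct Hy as (c & Hc & Hy). apply in_V; auto.
  assert (Ob : Ord b) by eauto using Ord_in. assert (Oc : Ord c) by eauto using Ord_in.
  assert (G : exists d, d ∈ a /\ Ord d /\ subset b d /\ subset c d).
  { destruct (Ord_tri Ob Oc) as [H|[H|H]].
    - exists c. split; [auto|split; [auto|split]]; [apply Ord_sub; auto|intros z Hz; auto].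
    - subst. exists c. split; [auto|split; [auto|split]]; intros z Hz; auto.
    - exists b. split; [auto|split; [auto|split]]; [intros z Hz; auto|apply Ord_sub; auto]. }
  destruct G as (d & Hd & Od & H1 & H2). exists (suc d). split; auto.
  intros z Hz. apply in_V; [apply Ord_suc; auto|]. exists d. split; [apply in_suc; auto|].
  apply in_upair in Hz. destruct Hz; subst; intros w Hw.
  - apply (V_mono Od H1 Ob); auto.
  - apply (V_mono Od H2 Oc); auto.
Qed.
Lemma V_lim_opair a x y : lim a -> x ∈ V a -> y ∈ V a -> opair x y ∈ V a.
Proof. intros. unfold opair, sing. auto using V_lim_pair. Qed.
Lemma V_Ord a : Ord a -> subset a (V a).
Proof.
  revert a. apply (Ord_ind (P := fun a => subset a (V a))). { df. }
  intros a Ha IH x Hx. apply in_V; auto. exists x. auto.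
Qed.
End Ordinals.
#[export] Hint Resolve D_transitive D_Ord D_nonempty D_lim DT_omega DT_V : df.
#[export] Hint Extern 1 (DT _ (fun e => mu _)) => apply DT_mu : df.
#[export] Hint Extern 1 (DT _ (fun e => Rec _ _)) => apply DT_Rec : df.

#[global] Opaque mu Rec omega tc V.

(** * Reflection *)

Section Reflection.
Context {M : structure} {Z : ZF M}.
Implicit Types (K : M -> Prop) (a b c x y z t A B C f g h : M) (F H : M -> M).

(* A set [t] codes the environment [fst t, fst (snd t), ...]. *)
Fixpoint dec t (i : nat) : M := match i with 0 => fst t | S k => dec (snd t) k end.
Lemma dec_opair x t : dec (opair x t) = scons x (dec t).
Proof. apply functional_extensionality. intros [|i]; simpl; rewrite ?fst_opair, ?snd_opair; auto. Qed.
Lemma DT_dec K i : forall s, DT K s -> DT K (fun e => dec (s e) i).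
Proof. induction i; intros s Hs; simpl. df. apply (IHi (fun e => snd (s e))). df. Qed.

(** The induction on the formula takes place in the metatheory, one formula at a time, so no truth
    predicate is involved. *)
Lemma D_sat K p : forall T : nat -> (nat -> M) -> M, (forall i, DT K (T i)) ->
  D K (fun e => sat (fun i => T i e) p).
Proof.
  induction p; intros T HT; simpl; try (specialize (IHp1 T HT); specialize (IHp2 T HT)); try df.
  - apply D_all.
    apply D_ext with (fun e => sat (fun i => (fun e => match i with 0 => e 0 | S k => T k (fun n => e (S n)) end) e) p).
    { intro e. match goal with |- sat ?a _ <-> sat ?b _ => replace a with b; [tauto|] end.
      apply functional_extensionality. intros [|i]; auto. }
    apply (IHp (fun i e => match i with 0 => e 0 | S k => T k (fun n => e (S n)) end)).
    intros [|i]. df. apply (DT_ren S); auto.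
  - apply D_ex.
    apply D_ext with (fun e => sat (fun i => (fun e => match i with 0 => e 0 | S k => T k (fun n => e (S n)) end) e) p).
    { intro e. match goal with |- sat ?a _ <-> sat ?b _ => replace a with b; [tauto|] end.
      apply functional_extensionality. intros [|i]; auto. }
    apply (IHp (fun i e => match i with 0 => e 0 | S k => T k (fun n => e (S n)) end)).
    intros [|i]. df. apply (DT_ren S); auto.
Qed.

Fixpoint satX (X : M) (e : nat -> M) (p : form) : Prop :=
  match p with
  | fMem i j => e i ∈ e j
  | fEq i j => e i = e j
  | fBot => False
  | fImp p q => satX X e p -> satX X e q
  | fAnd p q => satX X e p /\ satX X e q
  | fOr p q => satX X e p \/ satX X e q
  | fAll p => forall x, x ∈ X -> satX X (scons x e) p
  | fEx p => exists x, x ∈ X /\ satX X (scons x e) p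
  end.

Definition clo H b := forall c, c ∈ b -> H c ∈ b.
Definition ordfun H := DTf H /\ forall a, Ord a -> Ord (H a).

Lemma ordfun_cup H1 H2 : ordfun H1 -> ordfun H2 -> ordfun (fun a => cup (H1 a) (H2 a)).
Proof.
  intros [D1 O1] [D2 O2]. split; [|auto using Ord_cup].
  apply DT_cup; auto.
Qed.
Lemma clo_cup H1 H2 b : ordfun H1 -> ordfun H2 -> Ord b -> clo (fun a => cup (H1 a) (H2 a)) b -> clo H1 b /\ clo H2 b.
Proof.
  intros [D1 O1] [D2 O2] Hb C. split; intros c Hc; assert (Oc : Ord c) by eauto using Ord_in;
  (eapply Ord_sub_in; [| |auto| |apply C; eauto]; auto using Ord_cup); intros x Hx; apply in_cup; auto.
Qed.

(** The function bounds the least stages at which parameters in [V c] find a witness. A limit closed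
    under it therefore contains witnesses for all of its own parameters. *)
Lemma witness (R : M -> M -> Prop) : D (fun _ => True) (fun e => R (e 0) (e 1)) ->
  exists H, ordfun H /\ forall b, lim b -> clo H b -> forall t, t ∈ V b -> (exists x, R t x) -> exists x, x ∈ V b /\ R t x.
Proof.
  intro HR.
  assert (HR' : forall u w : (nat -> M) -> M, DT (fun _ => True) u -> DT (fun _ => True) w -> D (fun _ => True) (fun e => R (u e) (w e)))
    by (intros; apply D_pred2; auto).
  pose (rk := fun t => mu (fun d => exists x, x ∈ V d /\ R t x)).
  assert (Hrk : DTf rk) by (unfold rk; df).
  assert (Hrk' : forall s, DT (fun _ => True) s -> DT (fun _ => True) (fun e => rk (s e))).
  { intros s Hs. apply (DT_let (F := fun x _ => rk x)); auto. }
  exists (fun c => Un (image (V c) (fun t => suc (rk t)))). split; [split|].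
  - df.
  - intros a Ha. apply Ord_Un. intros x Hx. apply in_image in Hx; [|df]. destruct Hx as (y & _ & ->).
    apply Ord_suc, Ord_mu.
  - intros b Hb Cb t Ht [x Hx]. destruct (V_all x) as (a & Ha & Hxa).
    destruct (@mu_spec _ _ (fun d => exists x, x ∈ V d /\ R t x) a) as (O1 & (x' & Hx1 & Hx2) & _); eauto. { df. }
    exists x'. split; auto. destruct Hb as (Ob & Nb & Sb). apply in_V in Ht; auto. destruct Ht as (c & Hc & Ht).
    assert (G : rk t ∈ b).
    { apply (@Ord_trans _ b _ (Un (image (V (suc c)) (fun t => suc (rk t)))) Ob).
      - apply in_Un. exists (suc (rk t)). split; [|apply in_suc; auto]. apply in_image; [df|].
        exists t. split; auto. apply in_V; [apply Ord_suc; eauto using Ord_in|]. exists c. rewrite in_suc. auto.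
      - apply Cb. auto. }
    apply (V_mono Ob (a := rk t)); eauto using Ord_in. intros z Hz. eauto using Ord_trans.
Qed.

(** Each quantifier contributes a closure function, for counterexamples in the universal case, and
    unions combine them. Limit stages are used because pushing a value onto a coded environment
    forms a pair, which must stay in [V b]. *)
Lemma reflection p : exists H, ordfun H /\
  forall b, lim b -> clo H b -> forall t, t ∈ V b -> (sat (dec t) p <-> satX (V b) (dec t) p).
Proof.
  assert (Hid : exists H, ordfun H).
  { exists (fun a => a). split; auto. df. }
  assert (Hbin : forall p1 p2 (c : form -> form -> form),
     (forall b t, (sat (dec t) p1 <-> satX (V b) (dec t) p1) -> (sat (dec t) p2 <-> satX (V b) (dec t) p2) ->
        (sat (dec t) (c p1 p2) <-> satX (V b) (dec t) (c p1 p2))) ->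
     (exists H, ordfun H /\ forall b, lim b -> clo H b -> forall t, t ∈ V b -> (sat (dec t) p1 <-> satX (V b) (dec t) p1)) ->
     (exists H, ordfun H /\ forall b, lim b -> clo H b -> forall t, t ∈ V b -> (sat (dec t) p2 <-> satX (V b) (dec t) p2)) ->
     exists H, ordfun H /\ forall b, lim b -> clo H b -> forall t, t ∈ V b -> (sat (dec t) (c p1 p2) <-> satX (V b) (dec t) (c p1 p2))).
  { intros p1 p2 c Hc (H1 & O1 & R1) (H2 & O2 & R2).
    exists (fun a => cup (H1 a) (H2 a)). split; [apply ordfun_cup; auto|].
    intros b Hb Cb t Ht. apply clo_cup in Cb; auto; [|apply Hb]. destruct Cb. apply Hc; auto. }
  assert (HdR : forall q (c : Prop -> Prop), (forall P, D (fun _ => True) P -> D (fun _ => True) (fun e : nat -> M => c (P e))) ->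
     D (fun _ => True) (fun e : nat -> M => c (sat (scons (e 1) (dec (e 0))) q))).
  { intros q c Hc. apply Hc.
    apply D_ext with (fun e => sat (fun i => (fun e => match i with 0 => e 1 | S k => dec (e 0) k end) e) q).
    { intro e. match goal with |- sat ?a _ <-> sat ?b _ => replace a with b; [tauto|] end.
      apply functional_extensionality. intros [|i]; auto. }
    apply (@D_sat _ _ (fun i e => match i with 0 => e 1 | S k => dec (e 0) k end)).
    intros [|i]. df. apply (@DT_dec _ i (fun e => e 0)). df. }
  induction p; try (destruct Hid as (H & OH); exists H; split; auto; intros; simpl; tauto).
  - apply Hbin; auto. intros; simpl; tauto.
  - apply Hbin; auto. intros; simpl; tauto.
  - apply Hbin; auto. intros; simpl; tauto.
  - destruct IHp as (H1 & O1 & R1).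
    destruct (@witness (fun t x => ~ sat (scons x (dec t)) p)) as (H2 & O2 & R2). { apply (HdR p not). intros. df. }
    exists (fun a => cup (H1 a) (H2 a)). split; [apply ordfun_cup; auto|].
    intros b Hb Cb t Ht. apply clo_cup in Cb; auto; [|apply Hb]. destruct Cb as [C1 C2].
    assert (G : forall x, x ∈ V b -> (sat (scons x (dec t)) p <-> satX (V b) (scons x (dec t)) p)).
    { intros x Hx. rewrite <- dec_opair. apply R1; auto using V_lim_opair. }
    simpl. split.
    + intros A x Hx. apply G; auto.
    + intros A x. apply NNPP. intro N. destruct (R2 b Hb C2 t Ht) as (x' & Hx' & Nx'); eauto.
      apply Nx'. apply G; auto.
  - destruct IHp as (H1 & O1 & R1).
    destruct (@witness (fun t x => sat (scons x (dec t)) p)) as (H2 & O2 & R2). { apply (HdR p (fun P => P)). auto. }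
    exists (fun a => cup (H1 a) (H2 a)). split; [apply ordfun_cup; auto|].
    intros b Hb Cb t Ht. apply clo_cup in Cb; auto; [|apply Hb]. destruct Cb as [C1 C2].
    assert (G : forall x, x ∈ V b -> (sat (scons x (dec t)) p <-> satX (V b) (scons x (dec t)) p)).
    { intros x Hx. rewrite <- dec_opair. apply R1; auto using V_lim_opair. }
    simpl. split.
    + intro A. destruct (R2 b Hb C2 t Ht A) as (x' & Hx' & Nx'). exists x'. split; auto. apply G; auto.
    + intros (x & Hx & A). exists x. apply G; auto.
Qed.

(** Iterate omega times the passage from an ordinal [s] to one above [s] and above all values of [H]
    on [s]; the union of the stages is closed. *)
Lemma clo_ex H a0 : ordfun H -> Ord a0 -> exists b, lim b /\ a0 ∈ b /\ clo H b.
Proof.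
  intros [DH OH] Ha0.
  assert (DH' : forall s, DT (fun _ => True) s -> DT (fun _ => True) (fun e => H (s e))).
  { intros s Hs. apply (DT_let (F := fun x _ => H x)); auto. }
  pose (T := fun s => suc (cup s (Un (image s H)))).
  assert (DTT : forall s, DT (fun _ => True) s -> DT (fun _ => True) (fun e => T (s e))) by (intros; unfold T; df).
  pose (Sq := fun xi => Rec (fun h => cup (suc a0) (Un (image h (fun z => T (snd z))))) xi).
  assert (DSq : DTf Sq) by (unfold Sq; df).
  assert (inS : forall xi x, Ord xi -> x ∈ Sq xi <-> x ∈ suc a0 \/ exists b, b ∈ xi /\ x ∈ T (Sq b)).
  { intros xi x Hxi. unfold Sq at 1. rewrite Rec_eq; [|df|auto]. rewrite in_cup.
    rewrite (@in_Un_lam _ _ xi _ T); [|df|df]. reflexivity. }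
  assert (OT : forall s, Ord s -> Ord (T s)).
  { intros s Hs. apply Ord_suc, Ord_cup; auto. apply Ord_Un. intros x Hx. apply in_image in Hx; auto.
    destruct Hx as (y & Hy & ->). eauto using Ord_in. }
  assert (OS : forall xi, Ord xi -> Ord (Sq xi)).
  { apply (Ord_ind (P := fun xi => Ord (Sq xi))). { unfold Sq; df. }
    intros xi Hxi IH. split.
    + intros x Hx y Hy. apply inS in Hx; auto. apply inS; auto. destruct Hx as [Hx|(b & Hb & Hx)].
      * left. apply (Ord_trans (Ord_suc Ha0) Hy Hx).
      * right. exists b. split; auto. apply (Ord_trans (OT _ (IH b Hb)) Hy Hx).
    + intros x Hx. apply inS in Hx; auto. destruct Hx as [Hx|(b & Hb & Hx)].
      * destruct (Ord_in (Ord_suc Ha0) Hx); auto.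
      * destruct (Ord_in (OT _ (IH b Hb)) Hx); auto. }
  assert (G : forall x, x ∈ Sq omega -> exists n, n ∈ omega /\ Ord n /\ x ∈ Sq n).
  { intros x Hx. apply inS in Hx; [|apply Ord_omega]. destruct Hx as [Hx|(n & Hn & Hx)].
    - exists emp. split; [apply emp_lim, lim_omega|]. split; [apply Ord_emp|]. apply inS; auto using Ord_emp.
    - exists (suc n). split; [apply lim_omega; auto|]. assert (Ord (suc n)) by eauto using Ord_suc, Ord_in, Ord_omega.
      split; auto. apply inS; auto. right. exists n. rewrite in_suc. auto. }
  assert (a0S : a0 ∈ Sq omega). { apply inS; [apply Ord_omega|]. rewrite in_suc. auto. }
  exists (Sq omega). split; [split; [|split]|split].
  - apply OS, Ord_omega.
  - exists a0; auto.
  - intros x Hx. destruct (G x Hx) as (n & Hn & On & Hxn). apply inS; [apply Ord_omega|]. right. exists n. split; auto.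
    apply in_suc. assert (O1 : Ord (cup (Sq n) (Un (image (Sq n) H)))).
    { apply Ord_cup; auto. apply Ord_Un. intros y Hy. apply in_image in Hy; auto. destruct Hy as (w & Hw & ->). eauto using Ord_in. }
    apply Ord_sub; auto. { apply Ord_suc. eauto using Ord_in. }
    apply suc_sub; auto. apply in_cup; auto.
  - auto.
  - intros c Hc. destruct (G c Hc) as (n & Hn & On & Hxn). apply inS; [apply Ord_omega|]. right. exists n. split; auto.
    apply in_suc. assert (O1 : Ord (cup (Sq n) (Un (image (Sq n) H)))).
    { apply Ord_cup; auto. apply Ord_Un. intros y Hy. apply in_image in Hy; auto. destruct Hy as (w & Hw & ->). eauto using Ord_in. }
    apply Ord_sub; auto. { eauto using Ord_in. }
    intros y Hy. apply in_cup. right. apply in_Un. exists (H c). split; auto. apply in_image; eauto.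
Qed.
End Reflection.

(** * Enumerating the sets ordinal definable from a parameter *)

Section Enumeration.
Context {M : structure} {Z : ZF M}.
Implicit Types (K : M -> Prop) (a b c x y z t A B C f g h m q : M) (F H : M -> M).

(* [GG] enumerates all quadruples of ordinals in order type Ord, ordered first
   by the least ordinal above the entries. *)
Definition op4 (i j k l : M) := opair i (opair j (opair k l)).
Lemma op4_inj i j k l i' j' k' l' : op4 i j k l = op4 i' j' k' l' -> i = i' /\ j = j' /\ k = k' /\ l = l'.
Proof. unfold op4. intro E. do 3 (apply opair_inj in E; destruct E as [? E]). auto. Qed.
Lemma DT_op4 K (s t u v : (nat -> M) -> M) : DT K s -> DT K t -> DT K u -> DT K v ->
  DT K (fun e => op4 (s e) (t e) (u e) (v e)).
Proof. unfold op4. intros. df. Qed.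
Hint Resolve DT_op4 : df.
Definition free (R m i j k l : M) := i ∈ m /\ j ∈ m /\ k ∈ m /\ l ∈ m /\ ~ op4 i j k l ∈ R.
Definition next R :=
  let m := mu (fun m => exists i j k l, free R m i j k l) in
  let i := mu (fun i => exists j k l, free R m i j k l) in
  let j := mu (fun j => exists k l, free R m i j k l) in
  let k := mu (fun k => exists l, free R m i j k l) in
  let l := mu (fun l => free R m i j k l) in op4 i j k l.
Lemma DT_next K s : DT K s -> DT K (fun e => next (s e)).
Proof. apply DT_op1. unfold next. unfold free. df. Qed.
Hint Resolve DT_next : df.

Lemma next_spec R : exists m i j k l, Ord m /\ next R = op4 i j k l /\ free R m i j k l /\
  forall m' i' j' k' l', Ord m' -> free R m' i' j' k' l' -> subset m m'.
Proof.
  destruct (no_Ord_set (image R fst)) as (a & Ha & Na).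
  assert (F0 : free R (suc a) a a a a).
  { assert (a ∈ suc a) by (apply in_suc; auto). unfold free. intuition. apply Na. apply in_image; [df|].
    exists (op4 a a a a). split; auto. unfold op4. rewrite fst_opair; auto. }
  unfold next.
  destruct (@mu_spec _ _ (fun m => exists i j k l, free R m i j k l) (suc a)) as (Om & Fm & Mm);
    [unfold free; df|apply Ord_suc; auto|eauto 6|].
  set (m := mu (fun m => exists i j k l, free R m i j k l)) in *.
  destruct Fm as (i0 & Fi).
  destruct (@mu_spec _ _ (fun i => exists j k l, free R m i j k l) i0) as (_ & Fi' & _); auto;
    [unfold free; df|destruct Fi as (?&?&?&Fi); apply (Ord_in Om); apply Fi|].
  set (i := mu (fun i => exists j k l, free R m i j k l)) in *. clear Fi. destruct Fi' as (j0 & Fi).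
  destruct (@mu_spec _ _ (fun j => exists k l, free R m i j k l) j0) as (_ & Fi' & _); auto;
    [unfold free; df|destruct Fi as (?&?&Fi); apply (Ord_in Om); apply Fi|].
  set (j := mu (fun j => exists k l, free R m i j k l)) in *. clear Fi. destruct Fi' as (k0 & Fi).
  destruct (@mu_spec _ _ (fun k => exists l, free R m i j k l) k0) as (_ & Fi' & _); auto;
    [unfold free; df|destruct Fi as (?&Fi); apply (Ord_in Om); apply Fi|].
  set (k := mu (fun k => exists l, free R m i j k l)) in *. clear Fi. destruct Fi' as (l0 & Fi).
  destruct (@mu_spec _ _ (fun l => free R m i j k l) l0) as (_ & Fi' & _); auto;
    [unfold free; df|apply (Ord_in Om); apply Fi|].
  set (l := mu (fun l => free R m i j k l)) in *.
  exists m, i, j, k, l. split; auto. split; auto. split; auto.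
  intros m' i' j' k' l' Hm' H'. apply Mm; eauto 6.
Qed.

Opaque next.
Definition GG a := Rec (fun h => next (image h (fun z => snd z))) a.
Lemma DT_GG K s : DT K s -> DT K (fun e => GG (s e)).
Proof. unfold GG. intros. df. Qed.
Hint Resolve DT_GG : df.
Lemma GG_eq a : Ord a -> GG a = next (image a (fun x => GG x)).
Proof.
  intro Ha. unfold GG at 1. rewrite Rec_eq; [|df|auto]. f_equal. apply ext. intro x.
  rewrite !in_image by df. split.
  - intros (z & Hz & ->). apply in_lam in Hz; [|fold GG; df]. destruct Hz as (w & Hw & ->). rewrite snd_opair. eauto.
  - intros (w & Hw & ->). exists (opair w (GG w)). rewrite snd_opair. split; auto. apply in_lam; [fold GG; df|eauto].
Qed.
Opaque GG.
Lemma GG_spec a : Ord a -> exists m i j k l, Ord m /\ GG a = op4 i j k l /\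
  i ∈ m /\ j ∈ m /\ k ∈ m /\ l ∈ m /\ (forall b, b ∈ a -> GG b <> GG a) /\
  forall m' i' j' k' l', Ord m' -> i' ∈ m' -> j' ∈ m' -> k' ∈ m' -> l' ∈ m' ->
    (forall b, b ∈ a -> GG b <> op4 i' j' k' l') -> subset m m'.
Proof.
  intro Ha. rewrite GG_eq by auto. destruct (next_spec (image a (fun x => GG x))) as (m & i & j & k & l & Om & E & Fr & Mm).
  destruct Fr as (Hi & Hj & Hk & Hl & N).
  exists m, i, j, k, l. split; auto. split; auto. split; auto. split; auto. split; auto. split; auto. split.
  - intros b Hb E'. apply N. apply in_image; [df|]. exists b. split; [auto|congruence].
  - intros m' i' j' k' l' Hm' Hi' Hj' Hk' Hl' H. refine (Mm m' i' j' k' l' Hm' _).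
    split; [auto|split; [auto|split; [auto|split; [auto|]]]]. intro G. apply in_image in G; [|df].
    destruct G as (b & Hb & G). apply (H b); auto.
Qed.
Lemma GG_inj a b : Ord a -> Ord b -> GG a = GG b -> a = b.
Proof.
  intros Ha Hb E. destruct (Ord_tri Ha Hb) as [H|[H|H]]; auto; exfalso.
  - destruct (GG_spec Hb) as (m & i & j & k & l & _ & _ & _ & _ & _ & _ & N & _). apply (N a); auto.
  - destruct (GG_spec Ha) as (m & i & j & k & l & _ & _ & _ & _ & _ & _ & N & _). apply (N b); [auto|symmetry; exact E].
Qed.
Definition q4 m := prod m (prod m (prod m m)).
Lemma in_q4 i j k l m : op4 i j k l ∈ q4 m <-> i ∈ m /\ j ∈ m /\ k ∈ m /\ l ∈ m.
Proof. unfold q4, op4. rewrite !opair_prod. tauto. Qed.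
(** Quadruples with entries below [m] precede all others. This bounds initial segments of the
    enumeration in [square_le]. *)
Lemma GG_below a b m : Ord a -> Ord m -> b ∈ a -> GG a ∈ q4 m -> GG b ∈ q4 m.
Proof.
  intros Ha Hm Hb H. destruct (GG_spec Ha) as (m1 & i & j & k & l & Om & E & Hi & Hj & Hk & Hl & N & Mm).
  assert (Ob : Ord b) by eauto using Ord_in.
  destruct (GG_spec Ob) as (m2 & i' & j' & k' & l' & Om' & E' & Hi' & Hj' & Hk' & Hl' & N' & Mm').
  rewrite E in H. apply in_q4 in H. destruct H as (H1 & H2 & H3 & H4).
  assert (S : subset m2 m).
  { apply (Mm' m i j k l); auto. intros c Hc Ec. apply (N c); [eauto using Ord_trans|congruence]. }
  rewrite E'. apply in_q4. auto.
Qed.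
(** A missing quadruple below [m] would always be a candidate, so all values would stay inside the
    set [q4 m], and inverting [GG] would make the ordinals a set. *)
Lemma GG_onto i j k l : Ord i -> Ord j -> Ord k -> Ord l -> exists a, Ord a /\ GG a = op4 i j k l.
Proof.
  intros Hi Hj Hk Hl. apply NNPP. intro N.
  destruct (@Ord_sup _ _ (cup (upair i j) (upair k l))) as (m & Hm & Hsup).
  { intros x Hx. apply in_cup in Hx. rewrite !in_upair in Hx. intuition; subst; auto. }
  assert (G : forall a, Ord a -> GG a ∈ q4 m).
  { intros a Ha. destruct (GG_spec Ha) as (m1 & i1 & j1 & k1 & l1 & Om & E & Hi1 & Hj1 & Hk1 & Hl1 & N1 & Mm).
    assert (S : subset m1 m).
    { apply (Mm m i j k l); auto; try (apply Hsup; rewrite in_cup, !in_upair; tauto).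
      intros b Hb Eb. apply N. exists b. split; eauto using Ord_in. }
    rewrite E. apply in_q4. auto. }
  destruct (no_Ord_set (image (q4 m) (fun z => the (fun a => Ord a /\ GG a = z) emp))) as (a & Ha & Na).
  apply Na. apply in_image; [df|]. exists (GG a). split; auto. symmetry. apply the_eq; auto.
  intros b [Hb Eb]. apply GG_inj; auto.
Qed.
(** The fourth entry is a counter without meaning: only a set of its values occurs before [b], so a
    fresh one places the other three entries at or after [b]. *)
Lemma GG_cofinal i j k b : Ord i -> Ord j -> Ord k -> Ord b ->
  exists a l, Ord a /\ subset b a /\ GG a = op4 i j k l.
Proof.
  intros Hi Hj Hk Hb.
  destruct (no_Ord_set (image b (fun a => snd (snd (snd (GG a)))))) as (l & Hl & Nl).
  destruct (GG_onto Hi Hj Hk Hl) as (a & Ha & E). exists a, l. split; auto. split; auto.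
  apply Ord_nlt; auto. intro H. apply Nl. apply in_image; [df|]. exists a. split; auto.
  rewrite E. unfold op4. rewrite !snd_opair. auto.
Qed.

(** * Closure under the operations that generate definable sets *)

Fixpoint num (n : nat) : M := match n with 0 => emp | S n => suc (num n) end.
Lemma DT_num K n : DT K (fun _ => num n).
Proof. induction n; simpl; df. Qed.
Lemma Ord_num n : Ord (num n).
Proof. induction n; simpl; auto using Ord_emp, Ord_suc. Qed.
Lemma num_lt (n k : nat) : n < k -> num n ∈ num k.
Proof. induction 1; simpl; apply in_suc; auto. Qed.
Lemma num_inj (n k : nat) : num n = num k -> n = k.
Proof.
  intro E. destruct (Nat.lt_trichotomy n k) as [H|[H|H]]; auto; exfalso; apply num_lt in H; rewrite E in H;
  apply (mem_irr H).
Qed.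

(** The logical operations acting on sets of coded environments: [proj] is existential
    quantification, [pull] inserts a dummy variable at place 0 and [ins] at place 1, [swap]
    exchanges places 0 and 1, and [sect] fixes all places but the first. They replace a
    formalisation of syntax inside the model. *)
Definition proj a b := sep b (fun t => exists x, x ∈ b /\ opair x t ∈ a).
Definition pull a b := sep b (fun t => snd t ∈ a).
Definition swap a b := sep b (fun t => opair (fst (snd t)) (opair (fst t) (snd (snd t))) ∈ a).
Definition ins a b := sep b (fun t => opair (fst t) (snd (snd t)) ∈ a).
Definition mem01 b := sep b (fun t => fst t ∈ fst (snd t)).
Definition eq01 b := sep b (fun t => fst t = fst (snd t)).
Definition sect a b := sep (Un (Un a)) (fun x => opair x b ∈ a).

Fixpoint sel (s : list M) (n : nat) i : M :=
  match s with nil => emp | x :: s => if excluded_middle_informative (i = num n) then x else sel s (S n) i end.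
Lemma sel_nth s : forall n k : nat, sel s n (num (n + k)) = nth k s emp.
Proof.
  induction s as [|x s IH]; intros n k; simpl.
  - destruct k; auto.
  - destruct (excluded_middle_informative _) as [E|E].
    + apply num_inj in E. replace k with 0 by lia. auto.
    + destruct k as [|k]. { rewrite Nat.add_0_r in E. tauto. } replace (n + S k) with (S n + k) by lia. apply IH.
Qed.
Variable p : M.
(* The values of [En] are closed under these operations because [GG] enumerates every pair of
   earlier indices with every operation number cofinally often. *)
Definition ops j a b : list M :=
  V j :: p :: j :: diff a b :: proj a b :: pull a b :: swap a b :: ins a b :: mem01 b :: eq01 b ::
  opair a b :: sect a b :: nil.
Definition StEn h := let q := GG (domf h) in let j := fst (snd q) in let k := fst (snd (snd q)) in
   if excluded_middle_informative (j ∈ domf h /\ k ∈ domf h) then sel (ops j (ap h j) (ap h k)) 0 (fst q) else emp.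
Definition En a := Rec (fun h => StEn h) a.
(** Ordinal definability from [p], stated through an enumeration and hence by a single formula;
    every set obtained this way has a least index, which later serves as its code. *)
Definition OD x := exists a, Ord a /\ En a = x.

Hint Resolve DT_num : df.
Hint Extern 0 True => exact I : df.
Lemma DT_StEn K s : K p -> DT K s -> DT K (fun e => StEn (s e)).
Proof.
  intros Hp. apply DT_op1. change (DT K (fun e => StEn (e 0))).
  unfold StEn, ops, sel, proj, pull, swap, ins, mem01, eq01, sect. cbv zeta. df.
Qed.
Hint Resolve DT_StEn : df.
Lemma DT_En K s : K p -> DT K s -> DT K (fun e => En (s e)).
Proof. unfold En. intros Hp Hs. df. Qed.
Hint Resolve DT_En : df.
Lemma D_OD K s : K p -> DT K s -> D K (fun e => OD (s e)).
Proof. intros Hp. apply D_pred1. unfold OD. df. Qed.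
Hint Resolve D_OD : df.

Lemma En_eq a : Ord a -> En a = StEn (lam a (fun x => En x)).
Proof. intro Ha. unfold En at 1. rewrite Rec_eq; [reflexivity|df|auto]. Qed.
Opaque En.
Lemma OD_op n j k : Ord j -> Ord k -> OD (nth n (ops j (En j) (En k)) emp).
Proof.
  (* The index is taken above both arguments, so that their values are already available to the
     recursion. *)
  intros Hj Hk. destruct (@GG_cofinal (num n) j k (suc (cup j k))) as (a & l & Ha & Hs & E); auto using Ord_num, Ord_suc, Ord_cup.
  assert (Hja : j ∈ a /\ k ∈ a).
  { split; apply Hs; apply in_suc; apply Ord_sub; auto using Ord_cup; intros x Hx; apply in_cup; auto. }
  exists a. split; auto. rewrite En_eq by auto. unfold StEn. cbv zeta.
  rewrite domf_lam by df. rewrite E. unfold op4. rewrite !snd_opair, !fst_opair.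
  destruct (excluded_middle_informative _) as [_|N]; [|tauto].
  rewrite !ap_lam by (df || tauto). apply (sel_nth _ 0 n).
Qed.
Lemma OD_V j : Ord j -> OD (V j).
Proof. intro. apply (@OD_op 0 j j); auto. Qed.
Lemma OD_p : OD p.
Proof. apply (@OD_op 1 emp emp); auto using Ord_emp. Qed.
Lemma OD_Ord j : Ord j -> OD j.
Proof. intro. apply (@OD_op 2 j j); auto. Qed.
Lemma OD_bin n a b : OD a -> OD b -> 3 <= n -> OD (nth n (ops emp a b) emp).
Proof.
  intros (x & Hx & <-) (y & Hy & <-) Hn. replace (nth n (ops emp (En x) (En y)) emp) with (nth n (ops x (En x) (En y)) emp).
  apply OD_op; auto. destruct n as [|[|[|n]]]; try lia. reflexivity.
Qed.
Lemma OD_diff a b : OD a -> OD b -> OD (diff a b). Proof. intros. apply (@OD_bin 3); auto. Qed.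
Lemma OD_proj a b : OD a -> OD b -> OD (proj a b). Proof. intros. apply (@OD_bin 4); auto; lia. Qed.
Lemma OD_pull a b : OD a -> OD b -> OD (pull a b). Proof. intros. apply (@OD_bin 5); auto; lia. Qed.
Lemma OD_swap a b : OD a -> OD b -> OD (swap a b). Proof. intros. apply (@OD_bin 6); auto; lia. Qed.
Lemma OD_ins a b : OD a -> OD b -> OD (ins a b). Proof. intros. apply (@OD_bin 7); auto; lia. Qed.
Lemma OD_mem01 b : OD b -> OD (mem01 b). Proof. intros. apply (@OD_bin 8 b b); auto; lia. Qed.
Lemma OD_eq01 b : OD b -> OD (eq01 b). Proof. intros. apply (@OD_bin 9 b b); auto; lia. Qed.
Lemma OD_opair a b : OD a -> OD b -> OD (opair a b). Proof. intros. apply (@OD_bin 10); auto; lia. Qed.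
Lemma OD_sect a b : OD a -> OD b -> OD (sect a b). Proof. intros. apply (@OD_bin 11); auto; lia. Qed.

Ltac replace_OD H :=
  match type of H with OD ?u => match goal with |- OD ?v => replace v with u; auto end end.

Transparent the fst snd.
Lemma V_lim_fst b t : lim b -> t ∈ V b -> fst t ∈ V b.
Proof.
  intros Hb Ht. unfold fst, the. destruct (excluded_middle_informative _) as [E|]; [|apply V_Ord; [apply Hb|apply emp_lim; auto]].
  assert (G : exists c, t = opair (epsilon (inhabits emp) (fun a => exists b, t = opair a b)) c).
  { apply (@epsilon_spec _ (inhabits emp) (fun a => exists b, t = opair a b)). destruct E as (x & Hx & _). eauto. }
  destruct G as (c & G). revert G. generalize (epsilon (inhabits emp) (fun a => exists b, t = opair a b)). intros x ->.
  assert (T : transitive_set (V b)) by (apply V_trans, Hb).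
  apply (T (sing x)); [apply (T (opair x c)); auto; apply in_upair; auto|apply in_sing; auto].
Qed.
Lemma V_lim_snd b t : lim b -> t ∈ V b -> snd t ∈ V b.
Proof.
  intros Hb Ht. unfold snd, the. destruct (excluded_middle_informative _) as [E|]; [|apply V_Ord; [apply Hb|apply emp_lim; auto]].
  assert (G : exists c, t = opair c (epsilon (inhabits emp) (fun b => exists a, t = opair a b))).
  { apply (@epsilon_spec _ (inhabits emp) (fun b => exists a, t = opair a b)). destruct E as (x & Hx & _). eauto. }
  destruct G as (c & G). revert G. generalize (epsilon (inhabits emp) (fun b => exists a, t = opair a b)). intros x ->.
  assert (T : transitive_set (V b)) by (apply V_trans, Hb).
  apply (T (upair c x)); [apply (T (opair c x)); auto; apply in_upair; auto|apply in_upair; auto].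
Qed.

Opaque the fst snd.
(** All pairs of places are reached from three: [ins] raises the nonzero index by one while the
    other stays 0, and [pull] raises both. *)
Lemma OD_atom b (R : M -> M -> Prop) : lim b -> D (fun _ => True) (fun e => R (e 0) (e 1)) ->
  OD (sep (V b) (fun t => R (fst t) (fst t))) -> OD (sep (V b) (fun t => R (fst t) (fst (snd t)))) ->
  OD (sep (V b) (fun t => R (fst (snd t)) (fst t))) ->
  forall i j : nat, OD (sep (V b) (fun t => R (dec t i) (dec t j))).
Proof.
  intros Hb HR H00 H01 H10.
  assert (OV : OD (V b)) by (apply OD_V, Hb).
  assert (HR' : forall s t : (nat -> M) -> M, DT (fun _ => True) s -> DT (fun _ => True) t -> D (fun _ => True) (fun e => R (s e) (t e)))
    by (intros; apply D_pred2; auto).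
  assert (HD : forall (i : nat) s, DT (fun _ => True) s -> DT (fun _ => True) (fun e : nat -> M => dec (s e) i)) by (intros; apply DT_dec; auto).
  assert (H0 : forall j : nat, OD (sep (V b) (fun t => R (fst t) (dec t (S j)))) /\ OD (sep (V b) (fun t => R (dec t (S j)) (fst t)))).
  { induction j as [|j [IH1 IH2]]; [auto|]. apply OD_ins with (b := V b) in IH1, IH2; auto. split.
    - replace_OD IH1.
      apply ext. intro t. unfold ins. rewrite !in_sep by df. simpl. rewrite !snd_opair, !fst_opair.
      split; [tauto|]. intros [Ht H]. split; auto. split; auto. auto 10 using V_lim_opair, V_lim_fst, V_lim_snd.
    - replace_OD IH2.
      apply ext. intro t. unfold ins. rewrite !in_sep by df. simpl. rewrite !snd_opair, !fst_opair.
      split; [tauto|]. intros [Ht H]. split; auto. split; auto. auto 10 using V_lim_opair, V_lim_fst, V_lim_snd. }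
  induction i as [|i IH]; intros [|j].
  - exact H00.
  - apply H0.
  - apply H0.
  - specialize (IH j). apply OD_pull with (b := V b) in IH; auto.
    replace_OD IH.
    apply ext. intro t. unfold pull. rewrite !in_sep by df. simpl.
    split; [tauto|]. intros [Ht H]. split; auto. split; auto. auto 10 using V_lim_opair, V_lim_fst, V_lim_snd.
Qed.

Lemma D_satX K (q : form) : forall (X : (nat -> M) -> M) (T : nat -> (nat -> M) -> M), DT K X -> (forall i : nat, DT K (T i)) ->
  D K (fun e => satX (X e) (fun i => T i e) q).
Proof.
  induction q as [i j|i j| |q1 IH1 q2 IH2|q1 IH1 q2 IH2|q1 IH1 q2 IH2|q IH|q IH]; intros X T HX HT; simpl;
    try (specialize (IH1 X T HX HT); specialize (IH2 X T HX HT)); try df.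
  - apply D_all. apply D_imp. { apply (DT_ren S) in HX. df. }
    apply D_ext with (fun e => satX (X (fun n => e (S n))) (fun i => (fun e => match i with 0 => e 0 | S r => T r (fun n => e (S n)) end) e) q).
    { intro e. match goal with |- satX _ ?a _ <-> satX _ ?b _ => replace a with b; [tauto|] end.
      apply functional_extensionality. intros [|r]; auto. }
    apply (IH (fun e => X (fun n => e (S n))) (fun i e => match i with 0 => e 0 | S r => T r (fun n => e (S n)) end)).
    apply (DT_ren S); auto. intros [|r]. df. apply (DT_ren S); auto.
  - apply D_ex. apply D_and. { apply (DT_ren S) in HX. df. }
    apply D_ext with (fun e => satX (X (fun n => e (S n))) (fun i => (fun e => match i with 0 => e 0 | S r => T r (fun n => e (S n)) end) e) q).
    { intro e. match goal with |- satX _ ?a _ <-> satX _ ?b _ => replace a with b; [tauto|] end.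
      apply functional_extensionality. intros [|r]; auto. }
    apply (IH (fun e => X (fun n => e (S n))) (fun i e => match i with 0 => e 0 | S r => T r (fun n => e (S n)) end)).
    apply (DT_ren S); auto. intros [|r]. df. apply (DT_ren S); auto.
Qed.

(** Connectives become differences, an existential quantifier becomes a projection, and a universal
    one the complement of the projection of a complement. *)
Lemma OD_satX b (q : form) : lim b -> OD (sep (V b) (fun t => satX (V b) (dec t) q)).
Proof.
  intro Hb. assert (OV : OD (V b)) by (apply OD_V, Hb).
  assert (HS : forall (q : form) s, DT (fun _ => True) s -> D (fun _ => True) (fun e => satX (V b) (dec (s e)) q)).
  { intros q' s Hs. apply (@D_satX _ q' (fun _ => V b) (fun i e => dec (s e) i)). df. intro i. apply DT_dec. auto. }
  assert (HS1 : forall (q : form) s (u : (nat -> M) -> M), DT (fun _ => True) s -> DT (fun _ => True) u ->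
      D (fun _ => True) (fun e => satX (V b) (scons (u e) (dec (s e))) q)).
  { intros q' s u Hs Hu. apply D_ext with (fun e => satX (V b) (dec (opair (u e) (s e))) q').
    intro. rewrite dec_opair. tauto. apply HS. df. }
  assert (HE : OD emp) by (apply OD_Ord, Ord_emp).
  induction q as [i j|i j| |q1 IH1 q2 IH2|q1 IH1 q2 IH2|q1 IH1 q2 IH2|q IH|q IH]; simpl.
  - apply (@OD_atom b (fun x y => x ∈ y)); auto. df.
    + replace (sep _ _) with emp; auto. apply ext. intro x. rewrite in_sep by df. split; intro H; [destruct (in_emp H)|].
      destruct H as [_ H]. destruct (mem_irr H).
    + apply OD_mem01; auto.
    + assert (G := OD_mem01 OV). apply OD_swap with (b := V b) in G; auto.
      replace_OD G.
      apply ext. intro t. unfold swap, mem01. rewrite !in_sep by df. simpl. rewrite !snd_opair, !fst_opair.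
      split; [tauto|]. intros [Ht H]. split; auto. split; auto. auto 10 using V_lim_opair, V_lim_fst, V_lim_snd.
  - apply (@OD_atom b (fun x y => x = y)); auto. df.
    + replace (sep _ _) with (V b); auto. apply ext. intro x. rewrite in_sep by df. tauto.
    + apply OD_eq01; auto.
    + assert (G := OD_eq01 OV). replace_OD G.
      apply ext. intro t. unfold eq01. rewrite !in_sep by df. intuition.
  - replace (sep _ _) with emp; auto. apply ext. intro x. rewrite in_sep by df. split; intro H; [destruct (in_emp H)|tauto].
  - assert (G := OD_diff OV (OD_diff IH1 IH2)).
    replace_OD G.
    apply ext. intro t. rewrite !in_diff. rewrite !in_sep by df. destruct (classic (satX (V b) (dec t) q2)); tauto.
  - assert (G := OD_diff IH1 (OD_diff OV IH2)).
    replace_OD G.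
    apply ext. intro t. rewrite !in_diff. rewrite !in_sep by df. destruct (classic (satX (V b) (dec t) q2)); tauto.
  - assert (G := OD_diff OV (OD_diff (OD_diff OV IH1) IH2)).
    replace_OD G.
    apply ext. intro t. rewrite !in_diff. rewrite !in_sep by df.
    destruct (classic (satX (V b) (dec t) q2)); destruct (classic (satX (V b) (dec t) q1)); tauto.
  - assert (G := OD_diff OV (OD_proj (OD_diff OV IH) OV)).
    replace_OD G.
    apply ext. intro t. rewrite !in_diff. unfold proj. rewrite !in_sep by df. split.
    + intros [Ht N]. split; auto. intros x Hx. apply NNPP. intro N'. apply N. split; auto. exists x. split; auto.
      apply in_diff. split; auto using V_lim_opair. rewrite in_sep by df. rewrite dec_opair. tauto.
    + intros [Ht A]. split; auto. intros (_ & x & Hx & H). apply in_diff in H. destruct H as [_ H]. apply H.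
      rewrite in_sep by df. rewrite dec_opair. auto using V_lim_opair.
  - assert (G := OD_proj IH OV).
    replace_OD G.
    apply ext. intro t. unfold proj. rewrite !in_sep by df. split.
    + intros (Ht & x & Hx & H). split; auto. exists x. split; auto. rewrite in_sep in H by df. rewrite dec_opair in H. tauto.
    + intros (Ht & x & Hx & H). split; auto. exists x. split; auto. rewrite in_sep by df. rewrite dec_opair. auto using V_lim_opair.
Qed.

(** An environment is an infinite sequence of the metatheory; with only finitely many places
    relevant, its constants fit into one tuple of the model. *)
Lemma sat_bound (q : form) : exists N, forall e e' : nat -> M, (forall i : nat, i < N -> e i = e' i) -> (sat e q <-> sat e' q).
Proof.
  induction q as [i j|i j| |q1 [N1 IH1] q2 [N2 IH2]|q1 [N1 IH1] q2 [N2 IH2]|q1 [N1 IH1] q2 [N2 IH2]|q [N IH]|q [N IH]].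
  1-2: exists (S (i + j)); intros e e' H; simpl; rewrite !H by lia; tauto.
  - exists 0. simpl. tauto.
  - exists (N1 + N2). intros e e' H. simpl. rewrite (IH1 e e'), (IH2 e e'); [tauto| |]; intros; apply H; lia.
  - exists (N1 + N2). intros e e' H. simpl. rewrite (IH1 e e'), (IH2 e e'); [tauto| |]; intros; apply H; lia.
  - exists (N1 + N2). intros e e' H. simpl. rewrite (IH1 e e'), (IH2 e e'); [tauto| |]; intros; apply H; lia.
  - exists N. intros e e' H. simpl. assert (G : forall x, sat (scons x e) q <-> sat (scons x e') q).
    { intro x. apply IH. intros [|i] Hi; simpl; auto. apply H. lia. }
    split; intros A x; apply G; auto.
  - exists N. intros e e' H. simpl. assert (G : forall x, sat (scons x e) q <-> sat (scons x e') q).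
    { intro x. apply IH. intros [|i] Hi; simpl; auto. apply H. lia. }
    split; intros [x A]; exists x; apply G; auto.
Qed.

Fixpoint tup (u : nat -> M) (n : nat) : M := match n with 0 => emp | S n => opair (u 0) (tup (fun i => u (S i)) n) end.
Lemma dec_tup n : forall (u : nat -> M) (i : nat), i < n -> dec (tup u n) i = u i.
Proof. induction n; intros u i Hi; [lia|]. simpl tup. rewrite dec_opair. destruct i; simpl; auto. apply (IHn (fun i => u (S i))). lia. Qed.
Lemma OD_tup n : forall u, (forall i : nat, OD (u i)) -> OD (tup u n).
Proof. induction n; intros u Hu; simpl. apply OD_Ord, Ord_emp. apply OD_opair; auto. Qed.

(** Reflect the formula to some [V b] that contains [B] and the tuple of constants. The satisfying
    environments in [V b] form a set in [OD], and its section at the tuple is the set sought; since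
    [P] implies membership in [B], the section contains nothing else. *)
Theorem OD_sep (P : M -> Prop) B : D OD (fun e => P (e 0)) -> (forall x, P x -> x ∈ B) -> OD (sep B P).
Proof.
  intros HP HB. assert (DP : Df P) by (apply (D_K (K := OD)); auto).
  destruct HP as (q0 & v & Hv & HP).
  pose (q := ren (fun i => match v i with inl 0 => 0 | _ => S i end) q0).
  pose (u := fun i => match v i with inr c => c | inl _ => emp end).
  destruct (sat_bound q) as (N & HN).
  pose (t := tup u N).
  assert (Ot : OD t). { apply OD_tup. intro i. unfold u. destruct (v i) eqn:E; eauto. apply OD_Ord, Ord_emp. }
  assert (HP' : forall x, P x <-> sat (dec (opair x t)) q).
  { intro x. rewrite dec_opair. rewrite (HN _ (scons x u)).
    - unfold q. rewrite sat_ren. rewrite (HP (scons x (fun _ => emp))).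
      match goal with |- sat ?a _ <-> sat ?b _ => replace a with b; [tauto|] end.
      apply functional_extensionality. intro i. unfold asg. unfold u.
      destruct (v i) as [[|k]|c] eqn:E; simpl; auto; rewrite E; auto.
    - intros [|i] Hi; simpl; auto. apply dec_tup. lia. }
  destruct (reflection q) as (H & OH & HR).
  destruct (V_all t) as (a1 & O1 & H1). destruct (V_all B) as (a2 & O2 & H2).
  destruct (@clo_ex _ _ H (cup a1 a2) OH) as (b & Hb & Hab & Cb); [apply Ord_cup; auto|].
  assert (Ob : Ord b) by apply Hb.
  assert (Sb : forall a, Ord a -> subset a (cup a1 a2) -> subset (V a) (V b)).
  { intros a Oa Sa. apply V_mono; auto. intros x Hx. apply (Ord_trans Ob (Sa _ Hx)). auto. }
  assert (tb : t ∈ V b). { apply (Sb a1); auto. intros x Hx; apply in_cup; auto. }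
  assert (Bb : B ∈ V b). { apply (Sb a2); auto. intros x Hx; apply in_cup; auto. }
  assert (G := OD_sect (OD_satX q Hb) Ot).
  replace_OD G.
  assert (HS : D (fun _ => True) (fun e => satX (V b) (dec (e 0)) q)).
  { apply (@D_satX _ q (fun _ => V b) (fun i e => dec (e 0) i)). df. intro i. apply (@DT_dec _ _ _ i (fun e => e 0)). df. }
  apply ext. intro x. unfold sect. rewrite in_sep by df. rewrite (@in_sep _ _ B P x DP). rewrite (@in_sep _ _ (V b)) by auto. split.
  - intros (_ & Hx & Hs). assert (P x). { apply HP'. apply (HR b); auto. } auto.
  - intros [Hx Px]. assert (Hxb : x ∈ V b) by (apply (V_trans Ob Bb); auto).
    assert (Hp : opair x t ∈ V b) by auto using V_lim_opair.
    assert (HsX : satX (V b) (dec (opair x t)) q) by (apply (HR b); auto; apply HP'; auto).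
    split; auto. apply in_Un. exists (sing x). split; [|apply in_sing; auto].
    apply in_Un. exists (opair x t). split; [apply in_sep; auto|]. apply in_upair; auto.
Qed.

(** * Hereditarily definable sets *)

Definition inW x := exists t, transitive_set t /\ x ∈ t /\ forall y, y ∈ t -> OD y.
Lemma D_inW K s : K p -> DT K s -> D K (fun e => inW (s e)).
Proof. intros Hp. apply D_pred1. unfold inW. df. Qed.
Hint Resolve D_inW : df.
Lemma W_OD x : inW x -> OD x.
Proof. intros (t & _ & Hx & H). auto. Qed.
Lemma W_in x y : inW x -> y ∈ x -> inW y.
Proof. intros (t & Ht & Hx & H) Hy. exists t. split; auto. split; auto. apply (Ht x); auto. Qed.
Lemma W_OD_sub x : OD x -> (forall y, y ∈ x -> inW y) -> inW x.
Proof.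
  intros Ox H. exists (cup (tc x) (sing x)). split; [|split].
  - intros y Hy z Hz. apply in_cup. left. apply in_cup in Hy. destruct Hy as [Hy|Hy].
    + apply (tc_trans Hy); auto.
    + apply in_sing in Hy. subst. apply tc_sub; auto.
  - apply in_cup. right. apply in_sing. auto.
  - intros y Hy. apply in_cup in Hy. destruct Hy as [Hy|Hy]; [|apply in_sing in Hy; subst; auto].
    apply W_OD. revert y Hy. apply tc_min; auto. df. intros; eauto using W_in.
Qed.
Lemma W_Ord a : Ord a -> inW a.
Proof.
  revert a. apply (Ord_ind (P := inW)). { df. }
  intros a Ha IH. apply W_OD_sub; auto using OD_Ord.
Qed.
Theorem W_sep (P : M -> Prop) B : D OD (fun e => P (e 0)) -> (forall x, P x -> x ∈ B /\ inW x) -> inW (sep B P).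
Proof.
  intros HP HB. assert (DP : Df P) by (apply (D_K (K := OD)); auto).
  apply W_OD_sub. apply OD_sep; auto. intros; apply HB; auto.
  intros y Hy. apply in_sep in Hy; auto. apply HB; tauto.
Qed.
End Enumeration.
#[export] Hint Resolve DT_op4 DT_GG DT_num DT_En D_OD D_inW : df.
#[export] Hint Extern 0 True => exact I : df.
#[global] Opaque next GG En num.

(** * The inner model of hereditarily definable sets *)

(** Choice together with collection, for definable relations: no set containing the values is given
    in advance. *)
Definition Choice (M : structure) (Z : ZF M) : Prop :=
  forall (R : M -> M -> Prop) (A : M), D (fun _ => True) (fun e => R (e 0) (e 1)) ->
    (forall x, x ∈ A -> exists y, R x y) -> exists f, forall x, x ∈ A -> R x (ap f x).

Section Inner.
Context {M : structure} {Z : ZF M} (p : M).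
Notation OD := (OD p).
Notation inW := (inW p).

Definition W : structure := @Structure {x : M | inW x} (fun x y => proj1_sig x ∈ proj1_sig y).
Definition up (x : W) : M := proj1_sig x.
Definition mk x (H : inW x) : W := exist _ x H.
Lemma up_W x : inW (up x). Proof. exact (proj2_sig x). Qed.
Lemma up_OD x : OD (up x). Proof. apply W_OD, up_W. Qed.
Lemma up_inj (x y : W) : up x = up y -> x = y.
Proof. destruct x as [x Hx], y as [y Hy]. simpl. intros <-. f_equal. apply proof_irrelevance. Qed.
Lemma up_down (A : W) x : x ∈ up A -> exists y : W, up y = x.
Proof. intro H. exists (mk (W_in (up_W A) H)). reflexivity. Qed.
Hint Resolve OD_p up_OD : df.

Lemma scons_tl (A : Type) (e : nat -> A) : scons (e 0) (fun n => e (S n)) = e.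
Proof. apply functional_extensionality. intros [|n]; reflexivity. Qed.
Lemma up_scons (x : W) e : (fun n => up (scons x e n)) = scons (up x) (fun n => up (e n)).
Proof. apply functional_extensionality. intros [|n]; reflexivity. Qed.

(** Quantifiers are restricted to [inW], whose only constant is [p]. Thus truth in W of a fixed
    formula is definable outside from constants in [OD], as [OD_sep] requires. *)
Lemma relativize (q : form) : exists P : (nat -> M) -> Prop, D OD P /\
  forall e : nat -> W, sat e q <-> P (fun n => up (e n)).
Proof.
  induction q as [i j|i j| |q1 [P1 [D1 H1]] q2 [P2 [D2 H2]]|q1 [P1 [D1 H1]] q2 [P2 [D2 H2]]
    |q1 [P1 [D1 H1]] q2 [P2 [D2 H2]]|q [P [HD HP]]|q [P [HD HP]]].
  - exists (fun e => e i ∈ e j). split; [df|reflexivity].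
  - exists (fun e => e i = e j). split; [df|]. intro e. split; [simpl; congruence|apply up_inj].
  - exists (fun e => False). split; [df|reflexivity].
  - exists (fun e => P1 e -> P2 e). split; [apply D_imp; auto|]. intro e; simpl; rewrite H1, H2; tauto.
  - exists (fun e => P1 e /\ P2 e). split; [apply D_and; auto|]. intro e; simpl; rewrite H1, H2; tauto.
  - exists (fun e => P1 e \/ P2 e). split; [apply D_or; auto|]. intro e; simpl; rewrite H1, H2; tauto.
  - exists (fun e => forall x, inW x -> P (scons x e)). split.
    + apply (D_all (Q := fun x e => inW x -> P (scons x e))). apply D_imp. { apply D_inW; [apply OD_p|df]. }
      apply D_ext with P; auto. intro e. rewrite scons_tl. tauto.
    + intro e. simpl. split.
      * intros A x Hx. specialize (A (mk Hx)). rewrite HP, up_scons in A. exact A.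
      * intros A x. rewrite HP, up_scons. apply A. apply up_W.
  - exists (fun e => exists x, inW x /\ P (scons x e)). split.
    + apply (D_ex (Q := fun x e => inW x /\ P (scons x e))). apply D_and. { apply D_inW; [apply OD_p|df]. }
      apply D_ext with P; auto. intro e. rewrite scons_tl. tauto.
    + intro e. simpl. split.
      * intros [x Hx]. exists (up x). split; [apply up_W|]. rewrite HP, up_scons in Hx. exact Hx.
      * intros [x [Hx A]]. exists (mk Hx). rewrite HP, up_scons. exact A.
Qed.

Lemma D_fixK (K : M -> Prop) (P : M -> (nat -> M) -> Prop) (e : nat -> M) : (forall n, K (e n)) ->
  D K (fun e => P (e 0) (fun n => e (S n))) -> D K (fun e' => P (e' 0) e).
Proof.
  intros He (q & v & Hv & HP).
  exists q, (fun i => match v i with inl 0 => inl 0 | inl (S k) => inr (e k) | inr a => inr a end).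
  split.
  - intros i a. destruct (v i) as [[|k]|b] eqn:E; intro H; inversion H; subst; eauto.
  - intro e'. rewrite (HP (scons (e' 0) e)).
    match goal with |- sat ?a _ <-> sat ?b _ => replace a with b; [tauto|] end.
    apply functional_extensionality; intro i; unfold asg. destruct (v i) as [[|k]|b]; auto.
Qed.
Lemma D_fixK2 (K : M -> Prop) (P : M -> M -> (nat -> M) -> Prop) (e : nat -> M) : (forall n, K (e n)) ->
  D K (fun e => P (e 0) (e 1) (fun n => e (S (S n)))) -> D K (fun e' => P (e' 0) (e' 1) e).
Proof.
  intros He (q & v & Hv & HP).
  exists q, (fun i => match v i with inl 0 => inl 0 | inl 1 => inl 1 | inl (S (S k)) => inr (e k) | inr a => inr a end).
  split.
  - intros i a. destruct (v i) as [[|[|k]]|b] eqn:E; intro H; inversion H; subst; eauto.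
  - intro e'. rewrite (HP (scons (e' 0) (scons (e' 1) e))).
    match goal with |- sat ?a _ <-> sat ?b _ => replace a with b; [tauto|] end.
    apply functional_extensionality; intro i; unfold asg. destruct (v i) as [[|[|k]]|b]; auto.
Qed.

(** The source of all sets claimed to exist in W: their members need a definition from constants in
    [OD] and a bounding set outside. *)
Lemma W_ex (P : M -> Prop) B : D OD (fun e => P (e 0)) -> (forall x, P x -> x ∈ B /\ inW x) ->
  exists C : W, (forall x : W, x ∈ C <-> P (up x)) /\ forall x : M, x ∈ up C <-> P x.
Proof.
  intros HP HB. exists (mk (W_sep HP HB)).
  assert (G : forall x : M, x ∈ sep B P <-> P x).
  { intro x. rewrite in_sep; [|apply (D_K (K := OD)); auto]. split; [tauto|]. intro H. split; auto. apply HB; auto. }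
  split; [intro x; apply G|exact G].
Qed.

Lemma ZF_W : ZF W.
Proof.
  split.
  - intros A B H. apply up_inj. apply ext. intro x. split; intro Hx; destruct (up_down Hx) as (y & <-); apply H; auto.
  - intros A [x Hx]. destruct (@foundation _ _ (up A) (up x)) as (m & Hm & H); auto.
    destruct (up_down Hm) as (y & <-). exists y. split; auto. intros z Hz. apply H. auto.
  - intros a b. destruct (@W_ex (fun x => x = up a \/ x = up b) (upair (up a) (up b))) as (C & HC & _).
    + assert (A1 := up_OD a). assert (A2 := up_OD b). df.
    + intros x [->| ->]; split; auto using up_W; apply in_upair; auto.
    + exists C. intro x. rewrite HC. split; intros [H|H]; auto using up_inj; subst; auto.
  - intro A. destruct (@W_ex (fun x => exists y, y ∈ up A /\ x ∈ y) (Un (up A))) as (C & HC & _).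
    + assert (A1 := up_OD A). df.
    + intros x (y & Hy & Hx). split; [apply in_Un; eauto|]. apply (W_in (W_in (up_W A) Hy) Hx).
    + exists C. intro x. rewrite HC. split.
      * intros (y & Hy & Hx). destruct (up_down Hy) as (y' & <-). exists y'. auto.
      * intros (y & Hy & Hx). exists (up y). auto.
  - intro A. destruct (@W_ex (fun x => subset x (up A) /\ inW x) (Pw (up A))) as (C & HC & _).
    + assert (A1 := up_OD A). assert (A2 := OD_p p). df.
    + intros x [Hx H]. split; auto. apply in_Pw; auto.
    + exists C. intro x. rewrite HC. split.
      * intros [H _] y Hy. apply H. auto.
      * intro H. split; [|apply up_W]. intros y Hy. destruct (up_down Hy) as (y' & <-). apply H. auto.
  - exists (mk (W_Ord p Ord_omega)). split.
    + exists (mk (W_Ord p Ord_emp)). split; [intros x Hx; apply (in_emp Hx)|].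
      apply emp_lim, lim_omega.
    + intros x Hx. assert (Os : Ord (suc (up x))) by (apply Ord_suc; apply (Ord_in Ord_omega Hx)).
      exists (mk (W_Ord p Os)). split; [|apply lim_omega; auto].
      intro y. change (up y ∈ suc (up x) <-> up y ∈ up x \/ y = x). rewrite in_suc.
      split; intros [H|H]; auto; right; [apply up_inj|subst]; auto.
  - intros q e A. destruct (relativize q) as (P & DP & HP).
    assert (De : D OD (fun e' => P (scons (e' 0) (fun n => up (e n))))).
    { apply (@D_fixK OD (fun x e => P (scons x e)) (fun n => up (e n))). intro; apply up_OD.
      apply D_ext with P; auto. intro e'. rewrite scons_tl. tauto. }
    destruct (@W_ex (fun x => x ∈ up A /\ P (scons x (fun n => up (e n)))) (up A)) as (C & HC & _).
    + apply D_and; auto. assert (A1 := up_OD A). df.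
    + intros x [Hx _]. split; auto. apply (W_in (up_W A) Hx).
    + exists C. intro x. rewrite HC, HP, up_scons. reflexivity.
  - intros q e A HA. destruct (relativize q) as (P & DP & HP).
    pose (R := fun x y => P (scons x (scons y (fun n => up (e n))))).
    assert (De : D OD (fun e' => R (e' 0) (e' 1))).
    { apply (@D_fixK2 OD (fun x y e => P (scons x (scons y e))) (fun n => up (e n))). intro; apply up_OD.
      apply D_ext with P; auto. intro e'. rewrite (scons_tl (fun n => e' (S n))), scons_tl. tauto. }
    assert (De' : forall K s t, (forall a, OD a -> K a) -> DT K s -> DT K t -> D K (fun e => R (s e) (t e))).
    { intros. apply D_pred2; auto. apply (D_K (K := OD)); auto. }
    assert (HR : forall x y : W, sat (scons x (scons y e)) q <-> R (up x) (up y)).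
    { intros x y. rewrite HP, !up_scons. reflexivity. }
    destruct (@W_ex (fun y => exists x, x ∈ up A /\ inW y /\ R x y) (image (up A) (fun x => the (fun y => inW y /\ R x y) emp))) as (C & HC & _).
    + assert (A1 := up_OD A). assert (A2 := OD_p p). df.
    + intros y (x & Hx & Hy & HRxy). split; auto. apply in_image. { df. } exists x. split; auto.
      symmetry. apply the_eq; auto. intros y' [Hy' HR'].
      destruct (up_down Hx) as (x0 & <-). destruct (HA x0 Hx) as (y0 & _ & Hu).
      assert (E1 : y0 = mk Hy) by (apply Hu, HR; auto). assert (E2 : y0 = mk Hy') by (apply Hu, HR; auto).
      transitivity (up y0); [rewrite E2|rewrite E1]; reflexivity.
    + exists C. intro y. rewrite HC. split.
      * intros (x & Hx & Hy & H). destruct (up_down Hx) as (x0 & <-). exists x0. split; auto. apply HR; auto.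
      * intros (x & Hx & H). exists (up x). split; auto. split; [apply up_W|]. apply HR; auto.
Qed.
Existing Instance ZF_W.

Ltac dn := match goal with |- up ?x ∈ up ?y => change (x ∈ y) end.
Ltac dnh H := match type of H with up ?x ∈ up ?y => change (x ∈ y) in H end.
Lemma up_upair (a b : W) : up (upair a b) = upair (up a) (up b).
Proof.
  apply ext. intro x. rewrite in_upair. split.
  - intro H. destruct (up_down H) as (y & <-). dnh H; apply in_upair in H; destruct H; subst; auto.
  - intros [->| ->]; dn; apply in_upair; auto.
Qed.
Lemma up_opair (a b : W) : up (opair a b) = opair (up a) (up b).
Proof. unfold opair, sing. rewrite !up_upair. reflexivity. Qed.
Lemma W_opair a b : inW a -> inW b -> inW (opair a b).
Proof. intros Ha Hb. change (inW (opair (up (mk Ha)) (up (mk Hb)))). rewrite <- up_opair. apply up_W. Qed.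
Lemma up_Ord (a : W) : Ord a <-> Ord (up a).
Proof.
  assert (T : forall a : W, transitive_set a <-> transitive_set (up a)).
  { clear a. intro a. split.
    - intros H x Hx y Hy. destruct (up_down Hx) as (x0 & <-). destruct (up_down Hy) as (y0 & <-). apply (H x0 Hx y0 Hy).
    - intros H x Hx y Hy. apply (H (up x) Hx (up y) Hy). }
  unfold Ord. rewrite T. split; intros [H1 H2]; split; auto.
  - intros x Hx. destruct (up_down Hx) as (x0 & <-). apply T. apply H2; auto.
  - intros x Hx. apply T. apply H2; auto.
Qed.
Lemma up_emp : up emp = emp.
Proof. apply ext. intro x. split; intro H; [|destruct (in_emp H)]. destruct (up_down H) as (y & <-). destruct (in_emp (x := y) H). Qed.
Lemma up_suc (a : W) : up (suc a) = suc (up a).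
Proof.
  apply ext. intro x. rewrite in_suc. split.
  - intro H. destruct (up_down H) as (y & <-). dnh H; apply in_suc in H; destruct H; subst; auto.
  - intros [H| ->]; [destruct (up_down H) as (y & <-)|]; dn; apply in_suc; auto.
Qed.
Lemma up_lim (a : W) : lim a <-> lim (up a).
Proof.
  unfold lim. rewrite up_Ord. split; intros (H1 & (x & Hx) & H2); split; auto; split.
  - exists (up x); auto.
  - intros y Hy. destruct (up_down Hy) as (y0 & <-). rewrite <- up_suc. apply H2. auto.
  - destruct (up_down Hx) as (y0 & <-). exists y0; auto.
  - intros y Hy. change (up (suc y) ∈ up a). rewrite up_suc. apply H2. auto.
Qed.
Lemma up_omega : up omega = omega.
Proof.
  apply ext. intro x. split; revert x.
  - assert (H : @omega W _ = mk (W_Ord p Ord_omega) \/ @omega W _ ∈ mk (W_Ord p Ord_omega)).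
    { assert (L : lim (mk (W_Ord p Ord_omega))) by (apply up_lim, lim_omega).
      assert (S := omega_least L). apply Ord_sub in S; auto using Ord_omega; [|apply L]. tauto. }
    intros x Hx. destruct H as [H|H]; [rewrite H in Hx; exact Hx|].
    apply (Ord_trans Ord_omega Hx H).
  - apply omega_least. apply up_lim, lim_omega.
Qed.
Lemma up_ap (f x y : W) : opair x y ∈ f -> (forall z, opair (up x) z ∈ up f -> z = up y) -> ap f x = y /\ ap (up f) (up x) = up y.
Proof.
  intros H U. split; apply ap_eq; auto.
  - intros z Hz. apply up_inj. apply U. rewrite <- up_opair. auto.
  - rewrite <- up_opair. auto.
Qed.

(** The value chosen is the one with the least index in the enumeration [En]. This rule is definable
    from [p] and the constants of [R], so the choice function itself lies in W. *)
Lemma Choice_W : Choice ZF_W.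
Proof.
  intros R A (q & v & _ & HR) HA. destruct (relativize q) as (P & DP & HP).
  pose (u := fun n => match v n with inl _ => emp | inr a => up a end).
  assert (Ou : forall n, OD (u n)).
  { intro n. unfold u. destruct (v n); [apply OD_Ord, Ord_emp|apply up_OD]. }
  (* [R] depends on places 0 and 1 only; all other places are filled with the empty set, which is
     the same inside W and outside. *)
  pose (w := fun (x y : M) (u : nat -> M) n => match v n with inl 0 => x | inl 1 => y | inl _ => emp | inr a => u n end).
  pose (R0 := fun x y => P (w x y u)).
  assert (De : D OD (fun e' => R0 (e' 0) (e' 1))).
  { apply (@D_fixK2 OD (fun x y e => P (w x y e)) u); auto.
    destruct DP as (q' & v' & Hv' & HP').
    exists q', (fun i => match v' i with inr a => inr a | inl n => match v n with inl 0 => inl 0 | inl 1 => inl 1 | inl _ => inr emp | inr a => inl (S (S n)) end end).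
    split.
    - intros i a. destruct (v' i) as [n|b] eqn:E; [destruct (v n) as [[|[|k]]|b]|]; intro H; inversion H; subst; eauto.
      apply OD_Ord, Ord_emp.
    - intro e. rewrite HP'. match goal with |- sat ?a _ <-> sat ?b _ => replace a with b; [tauto|] end.
      apply functional_extensionality; intro i; unfold asg, w. destruct (v' i) as [n|b]; auto. destruct (v n) as [[|[|k]]|b]; auto. }
  assert (HR0 : forall x y, R x y <-> R0 (up x) (up y)).
  { intros x y. rewrite (HR (scons x (scons y (fun _ => emp)))), HP. unfold R0.
    match goal with |- P ?a <-> P ?b => replace a with b; [tauto|] end.
    apply functional_extensionality; intro n. unfold w, u, asg. destruct (v n) as [[|[|k]]|b] eqn:E; simpl; auto; symmetry; apply up_emp. }
  clearbody R0. clear HR HP w u Ou.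
  assert (De' : forall K s t, (forall a, OD a -> K a) -> DT K s -> DT K t -> D K (fun e => R0 (s e) (t e))).
  { intros. apply D_pred2; auto. apply (D_K (K := OD)); auto. }
  pose (F := fun x => En p (mu (fun a => inW (En p a) /\ R0 x (En p a)))).
  assert (HF : forall x : W, x ∈ A -> inW (F (up x)) /\ R0 (up x) (F (up x))).
  { intros x Hx. destruct (HA x Hx) as (y & Hy). apply HR0 in Hy. assert (Wy := up_W y). destruct (W_OD Wy) as (a & Oa & Ea).
    destruct (@mu_spec _ _ (fun a => inW (En p a) /\ R0 (up x) (En p a)) a) as (_ & G & _); auto. { df. } rewrite Ea. auto. }
  destruct (@W_ex (fun z => exists x, x ∈ up A /\ z = opair x (F x)) (lam (up A) F)) as (f & Hf & Hf').
  - assert (A1 := up_OD A). assert (A2 := OD_p p). unfold F. df.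
  - intros z (x & Hx & ->). split; [apply in_lam; [unfold F; df|eauto]|].
    destruct (up_down Hx) as (y & <-). apply W_opair; [apply up_W|]. apply HF; auto.
  - exists f. intros x Hx. destruct (HF x Hx) as [H1 H2].
    destruct (@up_ap f x (mk H1)) as [E _].
    + change (up (opair x (mk H1)) ∈ up f). rewrite up_opair. apply Hf'. exists (up x). auto.
    + intros z Hz. apply Hf' in Hz. destruct Hz as (x' & _ & E). apply opair_inj in E. destruct E as [<- ->]. reflexivity.
    + rewrite E. apply HR0. auto.
Qed.
End Inner.

(** * Sizes of sets *)

Section Sizes.
Context {M : structure} {Z : ZF M}.
Implicit Types (K : M -> Prop) (a b c x y z A B C f g h : M) (F G : M -> M).

(** The set [e] only has to behave as an injection on [A]; it need not be a function with domain
    [A], so restricting it is free. *)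
Definition le A B := exists e, (forall x, x ∈ A -> ap e x ∈ B) /\
  forall x y, x ∈ A -> y ∈ A -> ap e x = ap e y -> x = y.
Lemma D_le K s t : DT K s -> DT K t -> D K (fun e => le (s e) (t e)).
Proof. apply D_pred2. unfold le. df. Qed.
Hint Resolve D_le : df.

Lemma le_intro A B F : DTf F -> (forall x, x ∈ A -> F x ∈ B) ->
  (forall x y, x ∈ A -> y ∈ A -> F x = F y -> x = y) -> le A B.
Proof.
  intros HF H1 H2. exists (lam A F). split.
  - intros x Hx. rewrite ap_lam; auto.
  - intros x y Hx Hy. rewrite !ap_lam; auto.
Qed.
Lemma le_sub A B : subset A B -> le A B.
Proof. intro H. apply (@le_intro A B (fun x => x)); auto. df. Qed.
Lemma le_trans A B C : le A B -> le B C -> le A C.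
Proof.
  intros (e & H1 & H2) (f & H3 & H4). apply (@le_intro A C (fun x => ap f (ap e x))); auto. df.
Qed.
Lemma le_prod A B C E : le A B -> le C E -> le (prod A C) (prod B E).
Proof.
  intros (e & H1 & H2) (f & H3 & H4).
  apply (@le_intro _ _ (fun z => opair (ap e (fst z)) (ap f (snd z)))). df.
  - intros z Hz. apply in_prod in Hz. destruct Hz as (x & y & Hx & Hy & ->).
    rewrite fst_opair, snd_opair. apply opair_prod. auto.
  - intros z w Hz Hw. apply in_prod in Hz, Hw. destruct Hz as (x & y & Hx & Hy & ->).
    destruct Hw as (x' & y' & Hx' & Hy' & ->). rewrite !fst_opair, !snd_opair. intro E'.
    apply opair_inj in E'. destruct E' as [E1 E2]. f_equal; auto.
Qed.
Lemma le_image_Ord A F : DTf F -> Ord A -> le (image A F) A.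
Proof.
  intros HF HA.
  assert (HF' : forall s, DT (fun _ => True) s -> DT (fun _ => True) (fun e => F (s e))).
  { intros s Hs. apply (DT_let (F := fun x _ => F x)); auto. }
  assert (G : forall y, y ∈ image A F -> mu (fun a => a ∈ A /\ F a = y) ∈ A /\ F (mu (fun a => a ∈ A /\ F a = y)) = y).
  { intros y Hy. apply in_image in Hy; auto. destruct Hy as (x & Hx & ->).
    apply (@mu_spec _ _ (fun a => a ∈ A /\ F a = F x) x); auto. df. eauto using Ord_in. }
  apply (@le_intro _ _ (fun y => mu (fun a => a ∈ A /\ F a = y))). df.
  - intros y Hy. apply G; auto.
  - intros x y Hx Hy E. destruct (G x Hx) as [_ <-]. destruct (G y Hy) as [_ E2]. rewrite E. auto.
Qed.

Lemma suc_inj a b : suc a = suc b -> a = b.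
Proof.
  intro E. assert (H : a ∈ suc b) by (rewrite <- E; apply in_suc; auto).
  assert (H' : b ∈ suc a) by (rewrite E; apply in_suc; auto).
  apply in_suc in H, H'. destruct H as [H|H]; auto. destruct H' as [H'|H']; auto. destruct (mem_asym H H').
Qed.
Lemma suc_nemp a : suc a <> emp.
Proof. intro E. apply (@in_emp _ _ a). rewrite <- E. apply in_suc. auto. Qed.

(** Hilbert's hotel: [a] goes to 0, finite ordinals move up by one, the others stay. *)
Lemma le_suc a : Ord a -> subset omega a -> le (suc a) a.
Proof.
  intros Ha Hw.
  apply (@le_intro _ _ (fun x => if excluded_middle_informative (x = a) then emp
    else if excluded_middle_informative (x ∈ omega) then suc x else x)). df.
  - intros x Hx. apply in_suc in Hx. destruct (excluded_middle_informative (x = a)).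
    + apply Hw. apply emp_lim, lim_omega.
    + destruct (excluded_middle_informative (x ∈ omega)); [|tauto]. apply Hw, lim_omega. auto.
  - intros x y Hx Hy. apply in_suc in Hx, Hy.
    assert (Sw : forall z, z ∈ omega -> suc z ∈ omega) by (intros; apply lim_omega; assumption).
    assert (Ew : emp ∈ omega) by (apply emp_lim, lim_omega).
    destruct (excluded_middle_informative (x = a)) as [e1|n1].
    + destruct (excluded_middle_informative (y = a)) as [e2|n2]; [intros _; congruence|].
      destruct (excluded_middle_informative (y ∈ omega)) as [e3|n3]; intro E.
      * destruct (suc_nemp (eq_sym E)).
      * destruct n3. rewrite <- E. exact Ew.
    + destruct (excluded_middle_informative (y = a)) as [e2|n2].
      * destruct (excluded_middle_informative (x ∈ omega)) as [e3|n3]; intro E.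
        -- destruct (suc_nemp E).
        -- destruct n3. rewrite E. exact Ew.
      * destruct (excluded_middle_informative (x ∈ omega)) as [e3|n3],
          (excluded_middle_informative (y ∈ omega)) as [e4|n4]; intro E.
        -- apply suc_inj. exact E.
        -- destruct n4. rewrite <- E. apply Sw. exact e3.
        -- destruct n3. rewrite E. apply Sw. exact e4.
        -- exact E.
Qed.

(** * Finite sets and squares of infinite ordinals *)

Definition Fin x := exists n, n ∈ omega /\ le x n.
Lemma Ord_n n : n ∈ omega -> Ord n. Proof. apply Ord_in, Ord_omega. Qed.
Lemma D_Fin K s : DT K s -> D K (fun e => Fin (s e)).
Proof. apply D_pred1. unfold Fin. df. Qed.
Hint Resolve D_Fin : df.
Lemma Fin_adj x a : Fin x -> Fin (cup x (sing a)).
Proof.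
  intros (n & Hn & e & H1 & H2). exists (suc n). split; [apply lim_omega; auto|].
  apply (@le_intro _ _ (fun y => if excluded_middle_informative (y ∈ x) then ap e y else n)). df.
  - intros y Hy. apply in_suc. destruct (excluded_middle_informative _); auto.
  - intros y z Hy Hz. apply in_cup in Hy, Hz. rewrite in_sing in Hy, Hz.
    destruct (excluded_middle_informative (y ∈ x)) as [D1|D1], (excluded_middle_informative (z ∈ x)) as [D2|D2]; auto; intro E.
    + exfalso. apply (@mem_irr _ _ n). rewrite <- E at 1. auto.
    + exfalso. apply (@mem_irr _ _ n). rewrite E at 1. auto.
    + destruct Hy, Hz; congruence.
Qed.
Lemma Fin_le x y : le x y -> Fin y -> Fin x.
Proof. intros H (n & Hn & H'). exists n. eauto using le_trans. Qed.
Lemma Fin_prod n k : n ∈ omega -> k ∈ omega -> Fin (prod n k).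
Proof.
  intros Hn Hk. revert n Hn. apply (omega_ind (P := fun n => Fin (prod n k))). df.
  - exists emp. split; [apply emp_lim, lim_omega|]. apply le_sub. intros z Hz. apply in_prod in Hz.
    destruct Hz as (x & _ & Hx & _). destruct (in_emp Hx).
  - intros n Hn IH.
    assert (G : forall j, j ∈ omega -> Fin (cup (prod n k) (prod (sing n) j))).
    { apply (omega_ind (P := fun j => Fin (cup (prod n k) (prod (sing n) j)))). df.
      - apply Fin_le with (y := prod n k); auto. apply le_sub. intros z Hz. apply in_cup in Hz. destruct Hz as [|Hz]; auto.
        apply in_prod in Hz. destruct Hz as (x & y & _ & Hx & _). destruct (in_emp Hx).
      - intros j Hj IHj. apply (Fin_adj (opair n j)) in IHj. apply Fin_le with (2 := IHj). apply le_sub.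
        intros z Hz. rewrite !in_cup, in_sing. apply in_cup in Hz. destruct Hz as [|Hz]; auto.
        apply in_prod in Hz. destruct Hz as (x & y & Hx & Hy & ->). apply in_sing in Hx. subst x.
        apply in_suc in Hy. destruct Hy as [Hy| ->]; auto. left. right. apply opair_prod. rewrite in_sing. auto. }
    apply Fin_le with (2 := G k Hk). apply le_sub. intros z Hz. rewrite in_cup. apply in_prod in Hz.
    destruct Hz as (x & y & Hx & Hy & ->). rewrite !opair_prod, in_sing. apply in_suc in Hx. tauto.
Qed.
(** If an injection into [suc n] takes the value [n] at [a], skipping [a] in omega gives an
    injection into [n]. *)
Lemma not_Fin_omega : ~ Fin omega.
Proof.
  intros (n & Hn & H). revert n Hn H. apply (omega_ind (P := fun n => le omega n -> False)). df.
  - intros (e & H & _). destruct (in_emp (H emp (emp_lim lim_omega))).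
  - intros n Hn IH (e & H1 & H2). apply IH.
    destruct (classic (exists a, a ∈ omega /\ ap e a = n)) as [(a & Ha & E)|N].
    + assert (Oa := Ord_n Ha).
      assert (NE : forall x, x ∈ omega -> (if excluded_middle_informative (x ∈ a) then x else suc x) <> a).
      { intros x Hx E'. destruct (excluded_middle_informative (x ∈ a)) as [i|i].
        - rewrite E' in i. apply (mem_irr i).
        - apply i. rewrite <- E'. apply in_suc. auto. }
      assert (IN : forall x, x ∈ omega -> (if excluded_middle_informative (x ∈ a) then x else suc x) ∈ omega).
      { intros x Hx. destruct (excluded_middle_informative (x ∈ a)); auto. apply lim_omega. auto. }
      apply (@le_intro _ _ (fun x => ap e (if excluded_middle_informative (x ∈ a) then x else suc x))). df.
      * intros x Hx. specialize (H1 _ (IN x Hx)). apply in_suc in H1. destruct H1 as [H1|H1]; auto.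
        exfalso. apply (NE x Hx). apply H2; auto. congruence.
      * intros x y Hx Hy E'. apply H2 in E'; auto.
        destruct (excluded_middle_informative (x ∈ a)) as [i|i], (excluded_middle_informative (y ∈ a)) as [j|j].
        -- exact E'.
        -- exfalso. apply j. rewrite E' in i. apply (Ord_trans Oa) with (2 := i). apply in_suc. auto.
        -- exfalso. apply i. rewrite <- E' in j. apply (Ord_trans Oa) with (2 := j). apply in_suc. auto.
        -- apply suc_inj. exact E'.
    + exists e. split; auto. intros x Hx. specialize (H1 x Hx). apply in_suc in H1. destruct H1 as [|H1]; auto. exfalso. eauto.
Qed.

Lemma le_q4 a b : le (prod a a) b -> forall c, le (prod a b) c -> forall d, le (prod a c) d -> le (q4 a) d.
Proof.
  intros H1 c H2 d H3. unfold q4. assert (R : le a a) by (apply le_sub; intro; auto).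
  apply le_trans with (2 := H3). apply le_prod; auto. apply le_trans with (2 := H2). apply le_prod; auto.
Qed.

(** Hessenberg's argument. If [c] injects into a smaller ordinal, induction applies there. Otherwise
    a pair is sent to its index in [GG]: an index outside [c] would place [c] many quadruples in
    [q4 d] for some [d] in [c], and since [d] is finite or absorbs its square, [c] would inject into
    a smaller ordinal after all. *)
Lemma square_le c : Ord c -> subset omega c -> le (prod c c) c.
Proof.
  intros Hc. revert c Hc. apply (Ord_ind (P := fun c => subset omega c -> le (prod c c) c)). df.
  intros c Hc IH Hw.
  destruct (classic (exists d, d ∈ c /\ le c d)) as [(d & Hd & Hle)|N].
  - assert (Od := Ord_in Hc Hd).
    assert (Wd : subset omega d).
    { apply Ord_nlt; auto using Ord_omega. intro Hdw. apply not_Fin_omega. exists d. split; auto.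
      apply le_trans with c; auto using le_sub. }
    apply le_trans with (prod d d); [apply le_prod; auto|]. apply le_trans with d; auto.
    apply le_sub. apply Ord_sub; auto.
  - assert (Lc : forall a, a ∈ c -> suc a ∈ c).
    { intros a Ha. assert (Oa := Ord_in Hc Ha). assert (S := suc_sub Hc Ha). apply Ord_sub in S; auto using Ord_suc.
      destruct S as [|S]; auto. exfalso. apply N. exists a. split; auto. rewrite <- S. apply le_suc; auto.
      apply Ord_nlt; auto using Ord_omega. intro H. apply (@mem_irr _ _ c).
      assert (Hcw : c ∈ omega) by (rewrite <- S; apply lim_omega; auto). apply Hw. auto. }
    pose (ix := fun z => mu (fun i => GG i = op4 (fst z) (snd z) emp emp)).
    assert (Hix : DTf ix) by (unfold ix; df).
    assert (G : forall a b, a ∈ c -> b ∈ c -> Ord (ix (opair a b)) /\ GG (ix (opair a b)) = op4 a b emp emp).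
    { intros a b Ha Hb. destruct (@GG_onto _ _ a b emp emp) as (i & Oi & E); eauto using Ord_in, Ord_emp.
      unfold ix. destruct (@mu_spec _ _ (fun i => GG i = op4 (fst (opair a b)) (snd (opair a b)) emp emp) i) as (O1 & E1 & _).
      - df.
      - exact Oi.
      - rewrite fst_opair, snd_opair. exact E.
      - split; [exact O1|]. rewrite E1, fst_opair, snd_opair. reflexivity. }
    assert (IX : forall a b, a ∈ c -> b ∈ c -> ix (opair a b) ∈ c).
    { intros a b Ha Hb. destruct (G a b Ha Hb) as [Oi E]. apply NNPP. intro Ni.
      assert (Sc := Ord_nlt Oi Hc Ni). set (i := ix (opair a b)) in *.
      assert (Hd : exists d, d ∈ c /\ a ∈ d /\ b ∈ d).
      { destruct (Ord_tri (Ord_in Hc Ha) (Ord_in Hc Hb)) as [H|[H|H]].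
        - exists (suc b). rewrite !in_suc. auto.
        - subst. exists (suc b). rewrite !in_suc. auto.
        - exists (suc a). rewrite !in_suc. auto. }
      destruct Hd as (d & Hd & Had & Hbd). assert (Od := Ord_in Hc Hd).
      assert (E0 : emp ∈ d). { destruct (Ord_tri Ord_emp Od) as [|[E0|E0]]; auto; [subst d; destruct (in_emp Had)|destruct (in_emp E0)]. }
      assert (Hq : le c (q4 d)).
      { apply (@le_intro _ _ (fun x => GG x)). df.
        - intros x Hx. apply GG_below with (a := i); auto. rewrite E. apply in_q4. auto.
        - intros x y Hx Hy. apply GG_inj; eauto using Ord_in. }
      destruct (classic (d ∈ omega)) as [Hdw|Hdw].
      - destruct (Fin_prod Hdw Hdw) as (k1 & Hk1 & L1). destruct (Fin_prod Hdw Hk1) as (k2 & Hk2 & L2).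
        destruct (Fin_prod Hdw Hk2) as (k3 & Hk3 & L3).
        apply N. exists k3. split; auto. apply le_trans with (1 := Hq). eapply le_q4; eauto.
      - assert (L : le (prod d d) d). { apply IH; auto. apply Ord_nlt; auto using Ord_omega. }
        apply N. exists d. split; auto. apply le_trans with (1 := Hq). eapply le_q4; eauto. }
    apply (@le_intro _ _ ix Hix).
    + intros z Hz. apply in_prod in Hz. destruct Hz as (a & b & Ha & Hb & ->). auto.
    + intros z w Hz Hw' E. apply in_prod in Hz, Hw'. destruct Hz as (a & b & Ha & Hb & ->). destruct Hw' as (a' & b' & Ha' & Hb' & ->).
      destruct (G a b Ha Hb) as [_ E1]. destruct (G a' b' Ha' Hb') as [_ E2]. rewrite E, E2 in E1. apply op4_inj in E1.
      destruct E1 as (-> & -> & _). auto.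
Qed.

Definition fnset A B := sep (Pw (prod A B)) (fun f => f = lam A (ap f) /\ forall x, x ∈ A -> ap f x ∈ B).
Lemma in_fnset A B f : f ∈ fnset A B <-> f = lam A (ap f) /\ forall x, x ∈ A -> ap f x ∈ B.
Proof.
  unfold fnset. rewrite in_sep by df. split; [tauto|]. intros [E H]. split; auto.
  apply in_Pw. rewrite E. intros z Hz. apply in_lam in Hz; [|df]. destruct Hz as (x & Hx & ->). apply opair_prod. auto.
Qed.
Lemma DT_fnset K s t : DT K s -> DT K t -> DT K (fun e => fnset (s e) (t e)).
Proof. apply DT_op2. change (DT K (fun e => fnset (e 0) (e 1))). unfold fnset. df. Qed.
Hint Resolve DT_fnset : df.
Lemma lam_fnset A B F : DTf F -> (forall x, x ∈ A -> F x ∈ B) -> lam A F ∈ fnset A B.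
Proof.
  intros HF H. apply in_fnset. split.
  - apply lam_ext; auto; [|df]. intros x Hx. rewrite ap_lam; auto.
  - intros x Hx. rewrite ap_lam; auto.
Qed.

(** * Sets smaller than a strong limit *)

Section Small.
Context (AC : Choice Z) (m : M) (Om : Ord m) (wm : omega ∈ m).
Context (Hpow : forall c, c ∈ m -> exists d, d ∈ m /\ le (Pw c) d).

Definition Sm x := exists c, c ∈ m /\ le x c.
Lemma D_Sm s : DT (fun _ => True) s -> D (fun _ => True) (fun e => Sm (s e)).
Proof. apply D_pred1. unfold Sm. df. Qed.
Hint Resolve D_Sm : df.
Lemma Sm_le x y : le x y -> Sm y -> Sm x.
Proof. intros H (c & Hc & H'). exists c. eauto using le_trans. Qed.
Lemma Sm_sub x y : subset x y -> Sm y -> Sm x.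
Proof. intros H. apply Sm_le, le_sub; auto. Qed.
Lemma Sm_in c : c ∈ m -> Sm c.
Proof. intro H. exists c. split; auto. apply le_sub. intro; auto. Qed.
Lemma Sm_Pw x : Sm x -> Sm (Pw x).
Proof.
  intros (c & Hc & e & H1 & H2). destruct (Hpow Hc) as (d & Hd & H). exists d. split; auto.
  apply le_trans with (2 := H). apply (@le_intro _ _ (fun s => image s (ap e))). df.
  - intros s Hs. apply in_Pw in Hs. apply in_Pw. intros y Hy. apply in_image in Hy; [|df]. destruct Hy as (z & Hz & ->). auto.
  - intros s t Hs Ht E. apply in_Pw in Hs, Ht.
    assert (G : forall s t, subset s x -> subset t x -> image s (ap e) = image t (ap e) -> subset s t).
    { clear s t Hs Ht E. intros s t Hs Ht E y Hy.
      assert (Hi : ap e y ∈ image t (ap e)) by (rewrite <- E; apply in_image; [df|eauto]).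
      apply in_image in Hi; [|df]. destruct Hi as (z & Hz & E'). apply H2 in E'; auto. subst; auto. }
    apply ext. intro y. split; apply G; auto.
Qed.
Lemma max_in c d : c ∈ m -> d ∈ m -> exists k, k ∈ m /\ subset c k /\ subset d k.
Proof.
  intros Hc Hd. destruct (Ord_tri (Ord_in Om Hc) (Ord_in Om Hd)) as [H|[H|H]].
  - exists d. split; auto. split; [|intro; auto]. apply Ord_sub; eauto using Ord_in.
  - subst. exists d. split; auto. split; intro; auto.
  - exists c. split; auto. split; [intro; auto|]. apply Ord_sub; eauto using Ord_in.
Qed.
Lemma Sm_prod x y : Sm x -> Sm y -> Sm (prod x y).
Proof.
  intros (c & Hc & H1) (d & Hd & H2). destruct (max_in Hc Hd) as (k & Hk & S1 & S2).
  apply Sm_le with (prod k k).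
  - apply le_prod; eapply le_trans; eauto using le_sub.
  - apply Sm_sub with (Pw (Pw (cup k k))).
    + intros z Hz. unfold subset. apply in_prod in Hz. destruct Hz as (a & b & Ha & Hb & ->).
      apply in_Pw. intros u Hu. apply in_Pw. intros v Hv. apply in_cup. apply in_upair in Hu.
      destruct Hu; subst; [apply in_sing in Hv|apply in_upair in Hv]; intuition; subst; auto.
    + apply Sm_Pw, Sm_Pw. apply Sm_sub with k; auto using Sm_in. intros z Hz. apply in_cup in Hz. tauto.
Qed.
Lemma Sm_fnset x y : Sm x -> Sm y -> Sm (fnset x y).
Proof.
  intros Hx Hy. apply Sm_sub with (Pw (prod x y)); [|auto using Sm_Pw, Sm_prod].
  intros f Hf. unfold fnset in Hf. apply in_sep in Hf; [tauto|df].
Qed.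
(** The common bound [c] matters, since [m] will be singular. Choice supplies the injections into
    [c] and, for each element, a member containing it. *)
Lemma Sm_Un I F c : DTf F -> Sm I -> c ∈ m -> (forall i, i ∈ I -> le (F i) c) -> Sm (Un (image I F)).
Proof.
  intros HF HI Hc H.
  assert (HF' : forall s, DT (fun _ => True) s -> DT (fun _ => True) (fun e => F (s e))).
  { intros s Hs. apply (DT_let (F := fun x _ => F x)); auto. }
  destruct (@AC (fun i e => (forall x, x ∈ F i -> ap e x ∈ c) /\ forall x y, x ∈ F i -> y ∈ F i -> ap e x = ap e y -> x = y) I) as (e & He); auto. df.
  destruct (@AC (fun v i => i ∈ I /\ v ∈ F i) (Un (image I F))) as (ch & Hch). df.
  { intros v Hv. apply in_Un in Hv. destruct Hv as (y & Hy & Hv). apply in_image in Hy; auto. destruct Hy as (i & Hi & ->). eauto. }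
  apply Sm_le with (prod I c); [|auto using Sm_prod, Sm_in].
  apply (@le_intro _ _ (fun v => opair (ap ch v) (ap (ap e (ap ch v)) v))). df.
  - intros v Hv. destruct (Hch v Hv) as [H1 H2]. apply opair_prod. split; auto. apply (He _ H1). auto.
  - intros v w Hv Hw E. apply opair_inj in E. destruct E as [E1 E2]. destruct (Hch v Hv) as [H1 H2].
    destruct (Hch w Hw) as [H3 H4]. apply (He _ H1); auto; rewrite E1 in *; auto.
Qed.
Lemma Sm_emp : Sm emp.
Proof. apply Sm_in. apply (Ord_trans Om (emp_lim lim_omega) wm). Qed.
End Small.
End Sizes.
#[export] Hint Resolve D_le D_Fin DT_fnset D_Sm : df.

(** * Covering theorem at a strong limit of cofinality ω *)

Notation "'If' P 'then' x 'else' y" := (if excluded_middle_informative P then x else y)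
  (at level 200, P at level 200, x at level 200, y at level 200).
Ltac split_if := match goal with |- context [excluded_middle_informative ?P] =>
  destruct (excluded_middle_informative P) end.
Ltac opdf F := let h := fresh "Dop" in assert (h : forall s, DT (fun _ => True) s -> DT (fun _ => True) (fun e => F (s e)))
  by (let s := fresh "s" in let Hs := fresh "Hs" in intros s Hs; apply (DT_let (F := fun x _ => F x)); auto).

Section More.
Context {M : structure} {Z : ZF M}.
Implicit Types (K : M -> Prop) (a b c x y z A B C f g h : M) (F G : M -> M).

Lemma reindex I A F : DTf F -> le I A -> exists P, (forall i, i ∈ I -> exists k, k ∈ A /\ ap P k = F i) /\
  forall k, k ∈ A -> ap P k = emp \/ exists i, i ∈ I /\ ap P k = F i.
Proof.
  intros HF (e & H1 & H2). opdf F.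
  pose (G := fun k => If exists i, i ∈ I /\ ap e i = k then F (the (fun i => i ∈ I /\ ap e i = k) emp) else emp).
  assert (HG : DTf G) by (unfold G; df).
  assert (E : forall i, i ∈ I -> G (ap e i) = F i).
  { intros i Hi. unfold G. split_if.
    - f_equal. apply the_eq; [auto|]. intros j [Hj Ej]. apply H2; auto.
    - exfalso. eauto. }
  exists (lam A G). split.
  - intros i Hi. exists (ap e i). split; auto. rewrite ap_lam; auto.
  - intros k Hk. rewrite ap_lam; auto. destruct (classic (exists i, i ∈ I /\ ap e i = k)) as [(i & Hi & <-)|N].
    + right. exists i. auto.
    + left. unfold G. split_if; tauto.
Qed.

Lemma le_omega2 : le (prod omega omega) omega.
Proof. apply square_le; [apply Ord_omega|]. intro. auto. Qed.

(** Countable in the sense of being covered by a sequence, so that subsets and the empty set cause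
    no case distinction. *)
Definition Ct x := exists c, forall v, v ∈ x -> exists n, n ∈ omega /\ ap c n = v.
Lemma D_Ct K s : DT K s -> D K (fun e => Ct (s e)).
Proof. apply D_pred1. unfold Ct. df. Qed.
Hint Resolve D_Ct : df.
Lemma Ct_image I F : DTf F -> le I omega -> Ct (image I F).
Proof.
  intros HF HI. destruct (reindex HF HI) as (P & H & _). exists P. intros v Hv. apply in_image in Hv; auto.
  destruct Hv as (i & Hi & ->). auto.
Qed.
Lemma Ct_sub x y : subset x y -> Ct y -> Ct x.
Proof. intros H (c & Hc). exists c. auto. Qed.
Lemma Ct_adj x v : Ct x -> Ct (cup x (sing v)).
Proof.
  intros (c & Hc). apply Ct_sub with (image (suc omega) (fun i => If i ∈ omega then ap c i else v)).
  - intros y Hy. apply in_image. df. apply in_cup in Hy. rewrite in_sing in Hy. destruct Hy as [Hy| ->].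
    + destruct (Hc y Hy) as (n & Hn & <-). exists n. rewrite in_suc. split; auto. split_if; tauto.
    + exists omega. rewrite in_suc. split; auto. split_if; auto. destruct (mem_irr m).
  - apply Ct_image. df. apply le_suc. apply Ord_omega. intro; auto.
Qed.
Lemma Ct_Un (AC : Choice Z) A : Ct A -> (forall x, x ∈ A -> Ct x) -> Ct (Un A).
Proof.
  intros (c & Hc) H.
  destruct (@AC (fun x d => forall v, v ∈ x -> exists n, n ∈ omega /\ ap d n = v) A) as (d & Hd); auto. df.
  apply Ct_sub with (image (prod omega omega) (fun z => ap (ap d (ap c (fst z))) (snd z))).
  - intros y Hy. apply in_image. df. apply in_Un in Hy. destruct Hy as (x & Hx & Hy).
    destruct (Hc x Hx) as (n & Hn & En). destruct (Hd x Hx y Hy) as (k & Hk & Ek). exists (opair n k).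
    rewrite fst_opair, snd_opair, opair_prod, En. auto.
  - apply Ct_image. df. apply le_omega2.
Qed.
End More.
#[export] Hint Resolve D_Ct : df.

Section RGCH.
Context {M : structure} {Z : ZF M}.
Implicit Types (K : M -> Prop) (a b c x y z A B C f g h : M) (F G : M -> M).
Context (AC : Choice Z) (m : M) (Om : Ord m) (wm : omega ∈ m).
Context (Hpow : forall c, c ∈ m -> exists d, d ∈ m /\ le (Pw c) d).
Context (kp : M) (Hkp : forall n, n ∈ omega -> ap kp n ∈ m).
Context (Hcof : forall c, c ∈ m -> exists n, n ∈ omega /\ subset c (ap kp n)).
Notation Sm := (Sm m).
Notation T := (fun _ : M => True).

Definition Covers a P t k := forall g, (forall i, i ∈ t -> ap g i ∈ a) ->
  exists s, forall i, i ∈ t -> exists j, j ∈ k /\ ap s j ∈ a /\ ap g i ∈ ap P (ap s j).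
(** The number [k] of pieces is fixed before the length [t], whereas the family may depend on [t];
    with [k] chosen after [t], singletons would do. *)
Definition Good k a := forall t, t ∈ m -> exists P, (forall i, i ∈ a -> Sm (ap P i)) /\ Covers a P t k.
Lemma D_Covers s t u v : DT T s -> DT T t -> DT T u -> DT T v -> D T (fun e => Covers (s e) (t e) (u e) (v e)).
Proof. apply (D_pred4 (R := Covers)). unfold Covers. df. Qed.
Hint Resolve D_Covers : df.
Lemma D_Good s t : DT T s -> DT T t -> D T (fun e => Good (s e) (t e)).
Proof. apply D_pred2. unfold Good. df. Qed.
Hint Resolve D_Good : df.

Lemma Good_mono k k' a : subset k k' -> Good k a -> Good k' a.
Proof.
  intros H G t Ht. destruct (G t Ht) as (P & H1 & H2). exists P. split; auto.
  intros g Hg. destruct (H2 g Hg) as (s & Hs). exists s. intros i Hi. destruct (Hs i Hi) as (j & Hj & Hj').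
  exists j. auto.
Qed.
Lemma Sm_kp x : Sm x -> exists n, n ∈ omega /\ le x (ap kp n).
Proof. intros (c & Hc & H). destruct (Hcof Hc) as (n & Hn & S). exists n. split; auto. apply le_trans with c; auto using le_sub. Qed.
Lemma Good_Sm a : Ord a -> Sm a -> Good (suc emp) a.
Proof.
  intros Oa Ha t Ht. exists (lam a (fun _ => a)). split.
  - intros i Hi. rewrite ap_lam; auto. df.
  (* One piece, [a] itself, suffices. The empty set is the selector: it sends 0 to 0, and 0 belongs
     to [a] because [g] takes a value there. *)
  - intros g Hg. exists emp. intros i Hi. exists emp. split; [apply in_suc; auto|].
    assert (E : ap emp emp ∈ a).
    { assert (H := Hg i Hi). apply (Ord_least (P := fun x => x ∈ a)) in H; [|df|eauto using Ord_in].
      destruct H as (b & Ob & Hb & Lb). replace (ap emp emp) with b; auto.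
      transitivity emp.
      - destruct (Ord_tri Ob Ord_emp) as [H|[H|H]]; auto. destruct (in_emp H). destruct (Lb emp H). eapply Ord_trans; eauto.
      - symmetry. replace emp with (lam emp (fun x => x)) at 1; [apply ap_lam_out; [df|apply in_emp]|].
        apply ext. intro x. split; intro Hx; [|destruct (in_emp Hx)]. apply in_lam in Hx; [|df]. destruct Hx as (y & Hy & _). destruct (in_emp Hy). }
    split; auto. rewrite ap_lam; auto. df.
Qed.

(** * A least counterexample [l] to the covering theorem *)

Section Bad.
Context (l : M) (Ol : Ord l) (ml : subset m l) (ll : le (prod l l) l).
Context (Lg : forall a, a ∈ l -> exists k, k ∈ m /\ Good k a).
Context (Bad : forall k, k ∈ m -> ~ Good k l).

Definition Fam P := forall i, i ∈ l -> Sm (ap P i).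
Lemma D_Fam s : DT T s -> D T (fun e => Fam (s e)).
Proof. apply D_pred1. unfold Fam. df. Qed.
Hint Resolve D_Fam : df.
Lemma Sm_l x : Sm x -> le x l.
Proof. intros (c & Hc & H). apply le_trans with c; auto. apply le_sub. apply Ord_sub; eauto using Ord_in. Qed.
Lemma le_prod_l x y : le x l -> le y l -> le (prod x y) l.
Proof. intros H1 H2. apply le_trans with (2 := ll). apply le_prod; auto. Qed.
Lemma el : emp ∈ l.
Proof. apply ml. apply (Ord_trans Om (emp_lim lim_omega) wm). Qed.
Lemma wl : subset omega l.
Proof. apply Ord_sub; auto using Ord_omega. Qed.
Lemma le_refl x : le x x. Proof. apply le_sub. intro; auto. Qed.

Lemma Fam_reindex I F : DTf F -> le I l -> (forall i, i ∈ I -> Sm (F i)) ->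
  exists P, Fam P /\ forall i, i ∈ I -> exists k, k ∈ l /\ ap P k = F i.
Proof.
  intros HF HI H. destruct (reindex HF HI) as (P & H1 & H2). exists P. split; auto.
  intros k Hk. destruct (H2 k Hk) as [->|(i & Hi & ->)]; auto. apply Sm_emp; auto.
Qed.
Lemma Fam_ex : exists P, Fam P.
Proof. exists (lam l (fun _ => emp)). intros i Hi. rewrite ap_lam; auto; [|df]. apply Sm_emp; auto. Qed.

(** The failure of [Good k l] spelled out. The length [t] depends on [k] alone and works against all
    families at once. *)
Lemma uncovered_ex k : k ∈ m -> exists t, t ∈ m /\ forall P, Fam P -> exists g, (forall i, i ∈ t -> ap g i ∈ l) /\
  forall s, exists i, i ∈ t /\ forall j, j ∈ k -> ap s j ∈ l -> ~ ap g i ∈ ap P (ap s j).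
Proof.
  intro Hk. apply NNPP. intro N. apply (Bad Hk). intros t Ht. apply NNPP. intro N1. apply N.
  exists t. split; auto. intros P HP. apply NNPP. intro N2. apply N1. exists P. split; auto.
  intros g Hg. apply NNPP. intro N3. apply N2. exists g. split; auto. intro s. apply NNPP. intro N4. apply N3.
  exists s. intros i Hi. apply NNPP. intro N5. apply N4. exists i. split; auto. intros j Hj H1 H2. apply N5. eauto.
Qed.

(* The closure condition combines downward closure with closure under countable unions. *)
Definition ideal Y I := subset I (Pw Y) /\ ~ Y ∈ I /\
  forall c X, subset X Y -> (forall n, n ∈ omega -> ap c n ∈ I) ->
    (forall y, y ∈ X -> exists n, n ∈ omega /\ y ∈ ap c n) -> X ∈ I.
Lemma D_ideal s t : DT T s -> DT T t -> D T (fun e => ideal (s e) (t e)).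
Proof. apply D_pred2. unfold ideal. df. Qed.
Hint Resolve D_ideal : df.

(* If every ideal had a family refuting it, joining these (there are few ideals) would give one family,
   and the ideal of the sets countably covered by a function avoiding that family would be refuted too. *)
Lemma ideal_ex : exists Y I, Y ∈ m /\ ideal Y I /\ forall P, Fam P -> exists g, (forall y, y ∈ Y -> ap g y ∈ l) /\
  forall i, i ∈ l -> sep Y (fun y => ap g y ∈ ap P i) ∈ I.
Proof.
  (* With [k] equal to omega, the sets that countably many pieces cover are closed under countable
     unions, and [Y] is not among them. *)
  destruct (uncovered_ex wm) as (Y & HY & H). exists Y. apply NNPP. intro N.
  destruct (@AC (fun I P => Fam P /\ (ideal Y I -> forall g, (forall y, y ∈ Y -> ap g y ∈ l) ->
    exists i, i ∈ l /\ ~ sep Y (fun y => ap g y ∈ ap P i) ∈ I)) (Pw (Pw Y))) as (Q & HQ). df.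
  { intros I _. destruct (classic (ideal Y I)) as [HI|HI]; [|destruct Fam_ex as (P & HP); exists P; tauto].
    apply NNPP. intro N1. apply N. exists I. split; auto. split; auto. intros P HP. apply NNPP. intro N2. apply N1.
    exists P. split; auto. intros _ g Hg. apply NNPP. intro N3. apply N2. exists g. split; auto.
    intros i Hi. apply NNPP. intro N4. apply N3. eauto. }
  destruct (@Fam_reindex (prod (Pw (Pw Y)) l) (fun z => ap (ap Q (fst z)) (snd z))) as (P & HP & HP'). df.
  { apply le_prod_l; [|apply le_refl]. apply Sm_l. do 2 (apply Sm_Pw; auto). apply Sm_in; auto. }
  { intros z Hz. apply in_prod in Hz. destruct Hz as (I & i & HI & Hi & ->). rewrite fst_opair, snd_opair. apply (HQ I HI); auto. }
  destruct (H P HP) as (g & Hg & Hg').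
  pose (I := sep (Pw Y) (fun X => exists s, forall t, t ∈ X -> exists n, n ∈ omega /\ ap s n ∈ l /\ ap g t ∈ ap P (ap s n))).
  assert (HI : forall X, X ∈ I <-> subset X Y /\ exists s, forall t, t ∈ X -> exists n, n ∈ omega /\ ap s n ∈ l /\ ap g t ∈ ap P (ap s n)).
  { intro X. unfold I. rewrite in_sep by df. rewrite in_Pw. tauto. }
  assert (IP : I ∈ Pw (Pw Y)).
  { apply in_Pw. intros X HX. apply HI in HX. apply in_Pw. tauto. }
  assert (Id : ideal Y I).
  { split; [|split].
    - apply in_Pw. auto.
    - intro HYI. apply HI in HYI. destruct HYI as (_ & s & Hs). destruct (Hg' s) as (i & Hi & Ni).
      destruct (Hs i Hi) as (n & Hn & H1 & H2). apply (Ni n); auto.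
    - intros c X HX Hc Hcov. apply HI. split; auto.
      destruct (@AC (fun n s => forall t, t ∈ ap c n -> exists n, n ∈ omega /\ ap s n ∈ l /\ ap g t ∈ ap P (ap s n)) omega) as (S & HS). df.
      { intros n Hn. apply HI. auto. }
      destruct (@reindex _ _ (prod omega omega) omega (fun z => ap (ap S (fst z)) (snd z))) as (s & Hs & _). df. apply le_omega2.
      exists s. intros t Ht. destruct (Hcov t Ht) as (n & Hn & Htn). destruct (HS n Hn t Htn) as (k & Hk & H1 & H2).
      destruct (Hs (opair n k)) as (j & Hj & E). { apply opair_prod; auto. }
      rewrite fst_opair, snd_opair in E. exists j. rewrite E. auto. }
  destruct (HQ I IP) as [HF HG]. destruct (HG Id g Hg) as (i & Hi & Ni). apply Ni. apply HI. split.
  - intros x Hx. apply in_sep in Hx; [tauto|df].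
  - destruct (HP' (opair I i)) as (k & Hk & E). { apply opair_prod; auto. }
    rewrite fst_opair, snd_opair in E. exists (lam omega (fun _ => k)). intros t Ht. apply in_sep in Ht; [|df].
    exists emp. assert (E0 : emp ∈ omega) by (apply emp_lim, lim_omega). rewrite ap_lam; auto; [|df]. rewrite E. tauto.
Qed.

(** * Functions below a bound, modulo the ideal *)

Section Ideal.
Context (Y : M) (HY : Y ∈ m) (I : M) (Id : ideal Y I).
Context (IP : forall P, Fam P -> exists g, (forall y, y ∈ Y -> ap g y ∈ l) /\
  forall i, i ∈ l -> sep Y (fun y => ap g y ∈ ap P i) ∈ I).
Let IY : ~ Y ∈ I := proj1 (proj2 Id).

Lemma I_sub X : X ∈ I -> subset X Y.
Proof. intro H. apply in_Pw. apply Id. auto. Qed.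
Lemma I_le X X' : X ∈ I -> subset X' X -> X' ∈ I.
Proof.
  intros H S. assert (HX := I_sub H). apply (proj2 (proj2 Id)) with (c := lam omega (fun _ => X)).
  - intros x Hx. auto.
  - intros n Hn. rewrite ap_lam; auto. df.
  - intros y Hy. exists emp. assert (E0 : emp ∈ omega) by (apply emp_lim, lim_omega). split; auto. rewrite ap_lam; auto. df.
Qed.
Lemma I_cup X X' X'' : X ∈ I -> X' ∈ I -> (forall y, y ∈ X'' -> y ∈ X \/ y ∈ X') -> X'' ∈ I.
Proof.
  intros H1 H2 H. assert (S1 := I_sub H1). assert (S2 := I_sub H2).
  assert (E0 : emp ∈ omega) by (apply emp_lim, lim_omega).
  assert (E1 : suc emp ∈ omega) by (apply lim_omega; auto).
  apply (proj2 (proj2 Id)) with (c := lam omega (fun n => If n = emp then X else X')).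
  - intros x Hx. destruct (H x Hx); auto.
  - intros n Hn. rewrite ap_lam; auto; [|df]. split_if; auto.
  - intros y Hy. destruct (H y Hy).
    + exists emp. split; auto. rewrite ap_lam; auto; [|df]. split_if; [auto|tauto].
    + exists (suc emp). split; auto. rewrite ap_lam; auto; [|df]. split_if; auto. destruct (suc_nemp e).
Qed.
(** The closure condition by itself produces no member of the ideal; [IP], applied to any family,
    supplies one. *)
Lemma I_emp X : (forall y, ~ y ∈ X) -> X ∈ I.
Proof.
  intro H. destruct Fam_ex as (P & HP). destruct (IP HP) as (g & _ & Hg). apply I_le with (1 := Hg emp el).
  intros y Hy. destruct (H y Hy).
Qed.
Lemma I_not X : subset X Y -> ~ X ∈ I -> exists y, y ∈ X.
Proof. intros S N. apply NNPP. intro N1. apply N. apply I_emp. intros y Hy. eauto. Qed.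

(* No small family absorbs the functions below [b] on [A], modulo the ideal. *)
Definition U A b := subset A Y /\ ~ A ∈ I /\ b ∈ fnset Y (suc l) /\ forall P, Fam P ->
  exists g, sep A (fun y => ~ ap g y ∈ suc (ap b y)) ∈ I /\ forall i, i ∈ l -> sep A (fun y => ap g y ∈ ap P i) ∈ I.
Lemma D_U s t : DT T s -> DT T t -> D T (fun e => U (s e) (t e)).
Proof. apply D_pred2. unfold U. df. Qed.
Hint Resolve D_U : df.
Lemma b_Ord b y : b ∈ fnset Y (suc l) -> y ∈ Y -> Ord (ap b y) /\ subset (ap b y) l.
Proof.
  intros H Hy. apply in_fnset in H. destruct H as [_ H]. specialize (H y Hy). apply in_suc in H.
  destruct H as [H|H]; [|rewrite H; split; [auto|intro; auto]]. split; [eapply Ord_in; eauto|apply Ord_sub; eauto using Ord_in].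
Qed.
Lemma SmY X : subset X Y -> Sm X.
Proof. intro H. apply Sm_sub with Y; auto. apply Sm_in; auto. Qed.
Lemma SmYimage F : DTf F -> Sm (image Y F).
Proof. intro HF. apply Sm_le with Y; [|apply Sm_in; auto]. apply le_image_Ord; eauto using Ord_in. Qed.

(** [U] lets [g] reach [b]. Adding the range of [b], a small set, to the family forces [g] strictly
    below [b] modulo the ideal; the extra index is [l] in [suc l]. *)
Lemma U_avoid A b J F : U A b -> DTf F -> le J l -> (forall j, j ∈ J -> Sm (F j)) ->
  exists g, sep A (fun y => ~ ap g y ∈ ap b y) ∈ I /\ forall j, j ∈ J -> sep A (fun y => ap g y ∈ F j) ∈ I.
Proof.
  intros (HA & NA & Hb & HU) HF HJ HS. destruct (Fam_reindex HF HJ HS) as (P & HP & HP').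
  destruct (@Fam_reindex (suc l) (fun i => If i ∈ l then ap P i else image Y (ap b))) as (P' & FP & HP2). df.
  { apply le_suc; auto. apply wl. }
  { intros i Hi. split_if; auto. apply SmYimage. df. }
  destruct (HU P' FP) as (g & H1 & H2). exists g. split.
  - destruct (HP2 l) as (k & Hk & Ek); [apply in_suc; auto|]. assert (H3 := H2 k Hk). rewrite Ek in H3.
    apply I_cup with (1 := H1) (2 := H3). intros y Hy. apply in_sep in Hy; [|df]. rewrite !in_sep by df.
    destruct Hy as [Hy N]. destruct (classic (ap g y ∈ suc (ap b y))) as [E|E]; [|auto].
    apply in_suc in E. destruct E as [E|E]; [tauto|]. right. split; auto. destruct (excluded_middle_informative (l ∈ l)) as [e|e]; [destruct (mem_irr e)|]. apply in_image. df. exists y. auto.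
  - intros j Hj. destruct (HP' j Hj) as (i & Hi & Ei). destruct (HP2 i) as (k & Hk & Ek); [apply in_suc; auto|].
    assert (H3 := H2 k Hk). rewrite Ek in H3. destruct (excluded_middle_informative (i ∈ l)) as [e|e]; [|tauto].
    rewrite Ei in H3. opdf F. apply I_le with (1 := H3). intros y Hy. rewrite in_sep in * by df. auto.
Qed.
(** A family refuting [U X b], stated so as to exist for all [X] and [b]; choice can then be applied
    to a whole set of such pairs. *)
Lemma not_U_witness X b : subset X Y -> b ∈ fnset Y (suc l) -> exists P, Fam P /\ (~ X ∈ I -> ~ U X b -> forall g,
   (forall y, y ∈ X -> ap g y ∈ suc (ap b y)) -> exists i, i ∈ l /\ ~ sep X (fun y => ap g y ∈ ap P i) ∈ I).
Proof.
  intros HX Hb. destruct (classic (~ X ∈ I /\ ~ U X b)) as [[H1 H2]|N].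
  - apply NNPP. intro N. apply H2. split; auto. split; auto. split; auto. intros P HP. apply NNPP. intro N1. apply N.
    exists P. split; auto. intros _ _ g Hg. apply NNPP. intro N2. apply N1. exists g. split.
    + apply I_emp. intros y Hy. apply in_sep in Hy; [|df]. destruct Hy. auto.
    + intros i Hi. apply NNPP. intro N3. apply N2. eauto.
  - destruct Fam_ex as (P & HP). exists P. tauto.
Qed.

(* [J A b X] says that, up to a set in the ideal, [X] is covered by countably many nodes [(A', b')]
   with [b'] below [b]; a witness [w] is a pair of the exceptional set and the sequence of nodes. *)
Definition Nd v := v = opair (fst v) (snd v) /\ U (fst v) (snd v).
Definition below b v y := Nd v /\ y ∈ fst v /\ ap (snd v) y ∈ ap b y.
Definition Jw A b X w := fst w ∈ I /\ forall y, y ∈ X ->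
  y ∈ fst w \/ exists n, n ∈ omega /\ below b (ap (snd w) n) y.
Definition J A b X := subset X A /\ exists w, Jw A b X w.
Lemma D_Nd s : DT T s -> D T (fun e => Nd (s e)).
Proof. apply D_pred1. unfold Nd. df. Qed.
Hint Resolve D_Nd : df.
Lemma D_below s t u : DT T s -> DT T t -> DT T u -> D T (fun e => below (s e) (t e) (u e)).
Proof. apply (D_pred3 (R := below)). unfold below. df. Qed.
Hint Resolve D_below : df.
Lemma D_Jw s t u v : DT T s -> DT T t -> DT T u -> DT T v -> D T (fun e => Jw (s e) (t e) (u e) (v e)).
Proof. apply (D_pred4 (R := Jw)). unfold Jw. df. Qed.
Hint Resolve D_Jw : df.
Lemma D_J s t u : DT T s -> DT T t -> DT T u -> D T (fun e => J (s e) (t e) (u e)).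
Proof. apply (D_pred3 (R := J)). unfold J. df. Qed.
Hint Resolve D_J : df.

(* Otherwise the witnesses form a countable tree; at a point outside all exceptional sets the values of
   the bounds descend along a branch forever. *)
Lemma node_ex : exists A b, U A b /\ ~ J A b A.
Proof.
  apply NNPP. intro N.
  pose (C := prod (Pw Y) (fnset Y (suc l))).
  assert (NC : forall v, Nd v -> exists w, Jw (fst v) (snd v) (fst v) w).
  { intros v Hv. apply NNPP. intro N1. apply N. exists (fst v), (snd v). split; [apply Hv|]. intros [_ H]. auto. }
  destruct (@AC (fun v w => Jw (fst v) (snd v) (fst v) w) (sep C Nd)) as (ch & Hch). df.
  { intros v Hv. apply NC. apply in_sep in Hv; [tauto|df]. }
  pose (v0 := opair Y (lam Y (fun _ => l))).
  assert (Nv0 : Nd v0).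
  { unfold Nd, v0. rewrite fst_opair, snd_opair. split; [auto|]. split; [intro; auto|]. split; [apply Id|]. split.
    - apply lam_fnset. df. intros. apply in_suc. auto.
    - intros P HP. destruct (IP HP) as (g & Hg & Hg'). exists g. split; auto. apply I_emp. intros y Hy. apply in_sep in Hy; [|df].
      destruct Hy as [Hy Hy']. apply Hy'. rewrite ap_lam; [|df|auto]. apply in_suc. auto. }
  (* For [a] up to omega, [L a] collects the root and what is reached from it by fewer than [a]
     further steps along the chosen sequences. *)
  pose (L := Rec (fun h => cup (sing v0) (image (prod (Un (image h snd)) omega) (fun z => ap (snd (ap ch (fst z))) (snd z))))).
  assert (HL : DTf L) by (unfold L; df).
  assert (inL : forall a v, Ord a -> v ∈ L a <-> v = v0 \/ exists b w n, b ∈ a /\ w ∈ L b /\ n ∈ omega /\ v = ap (snd (ap ch w)) n).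
  { intros a v Ha. unfold L at 1. rewrite Rec_eq; [|df|auto]. fold L. rewrite in_cup, in_sing, in_image by df. split.
    - intros [E|(z & Hz & E)]; auto. right. apply in_prod in Hz. destruct Hz as (w & n & Hw & Hn & ->).
      rewrite fst_opair, snd_opair in E. apply in_Un in Hw. destruct Hw as (u & Hu & Hw). apply in_image in Hu; [|df].
      destruct Hu as (q & Hq & ->). apply in_lam in Hq; [|df]. destruct Hq as (b & Hb & ->). rewrite snd_opair in Hw. exists b, w, n. auto.
    - intros [E|(b & w & n & Hb & Hw & Hn & E)]; auto. right. exists (opair w n). rewrite fst_opair, snd_opair. split; auto.
      apply opair_prod. split; auto. apply in_Un. exists (L b). split; auto. apply in_image. df. exists (opair b (L b)).
      rewrite snd_opair. split; auto. apply in_lam. df. eauto. }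
  assert (CtL : forall a, Ord a -> subset a omega -> Ct (L a)).
  { apply (Ord_ind (P := fun a => subset a omega -> Ct (L a))). df. intros a Oa IH Ha.
    apply Ct_sub with (cup (image (prod (Un (image a L)) omega) (fun z => ap (snd (ap ch (fst z))) (snd z))) (sing v0)).
    - intros v Hv. rewrite in_cup, in_sing, in_image by df. apply inL in Hv; auto. destruct Hv as [E|(b & w & n & Hb & Hw & Hn & E)]; auto.
      left. exists (opair w n). rewrite fst_opair, snd_opair. split; auto. apply opair_prod. split; auto. apply in_Un. exists (L b). split; auto.
      apply in_image; auto. eauto.
    - apply Ct_adj.
      assert (CU : Ct (Un (image a L))).
      { apply Ct_Un; auto.
        - apply Ct_image; auto. apply le_sub; auto.
        - intros x Hx. apply in_image in Hx; auto. destruct Hx as (b & Hb & ->). apply IH; auto.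
          intros c Hc. apply Ha. eapply Ord_trans; eauto. }
      destruct CU as (c & Hc).
      apply Ct_sub with (image (prod omega omega) (fun z => ap (snd (ap ch (ap c (fst z)))) (snd z))).
      + intros v Hv. apply in_image in Hv; [|df]. destruct Hv as (z & Hz & ->). apply in_prod in Hz. destruct Hz as (w & n & Hw & Hn & ->).
        apply in_image. df. destruct (Hc w Hw) as (k & Hk & Ek). exists (opair k n). rewrite opair_prod, !fst_opair, !snd_opair, Ek. auto.
      + apply Ct_image. df. apply le_omega2. }
  destruct (CtL omega Ord_omega) as (c & Hc). { intro; auto. }
  (* The tree being countable, the union of the exceptional sets of its nodes remains in the
     ideal. *)
  pose (NN := sep Y (fun y => exists v, v ∈ L omega /\ v ∈ sep C Nd /\ y ∈ fst (ap ch v))).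
  assert (HN : NN ∈ I).
  { apply (proj2 (proj2 Id)) with (c := lam omega (fun n => If ap c n ∈ sep C Nd then fst (ap ch (ap c n)) else emp)).
    - intros y Hy. apply in_sep in Hy; [tauto|df].
    - intros n Hn. rewrite ap_lam; auto; [|df]. split_if; [apply (Hch _ m0)|]. apply I_emp. apply in_emp.
    - intros y Hy. apply in_sep in Hy; [|df]. destruct Hy as (Hy & v & Hv & Hv1 & Hv2). destruct (Hc v Hv) as (n & Hn & En).
      exists n. split; auto. rewrite ap_lam; auto; [|df]. rewrite En. split_if; [auto|tauto]. }
  destruct (@I_not (diff Y NN)) as (y & Hy).
  { intros y Hy. apply in_diff in Hy. tauto. }
  { intro H. apply IY. apply I_cup with (1 := H) (2 := HN). intros y Hy. rewrite in_diff. destruct (classic (y ∈ NN)); auto. }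
  apply in_diff in Hy. destruct Hy as [Hy Ny].
  (* The bounds at [y] of the nodes through [y]. At the least of them the witness of the node offers
     a child with a smaller bound. *)
  pose (Ach := fun x => exists v, v ∈ L omega /\ Nd v /\ v ∈ C /\ y ∈ fst v /\ ap (snd v) y = x).
  assert (DA : Df Ach) by (unfold Ach; df).
  assert (HCv : v0 ∈ C).
  { apply opair_prod. split; [apply in_Pw; intro; auto|]. apply lam_fnset. df. intros. apply in_suc. auto. }
  destruct (@Ord_least _ _ Ach l) as (x & Ox & (v & Hv & HNv & HCv' & Hyv & Ex) & Lx); auto.
  { exists v0. split; [apply inL; auto using Ord_omega|]. split; auto. split; auto. unfold v0. rewrite fst_opair, snd_opair. split; auto. rewrite ap_lam; auto. df. }
  assert (HvS : v ∈ sep C Nd) by (apply in_sep; [df|auto]).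
  destruct (Hch v HvS) as [_ Hcv]. destruct (Hcv y Hyv) as [Hyw|(n & Hn & Hw & Hyw & Hlt)].
  - apply Ny. apply in_sep. df. eauto.
  - apply (Lx (ap (snd (ap (snd (ap ch v)) n)) y)); [rewrite <- Ex; auto|].
    exists (ap (snd (ap ch v)) n). split; [|split; [auto|split; [|auto]]].
    + apply inL in Hv; auto using Ord_omega. apply inL; auto using Ord_omega. right. destruct Hv as [E|(b & w & k & Hb & Hw' & Hk & E)].
      * exists emp, v, n. split; [apply emp_lim, lim_omega|]. split; [apply inL; auto using Ord_emp|]. auto.
      * exists (suc b), v, n. split; [apply lim_omega; auto|]. split; [|auto]. apply inL. eauto using Ord_suc, Ord_n. right. exists b, w, k.
        split; auto. apply in_suc; auto.
    + destruct Hw as [E (HA & _ & Hb & _)]. rewrite E. apply opair_prod. rewrite in_Pw. auto.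
Qed.

(** * A node that countably many lower nodes do not cover *)

Section Node.
Context (A b : M) (UA : U A b) (NJ : ~ J A b A).
Let AY : subset A Y := proj1 UA.
Let bF : b ∈ fnset Y (suc l) := proj1 (proj2 (proj2 UA)).
Notation J := (J A b).

Lemma J_I X : subset X A -> X ∈ I -> J X.
Proof. intros H1 H2. split; auto. exists (opair X emp). unfold Jw. rewrite fst_opair. auto. Qed.
Lemma J_U X b' : subset X A -> U X b' -> (forall y, y ∈ X -> ap b' y ∈ ap b y) -> J X.
Proof.
  intros H1 H2 H3. split; auto. exists (opair emp (lam omega (fun _ => opair X b'))). unfold Jw. rewrite fst_opair, snd_opair. split.
  - apply I_emp. apply in_emp.
  - intros y Hy. right. exists emp. assert (E0 : emp ∈ omega) by (apply emp_lim, lim_omega). split; auto.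
    rewrite ap_lam; auto; [|df]. unfold below, Nd. rewrite fst_opair, snd_opair. auto.
Qed.
Lemma J_cl c X : subset X A -> (forall n, n ∈ omega -> J (ap c n)) -> (forall y, y ∈ X -> exists n, n ∈ omega /\ y ∈ ap c n) -> J X.
Proof.
  intros HX Hc Hcov. split; auto.
  destruct (@AC (fun n w => Jw A b (ap c n) w) omega) as (W & HW). df. { intros n Hn. apply Hc; auto. }
  destruct (@reindex _ _ (prod omega omega) omega (fun z => ap (snd (ap W (fst z))) (snd z))) as (s & Hs & _). df. apply le_omega2.
  pose (N := sep Y (fun y => exists n, n ∈ omega /\ y ∈ fst (ap W n))).
  exists (opair N s). unfold Jw. rewrite fst_opair, snd_opair. split.
  - apply (proj2 (proj2 Id)) with (c := lam omega (fun n => fst (ap W n))).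
    + intros y Hy. apply in_sep in Hy; [tauto|df].
    + intros n Hn. rewrite ap_lam; auto; [|df]. apply (HW n Hn).
    + intros y Hy. apply in_sep in Hy; [|df]. destruct Hy as (_ & n & Hn & Hy). exists n. split; auto. rewrite ap_lam; auto. df.
  - intros y Hy. destruct (Hcov y Hy) as (n & Hn & Hyn). destruct (HW n Hn) as [_ H]. destruct (H y Hyn) as [H1|(k & Hk & H1)].
    + left. apply in_sep; [df|]. split; [apply AY, HX, Hy|eauto].
    + right. destruct (Hs (opair n k)) as (j & Hj & E). { apply opair_prod; auto. } rewrite fst_opair, snd_opair in E.
      exists j. rewrite E. auto.
Qed.
Lemma J_cup X X' X'' : subset X'' A -> J X -> J X' -> (forall y, y ∈ X'' -> y ∈ X \/ y ∈ X') -> J X''.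
Proof.
  intros S H1 H2 H.
  assert (E0 : emp ∈ omega) by (apply emp_lim, lim_omega).
  assert (E1 : suc emp ∈ omega) by (apply lim_omega; auto).
  apply J_cl with (c := lam omega (fun n => If n = emp then X else X')); auto.
  - intros n Hn. rewrite ap_lam; auto; [|df]. split_if; auto.
  - intros y Hy. destruct (H y Hy).
    + exists emp. split; auto. rewrite ap_lam; auto; [|df]. split_if; [auto|tauto].
    + exists (suc emp). split; auto. rewrite ap_lam; auto; [|df]. split_if; auto. destruct (suc_nemp e).
Qed.
Lemma b_Ord_A y : y ∈ A -> Ord (ap b y) /\ subset (ap b y) l.
Proof. intro Hy. apply b_Ord; auto. Qed.

(** The cofinality of [ap b y] is at least [m]; lengths 0 and 1 also exclude zero and successors. *)
Definition cof_large y := forall c e, c ∈ m -> exists x, x ∈ ap b y /\ forall i, i ∈ c -> ap e i ∈ ap b y -> ap e i ∈ x.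
Lemma D_cof_large s : DT T s -> D T (fun e => cof_large (s e)).
Proof. apply D_pred1. unfold cof_large. df. Qed.
Hint Resolve D_cof_large : df.

(* A function below [b] lies below one of the few functions obtained by choosing a member of a
   short cofinal sequence at each point. *)
Lemma small_cof_J n : n ∈ omega -> J (sep A (fun y => exists e, forall x, x ∈ ap b y -> exists i, i ∈ ap kp n /\ ap e i ∈ ap b y /\ ~ ap e i ∈ x)).
Proof.
  intro Hn. set (A' := sep _ _).
  assert (HA' : forall y, y ∈ A' <-> y ∈ A /\ exists e, forall x, x ∈ ap b y -> exists i, i ∈ ap kp n /\ ap e i ∈ ap b y /\ ~ ap e i ∈ x).
  { intro y. unfold A'. rewrite in_sep by df. tauto. }
  clearbody A'. assert (SA : subset A' A) by (intros y Hy; apply HA' in Hy; tauto).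
  destruct (@AC (fun y e => forall x, x ∈ ap b y -> exists i, i ∈ ap kp n /\ ap e i ∈ ap b y /\ ~ ap e i ∈ x) A') as (e & He). df.
  { intros y Hy. apply HA'. auto. }
  (* The bound that a selector [i] picks from the short cofinal sequences, with value [emp] where it
     picks nothing below [b]. *)
  pose (bb := fun i => lam Y (fun y => If y ∈ A' /\ ap (ap e y) (ap i y) ∈ ap b y then ap (ap e y) (ap i y) else emp)).
  assert (Dbb : DTf bb) by (unfold bb; df). opdf bb.
  assert (Fbb : forall i, bb i ∈ fnset Y (suc l)).
  { intro i. apply lam_fnset. df. intros y Hy. apply in_suc. left. split_if; [|apply el]. destruct a as [a1 a2]. destruct (b_Ord_A (SA y a1)) as [_ S]. auto. }
  pose (Ix := prod (Pw A') (Pw (prod A' (ap kp n)))).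
  assert (SIx : Sm Ix).
  { assert (SA' : Sm A') by (apply SmY; intros y Hy; auto).
    apply Sm_prod; auto; apply Sm_Pw; auto. apply Sm_prod; auto. apply Sm_in; auto. }
  destruct (@AC (fun z P => Fam P /\ (~ fst z ∈ I -> ~ U (fst z) (bb (snd z)) -> forall g,
   (forall y, y ∈ fst z -> ap g y ∈ suc (ap (bb (snd z)) y)) -> exists i, i ∈ l /\ ~ sep (fst z) (fun y => ap g y ∈ ap P i) ∈ I)) Ix) as (Q & HQ). df.
  { intros z Hz. apply not_U_witness; auto. apply in_prod in Hz. destruct Hz as (X & i & HX & _ & ->). rewrite fst_opair.
    apply in_Pw in HX. intros y Hy; auto. }
  (* There are few pairs of a subset and a selector, so a single [g] below [b] avoids the families
     chosen for all of them. *)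
  destruct (@U_avoid A b (prod Ix l) (fun z => ap (ap Q (fst z)) (snd z)) UA) as (g & Hg1 & Hg2). df.
  { apply le_prod_l; [|apply le_refl]. apply Sm_l; auto. }
  { intros z Hz. apply in_prod in Hz. destruct Hz as (w & i & Hw & Hi & ->). rewrite fst_opair, snd_opair. apply (HQ w Hw); auto. }
  pose (B := sep A' (fun y => ap g y ∈ ap b y)).
  assert (HB : forall y, y ∈ B <-> y ∈ A' /\ ap g y ∈ ap b y) by (intro y; unfold B; rewrite in_sep by df; tauto).
  apply J_cup with (X := sep A (fun y => ~ ap g y ∈ ap b y)) (X' := B); auto.
  - apply J_I; auto. intros y Hy. apply in_sep in Hy; [tauto|df].
  - destruct (classic (B ∈ I)) as [BI|BI]. { apply J_I; auto. intros y Hy. apply HB in Hy. apply SA. tauto. }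
    (* The selector read off from [g]: the first place where the cofinal sequence is not below
       [ap g y]. *)
    pose (i' := lam B (fun y => mu (fun j => j ∈ ap kp n /\ ap (ap e y) j ∈ ap b y /\ ~ ap (ap e y) j ∈ ap g y))).
    assert (Hi : forall y, y ∈ B -> ap i' y ∈ ap kp n /\ ap (ap e y) (ap i' y) ∈ ap b y /\ ~ ap (ap e y) (ap i' y) ∈ ap g y).
    { intros y Hy. unfold i'. rewrite ap_lam; auto; [|df]. apply HB in Hy. destruct Hy as [Hy Hgy].
      destruct (He y Hy (ap g y) Hgy) as (j & Hj & Hj').
      destruct (@mu_spec _ _ (fun j => j ∈ ap kp n /\ ap (ap e y) j ∈ ap b y /\ ~ ap (ap e y) j ∈ ap g y) j) as (_ & Hm & _).
      - df.
      - apply Ord_in with (2 := Hj). apply Ord_in with m; auto.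
      - auto.
      - exact Hm. }
    assert (Hi' : i' ∈ Pw (prod A' (ap kp n))).
    { apply in_Pw. intros z Hz. assert (Hz' := Hz). apply in_lam in Hz'; [|df]. destruct Hz' as (y & Hy & E).
      assert (Hm := proj1 (Hi y Hy)). unfold i' in Hm. rewrite ap_lam in Hm; auto; [|df]. rewrite E. apply opair_prod. split; auto.
      apply HB in Hy. tauto. }
    assert (HIx : opair B i' ∈ Ix).
    { apply opair_prod. split; auto. apply in_Pw. intros y Hy. apply HB in Hy. tauto. }
    assert (Ebb : forall y, y ∈ B -> ap (bb i') y = ap (ap e y) (ap i' y)).
    { intros y Hy. assert (Hy' := Hy). apply HB in Hy'. unfold bb. rewrite ap_lam; [|df|apply AY, SA; tauto].
      split_if; auto. destruct (Hi y Hy). tauto. }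
    destruct (classic (U B (bb i'))) as [UB|UB].
    + apply J_U with (b' := bb i'); auto.
      * intros y Hy. apply HB in Hy. apply SA. tauto.
      * intros y Hy. rewrite Ebb; auto. apply Hi. auto.
    (* If [bb i'] does not bound a node on [B], the family chosen for this pair catches [g] on a
       positive part of [B], although [g] avoids that family. *)
    + exfalso. destruct (HQ _ HIx) as [_ Hm]. rewrite fst_opair, snd_opair in Hm. destruct (Hm BI UB g) as (k & Hk & Nk).
      * intros y Hy. rewrite Ebb; auto. destruct (Hi y Hy) as (_ & H1 & H2). apply HB in Hy.
        assert (Ob : Ord (ap b y)) by (apply b_Ord_A; apply SA; tauto).
        apply in_suc. destruct (@Ord_tri _ _ (ap g y) (ap (ap e y) (ap i' y))) as [O|[O|O]]; auto; [eapply Ord_in; eauto; tauto|eapply Ord_in; eauto|tauto].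
      * apply Nk. assert (H3 := Hg2 (opair (opair B i') k)). rewrite fst_opair, snd_opair in H3.
        apply I_le with (1 := H3 (proj2 (opair_prod _ _ _ _) (conj HIx Hk))). intros y Hy. rewrite in_sep in * by df.
        destruct Hy as [Hy Hy']. apply HB in Hy. split; auto. apply SA. tauto.
  - intros y Hy. rewrite HB, in_sep by df. destruct (classic (ap g y ∈ ap b y)); auto.
Qed.
(** Points of small cofinality form countably many sets in [J]. At the others, each ordinal below
    [ap b y] is good for some number below [m] by minimality of [l]; the cofinality being
    uncountable, one [ap kp n] serves cofinally often. This [n] depends on [y], but it can be fixed
    on a part outside [J], again by countable closure. *)
Lemma good_part_ex : exists n A2, n ∈ omega /\ subset A2 A /\ ~ J A2 /\ forall y, y ∈ A2 -> cof_large y /\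
  forall x, x ∈ ap b y -> exists a, a ∈ ap b y /\ x ∈ a /\ Good (ap kp n) a.
Proof.
  apply NNPP. intro N. apply NJ.
  assert (SS : forall Q, Df Q -> subset (sep A Q) A) by (intros Q HQ y Hy; apply in_sep in Hy; tauto).
  apply J_cup with (X := sep A (fun y => ~ cof_large y)) (X' := sep A cof_large).
  - intro; auto.
  - apply J_cl with (c := lam omega (fun n => sep A (fun y => exists e, forall x, x ∈ ap b y -> exists i, i ∈ ap kp n /\ ap e i ∈ ap b y /\ ~ ap e i ∈ x))).
    + apply SS. df.
    + intros n Hn. rewrite ap_lam; auto; [|df]. apply small_cof_J. auto.
    + intros y Hy. apply in_sep in Hy; [|df]. destruct Hy as [Hy Hcl]. apply NNPP. intro N1. apply Hcl. intros c e Hc.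
      apply NNPP. intro N2. destruct (Hcof Hc) as (n & Hn & Hs). apply N1. exists n. split; auto. rewrite ap_lam; auto; [|df].
      apply in_sep. df. split; auto. exists e. intros x Hx. apply NNPP. intro N3. apply N2. exists x. split; auto.
      intros i Hi Hei. apply NNPP. intro N4. apply N3. exists i. auto.
  - apply J_cl with (c := lam omega (fun n => sep A (fun y => cof_large y /\ forall x, x ∈ ap b y -> exists a, a ∈ ap b y /\ x ∈ a /\ Good (ap kp n) a))).
    + apply SS. df.
    + intros n Hn. rewrite ap_lam; auto; [|df]. apply NNPP. intro N1. apply N. eexists n, _. split; [exact Hn|].
      split; [|split; [exact N1|]]. { apply SS. df. } intros y Hy. apply in_sep in Hy; [tauto|df].
    + intros y Hy. apply in_sep in Hy; [|df]. destruct Hy as [Hy Hcl]. destruct (b_Ord_A Hy) as [Oby Sby].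
      apply NNPP. intro N1.
      pose (e := lam omega (fun n => mu (fun x => x ∈ ap b y /\ ~ exists a, a ∈ ap b y /\ x ∈ a /\ Good (ap kp n) a))).
      assert (He : forall n, n ∈ omega -> ap e n ∈ ap b y /\ ~ exists a, a ∈ ap b y /\ ap e n ∈ a /\ Good (ap kp n) a).
      { intros n Hn. unfold e. rewrite ap_lam; auto; [|df].
        assert (Hx : exists x, x ∈ ap b y /\ ~ exists a, a ∈ ap b y /\ x ∈ a /\ Good (ap kp n) a).
        { apply NNPP. intro N2. apply N1. exists n. split; auto. rewrite ap_lam; auto; [|df]. apply in_sep. df. split; auto. split; auto.
          intros x Hx. apply NNPP. intro N3. apply N2. exists x. auto. }
        destruct Hx as (x & Hx).
        destruct (@mu_spec _ _ (fun x => x ∈ ap b y /\ ~ exists a, a ∈ ap b y /\ x ∈ a /\ Good (ap kp n) a) x) as (_ & Hm & _).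
        - df.
        - apply Ord_in with (2 := proj1 Hx). auto.
        - exact Hx.
        - exact Hm. }
      destruct (Hcl omega e wm) as (x & Hx & Hex).
      destruct (Hcl (suc emp) (lam (suc emp) (fun _ => x))) as (x' & Hx' & Hex').
      { apply (@Ord_trans _ m (suc emp) omega); auto. apply lim_omega, emp_lim, lim_omega. }
      assert (E0 : emp ∈ suc emp) by (apply in_suc; auto).
      specialize (Hex' emp E0). rewrite ap_lam in Hex'; auto; [|df]. specialize (Hex' Hx).
      destruct (Lg (Sby _ Hx')) as (k & Hk & Gk). destruct (Hcof Hk) as (n & Hn & Hs).
      destruct (He n Hn) as [H1 H2]. apply H2. exists x'. split; auto. split; [|apply Good_mono with (1 := Hs); auto].
      apply (@Ord_trans _ x' (ap e n) x); auto. eapply Ord_in; eauto.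
  - intros y Hy. rewrite !in_sep by df. destruct (classic (cof_large y)); auto.
Qed.

(** * Almost disjoint functions below the bound, and the count *)

Section Final.
Context (n0 A2 : M) (Hn0 : n0 ∈ omega) (A2A : subset A2 A) (NJ2 : ~ J A2)
  (Hcl : forall y, y ∈ A2 -> cof_large y)
  (Hub : forall y, y ∈ A2 -> forall x, x ∈ ap b y -> exists a, a ∈ ap b y /\ x ∈ a /\ Good (ap kp n0) a).

(** By recursion: the ranges of the earlier functions are at most [l] many small sets, and a
    function avoiding them modulo the ideal agrees with each earlier one only on a set in the ideal.
    Where it is not below [b] its value is reset to [emp]. *)
Lemma almost_disjoint_ex : exists G, DTf G /\ forall z, z ∈ l -> G z ∈ fnset Y l /\ sep A (fun y => ~ ap (G z) y ∈ ap b y) ∈ I /\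
  forall w, w ∈ z -> sep A (fun y => ap (G z) y = ap (G w) y) ∈ I.
Proof.
  destruct (@AC (fun S g => le S l -> g ∈ fnset Y l /\ sep A (fun y => ~ ap g y ∈ ap b y) ∈ I /\
     forall h, h ∈ S -> sep A (fun y => ap g y = ap h y) ∈ I) (Pw (fnset Y l))) as (ch & Hch). df.
  { intros S HS. apply in_Pw in HS. destruct (classic (le S l)) as [L|L]; [|exists emp; tauto].
    destruct (@U_avoid A b S (fun h => image Y (ap h)) UA) as (g & Hg1 & Hg2); auto. df.
    { intros j Hj. apply SmYimage. df. }
    exists (lam Y (fun y => If y ∈ A /\ ap g y ∈ ap b y then ap g y else emp)). intros _. split; [|split].
    - apply lam_fnset. df. intros y Hy. split_if; [|apply el]. apply (proj2 (b_Ord_A (proj1 a))). tauto.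
    - apply I_le with (1 := Hg1). intros y Hy. rewrite in_sep in * by df. destruct Hy as [Hy Hy']. split; auto.
      intro H. apply Hy'. rewrite ap_lam; [|df|auto]. split_if; tauto.
    - intros h Hh. apply I_cup with (1 := Hg1) (2 := Hg2 h Hh). intros y Hy. rewrite in_sep in * by df. destruct Hy as [Hy Hy'].
      rewrite in_sep by df. rewrite ap_lam in Hy'; [|df|auto]. destruct (excluded_middle_informative (y ∈ A /\ ap g y ∈ ap b y)) as [D|D]; [|left; tauto].
      right. split; auto. apply in_image. df. exists y. auto. }
  pose (G := Rec (fun h => ap ch (image h snd))).
  assert (HG : DTf G) by (unfold G; df).
  assert (EG : forall z, Ord z -> G z = ap ch (image z G)).
  { intros z Oz. unfold G at 1. rewrite Rec_eq; [|df|auto]. fold G. f_equal. apply ext. intro x. rewrite !in_image by df. split.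
    - intros (q & Hq & ->). apply in_lam in Hq; auto. destruct Hq as (w & Hw & ->). rewrite snd_opair. eauto.
    - intros (w & Hw & ->). exists (opair w (G w)). rewrite snd_opair. split; auto. apply in_lam; eauto. }
  exists G. split; auto.
  assert (H : forall z, Ord z -> z ∈ l -> G z ∈ fnset Y l /\ sep A (fun y => ~ ap (G z) y ∈ ap b y) ∈ I /\
  forall w, w ∈ z -> sep A (fun y => ap (G z) y = ap (G w) y) ∈ I); [|eauto using Ord_in].
  opdf G.
  apply (Ord_ind (P := fun z => z ∈ l -> G z ∈ fnset Y l /\ sep A (fun y => ~ ap (G z) y ∈ ap b y) ∈ I /\
    forall w, w ∈ z -> sep A (fun y => ap (G z) y = ap (G w) y) ∈ I)). df.
  intros z Oz IH Hz.
  assert (HS : image z G ∈ Pw (fnset Y l)).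
  { apply in_Pw. intros h Hh. apply in_image in Hh; auto. destruct Hh as (w & Hw & ->). apply IH; auto. eapply Ord_trans; eauto. }
  rewrite !(EG z Oz). destruct (Hch _ HS) as (H1 & H2 & H3).
  { apply (@le_trans _ _ _ z); [apply le_image_Ord; auto|]. apply le_sub. apply Ord_sub; auto. }
  split; auto. split; auto. intros w Hw. apply H3. apply in_image; eauto.
Qed.

(* Either one bound [c] works for all [G z], or every bound is dominated by some [G z]. *)
Lemma bounding_ex G : DTf G -> (forall z, z ∈ l -> sep A (fun y => ~ ap (G z) y ∈ ap b y) ∈ I) ->
  exists B : M -> M, DTf B /\ (forall j y, j ∈ l -> y ∈ A2 -> ap (B j) y ∈ ap b y) /\
  forall t u, t ∈ m -> (forall i, i ∈ t -> ap u i ∈ l) -> exists j, j ∈ l /\ forall i, i ∈ t ->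
    ~ J (sep A2 (fun y => ap (G (ap u i)) y ∈ suc (ap (B j) y))).
Proof.
  intros HG HGb. opdf G.
  destruct (classic (exists c, (forall y, y ∈ A2 -> ap c y ∈ ap b y) /\ forall z, z ∈ l -> ~ J (sep A2 (fun y => ap (G z) y ∈ suc (ap c y))))) as [(c & Hc1 & Hc2)|N].
  - exists (fun _ => c). split; [df|]. split; [auto|]. intros t u Ht Hu. exists emp. split; [apply el|]. intros i Hi. apply Hc2. auto.
  - assert (N' : forall c, (forall y, y ∈ A2 -> ap c y ∈ ap b y) -> exists z, z ∈ l /\ J (sep A2 (fun y => ap (G z) y ∈ suc (ap c y)))).
    { intros c Hc. apply NNPP. intro N1. apply N. exists c. split; auto. intros z Hz HJ. apply N1. eauto. }
    exists (fun z => lam A2 (fun y => If ap (G z) y ∈ ap b y then ap (G z) y else emp)). split; [df|]. split.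
    + intros j y Hj Hy. rewrite ap_lam; auto; [|df]. split_if; auto. destruct (Hcl Hy (c := emp) emp) as (x & Hx & _).
      { apply (Ord_trans Om (emp_lim lim_omega) wm). }
      assert (Ob : Ord (ap b y)) by (apply b_Ord_A; auto).
      destruct (Ord_tri Ord_emp Ob) as [E|[E|E]]; auto; [rewrite <- E in Hx; destruct (in_emp Hx)|destruct (in_emp E)].
    + intros t u Ht Hu.
      (* The least pointwise bound of fewer than [m] of the functions; it stays below [ap b y]
         because the cofinality there is large. *)
      pose (c := lam A2 (fun y => mu (fun x => x ∈ ap b y /\ forall i, i ∈ t -> ap (G (ap u i)) y ∈ ap b y -> ap (G (ap u i)) y ∈ x))).
      assert (Hc : forall y, y ∈ A2 -> ap c y ∈ ap b y /\ forall i, i ∈ t -> ap (G (ap u i)) y ∈ ap b y -> ap (G (ap u i)) y ∈ ap c y).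
      { intros y Hy. unfold c. rewrite ap_lam; auto; [|df]. destruct (Hcl Hy (c := t) (lam t (fun i => ap (G (ap u i)) y)) Ht) as (x & Hx & Hx').
        destruct (@mu_spec _ _ (fun x => x ∈ ap b y /\ forall i, i ∈ t -> ap (G (ap u i)) y ∈ ap b y -> ap (G (ap u i)) y ∈ x) x) as (_ & Hm & _).
        - df.
        - apply Ord_in with (2 := Hx). apply b_Ord_A; auto.
        - split; auto. intros i Hi Hi'. specialize (Hx' i Hi). rewrite ap_lam in Hx'; auto. df.
        - exact Hm. }
      destruct (N' c) as (z & Hz & HJ). { intros y Hy. apply Hc; auto. }
      exists z. split; auto. intros i Hi HJ2. apply NJ2.
      assert (J3 : J (sep A2 (fun y => ~ ap (G z) y ∈ ap b y \/ ~ ap (G (ap u i)) y ∈ ap b y))).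
      { apply J_I; [intros y Hy; apply in_sep in Hy; [apply A2A; tauto|df]|].
        apply I_cup with (1 := HGb z Hz) (2 := HGb _ (Hu i Hi)). intros y Hy. rewrite in_sep in * by df. rewrite in_sep by df.
        destruct Hy as [Hy D]. apply A2A in Hy. tauto. }
      assert (J4 : J (sep A2 (fun y => ap (G z) y ∈ suc (ap c y) \/ ~ ap (G z) y ∈ ap b y \/ ~ ap (G (ap u i)) y ∈ ap b y))).
      { apply J_cup with (2 := HJ) (3 := J3).
        - intros y Hy. apply in_sep in Hy; [apply A2A; tauto|df].
        - intros y Hy. rewrite !in_sep in * by df. tauto. }
      apply J_cup with (2 := J4) (3 := HJ2); auto.
      intros y Hy. rewrite !in_sep by df. destruct (classic (ap (G z) y ∈ ap b y)) as [H1|]; [|auto].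
      destruct (classic (ap (G (ap u i)) y ∈ ap b y)) as [H2|]; [|auto].
      destruct (classic (ap (G z) y ∈ suc (ap c y))) as [H3|H3]; [auto|]. right. split; auto.
      rewrite ap_lam; auto; [|df]. split_if; [|tauto].
      destruct (Hc y Hy) as [H4 H5]. specialize (H5 i Hi H2).
      assert (Ob : Ord (ap b y)) by (apply b_Ord_A; auto). apply in_suc. left.
      assert (Oz := Ord_in Ob H1). assert (Oc := Ord_in Ob H4).
      destruct (Ord_tri Oc Oz) as [O|[O|O]].
      * apply (Ord_trans Oz H5 O).
      * rewrite <- O. auto.
      * exfalso. apply H3. apply in_suc. auto.
Qed.
(* The families refuting the bounds [E j], composed with the covers of the ordinals [E j y], give small
   sets [S j X i C n]: the functions [G z] are pairwise different on [C], so they number no more than their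
   possible restrictions to [C]. Some [u] is covered by no [k1] of the [S j X i C n]; but for a bound [j]
   of the [G (u i)], few codes [(X, xi)] suffice to find an [S j X i C n] containing each [u i]. *)
Lemma good_part_false : False.
Proof.
  destruct almost_disjoint_ex as (G & HG & HGp).
  assert (GF : forall z, z ∈ l -> G z ∈ fnset Y l) by (intros z Hz; apply (HGp z Hz)).
  assert (Gd : forall z w, z ∈ l -> w ∈ z -> sep A (fun y => ap (G z) y = ap (G w) y) ∈ I) by (intros z w Hz Hw; apply (HGp z Hz); auto).
  destruct (@bounding_ex G HG) as (B & HB & HBb & HBu). { intros z Hz. apply (HGp z Hz). }
  opdf G. opdf B.
  (* Raises [B j] to the least ordinal above it that is good for the common number [ap kp n0]; such
     ordinals are cofinal below [b]. *)
  pose (E := fun j => lam Y (fun y => If y ∈ A2 then mu (fun a => a ∈ ap b y /\ ap (B j) y ∈ a /\ Good (ap kp n0) a) else emp)).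
  assert (HE : DTf E) by (unfold E; df). opdf E.
  assert (EP : forall j y, j ∈ l -> y ∈ A2 -> ap (E j) y ∈ ap b y /\ ap (B j) y ∈ ap (E j) y /\ Good (ap kp n0) (ap (E j) y)).
  { intros j y Hj Hy. unfold E. rewrite ap_lam; [|df|apply AY, A2A, Hy]. split_if; [|tauto].
    destruct (Hub Hy (HBb j y Hj Hy)) as (a & Ha).
    destruct (@mu_spec _ _ (fun a => a ∈ ap b y /\ ap (B j) y ∈ a /\ Good (ap kp n0) a) a) as (_ & Hm & _).
    - df.
    - apply Ord_in with (2 := proj1 Ha). apply b_Ord_A; auto.
    - exact Ha.
    - exact Hm. }
  assert (FE : forall j, j ∈ l -> E j ∈ fnset Y (suc l)).
  { intros j Hj. apply in_fnset. split.
    - unfold E at 1. apply lam_ext; [|df|df]. intros y Hy. unfold E. rewrite ap_lam; auto. df.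
    - intros y Hy. apply in_suc. left. destruct (classic (y ∈ A2)) as [Hy2|Hy2].
      + apply (proj2 (b_Ord_A (A2A Hy2))). apply EP; auto.
      + unfold E. rewrite ap_lam; [|df|auto]. split_if; [tauto|apply el]. }
  assert (EO : forall j y, j ∈ l -> y ∈ A2 -> Ord (ap (E j) y) /\ ap (E j) y ∈ l).
  { intros j y Hj Hy. destruct (b_Ord_A (A2A Hy)) as [O S]. destruct (EP j y Hj Hy) as [H1 _]. split; [eapply Ord_in; eauto|auto]. }
  assert (A2Y : subset A2 Y) by (intros y Hy; auto).
  clearbody E.
  (* A set outside [J] is not in [I], and with the bound [E j], which is below [b], it is no node;
     hence a refuting family exists. *)
  destruct (@AC (fun z P => Fam P /\ (~ J (snd z) -> forall g, (forall y, y ∈ snd z -> ap g y ∈ suc (ap (E (fst z)) y)) ->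
     exists i, i ∈ l /\ ~ sep (snd z) (fun y => ap g y ∈ ap P i) ∈ I)) (prod l (Pw A2))) as (Q & HQ). df.
  { intros z Hz. apply in_prod in Hz. destruct Hz as (j & X & Hj & HX & ->). rewrite fst_opair, snd_opair. apply in_Pw in HX.
    destruct (@not_U_witness X (E j)) as (P & HP & HP'); auto. { intros y Hy; auto. }
    exists P. split; auto. intro NX. apply HP'.
    - intro XI. apply NX. apply J_I; auto. intros y Hy; auto.
    - intro UX. apply NX. apply J_U with (E j); auto. { intros y Hy; auto. } intros y Hy. apply EP; auto. }
  assert (HQF : forall j X i, j ∈ l -> subset X A2 -> i ∈ l -> Sm (ap (ap Q (opair j X)) i)).
  { intros j X i Hj HX Hi. apply (HQ (opair j X)); auto. apply opair_prod. rewrite in_Pw. auto. }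
  assert (HQN : forall j X g, j ∈ l -> subset X A2 -> ~ J X -> (forall y, y ∈ X -> ap g y ∈ suc (ap (E j) y)) ->
     exists i, i ∈ l /\ ~ sep X (fun y => ap g y ∈ ap (ap Q (opair j X)) i) ∈ I).
  { intros j X g Hj HX NX Hg. destruct (HQ (opair j X)) as [_ Hm]. { apply opair_prod. rewrite in_Pw. auto. }
    rewrite fst_opair, snd_opair in Hm. auto. }
  clear HQ.
  (* The codes are pairs of a subset of [A2] and a selector into [ap kp n0]; [k1] bounds their
     number, and [t1] is a length at which [k1] pieces are too few. *)
  assert (Hk : Sm (prod (Pw A2) (fnset A2 (ap kp n0)))).
  { assert (S2 : Sm A2) by (apply SmY; auto). apply Sm_prod; auto. apply Sm_Pw; auto. apply Sm_fnset; auto. apply Sm_in; auto. }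
  destruct Hk as (k1 & Hk1 & Lk1). destruct (uncovered_ex Hk1) as (t1 & Ht1 & Bt1).
  destruct (@AC (fun a P => Good (ap kp n0) a -> (forall i, i ∈ a -> Sm (ap P i)) /\ Covers a P t1 (ap kp n0)) l) as (PP & HPP). df.
  { intros a Ha. destruct (classic (Good (ap kp n0) a)) as [Ga|Ga]; [|exists emp; tauto]. destruct (Ga t1 Ht1) as (P & HP). exists P. auto. }
  pose (S := fun j X i C n => sep l (fun z => forall y, y ∈ C -> exists k, k ∈ ap (ap Q (opair j X)) i /\ k ∈ ap (E j) y /\
    le (ap (ap PP (ap (E j) y)) k) (ap kp n) /\ ap (G z) y ∈ ap (ap PP (ap (E j) y)) k)).
  assert (inS : forall j X i C n z, z ∈ S j X i C n <-> z ∈ l /\ forall y, y ∈ C -> exists k, k ∈ ap (ap Q (opair j X)) i /\ k ∈ ap (E j) y /\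
    le (ap (ap PP (ap (E j) y)) k) (ap kp n) /\ ap (G z) y ∈ ap (ap PP (ap (E j) y)) k).
  { intros. unfold S. rewrite in_sep by df. tauto. }
  (* Restriction of [G z] to [C] is injective in [z], because two of these functions cannot agree on
     a positive set. The restrictions take values in a union of few sets of size at most [ap kp n],
     so there are fewer than [m] of them. *)
  assert (SS : forall j X i C n, j ∈ l -> subset X A2 -> i ∈ l -> subset C A2 -> ~ C ∈ I -> n ∈ omega -> Sm (S j X i C n)).
  { intros j X i C n Hj HX Hi HC NC Hn.
    pose (VF := fun w => If le (ap (ap PP (ap (E j) (fst w))) (snd w)) (ap kp n) then ap (ap PP (ap (E j) (fst w))) (snd w) else emp).
    assert (DV : DTf VF) by (unfold VF; df).
    assert (SV : Sm (Un (image (prod C (ap (ap Q (opair j X)) i)) VF))).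
    { apply Sm_Un with (c := ap kp n); auto.
      - apply Sm_prod; auto. apply SmY. intros y Hy; auto.
      - intros w _. unfold VF. split_if; auto. apply le_sub. intros x Hx. destruct (in_emp Hx). }
    apply Sm_le with (fnset C (Un (image (prod C (ap (ap Q (opair j X)) i)) VF))); [|apply Sm_fnset; auto; apply SmY; intros y Hy; auto].
    apply (@le_intro _ _ _ _ (fun z => lam C (ap (G z)))). df.
    - intros z Hz. apply inS in Hz. destruct Hz as [Hz Hz']. apply lam_fnset. df. intros y Hy.
      destruct (Hz' y Hy) as (k & Hk & Hk2 & Hk3 & Hk4). apply in_Un. exists (VF (opair y k)). split.
      + apply in_image; auto. exists (opair y k). split; auto. apply opair_prod. auto.
      + unfold VF. rewrite fst_opair, snd_opair. split_if; tauto.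
    - intros z w Hz Hw Ezw. apply inS in Hz, Hw. destruct Hz as [Hz _]. destruct Hw as [Hw _].
      assert (Eq : forall y, y ∈ C -> ap (G z) y = ap (G w) y).
      { intros y Hy. rewrite <- (@ap_lam _ _ C (ap (G z))), Ezw, ap_lam; auto; df. }
      destruct (Ord_tri (Ord_in Ol Hz) (Ord_in Ol Hw)) as [O|[O|O]]; auto; exfalso; apply NC.
      + apply I_le with (1 := Gd w z Hw O). intros y Hy. apply in_sep. df. rewrite Eq; auto.
      + apply I_le with (1 := Gd z w Hz O). intros y Hy. apply in_sep. df. rewrite Eq; auto. }
  pose (Ix := prod l (prod (Pw A2) (prod l (prod (Pw A2) omega)))).
  destruct (@Fam_reindex Ix (fun w => If ~ fst (snd (snd (snd w))) ∈ I then S (fst w) (fst (snd w)) (fst (snd (snd w))) (fst (snd (snd (snd w)))) (snd (snd (snd (snd w)))) else emp))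
    as (PF & FPF & HPF). { unfold S. df. }
  { assert (L2 : le (Pw A2) l) by (apply Sm_l; apply Sm_Pw; auto; apply SmY; auto).
    assert (Lw : le omega l) by (apply le_sub, wl). unfold Ix. auto using le_prod_l, le_refl. }
  { intros w Hw. apply in_prod in Hw. destruct Hw as (j & w1 & Hj & Hw & ->). apply in_prod in Hw. destruct Hw as (X & w2 & HX & Hw & ->).
    apply in_prod in Hw. destruct Hw as (i & w3 & Hi & Hw & ->). apply in_prod in Hw. destruct Hw as (C & n & HC & Hn & ->).
    rewrite ?snd_opair, ?fst_opair, ?snd_opair, ?fst_opair. apply in_Pw in HX, HC. split_if; auto. apply Sm_emp; auto. }
  assert (HPS : forall j X i C n, j ∈ l -> subset X A2 -> i ∈ l -> subset C A2 -> ~ C ∈ I -> n ∈ omega -> exists k, k ∈ l /\ ap PF k = S j X i C n).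
  { intros j X i C n Hj HX Hi HC NC Hn. destruct (HPF (opair j (opair X (opair i (opair C n))))) as (k & Hk & Ek).
    - unfold Ix. rewrite !opair_prod, !in_Pw. auto 10.
    - rewrite ?snd_opair, ?fst_opair, ?snd_opair, ?fst_opair in Ek.
      exists k. split; auto. destruct (excluded_middle_informative (~ C ∈ I)); tauto. }
  clear HPF.
  destruct (Bt1 PF FPF) as (u & Hu & Hunc).
  destruct (HBu t1 u Ht1 Hu) as (j & Hj & HJ).
  destruct (@AC (fun y s => forall i, i ∈ t1 -> exists k, k ∈ ap kp n0 /\ ap s k ∈ ap (E j) y /\
     (ap (G (ap u i)) y ∈ ap (E j) y -> ap (G (ap u i)) y ∈ ap (ap PP (ap (E j) y)) (ap s k))) A2) as (sy & Hsy). df.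
  { intros y Hy. destruct (EP j y Hj Hy) as (E1 & E2 & E3). destruct (HPP _ (proj2 (EO j y Hj Hy)) E3) as [_ Cv].
    destruct (Cv (lam t1 (fun i => If ap (G (ap u i)) y ∈ ap (E j) y then ap (G (ap u i)) y else ap (B j) y))) as (s & Hs).
    - intros i Hi. rewrite ap_lam; auto; [|df]. split_if; auto.
    - exists s. intros i Hi. destruct (Hs i Hi) as (k & Hk & Hk2 & Hk3). exists k. split; auto. split; auto. intro Hi2.
      rewrite ap_lam in Hk3; auto; [|df]. destruct (excluded_middle_informative (ap (G (ap u i)) y ∈ ap (E j) y)); tauto. }
  pose (hh := fun q => lam (fst q) (fun y => ap (ap sy y) (ap (snd q) y))).
  assert (Dhh : DTf hh) by (unfold hh; df). opdf hh.
  pose (code := fun q i => fst q = sep A2 (fun y => ap (G (ap u i)) y ∈ suc (ap (B j) y)) /\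
    forall y, y ∈ fst q -> ap (snd q) y ∈ ap kp n0 /\ ap (ap sy y) (ap (snd q) y) ∈ ap (E j) y /\ ap (G (ap u i)) y ∈ ap (ap PP (ap (E j) y)) (ap (ap sy y) (ap (snd q) y))).
  destruct (@AC (fun q k => k ∈ l /\ forall i, i ∈ t1 -> code q i -> ap u i ∈ ap PF k) (prod (Pw A2) (fnset A2 (ap kp n0)))) as (kk & Hkk).
  { unfold code. df. }
  { intros q Hq. destruct (classic (exists i, i ∈ t1 /\ code q i)) as [(i0 & Hi0 & Hc0)|Nc].
    2: { exists emp. split; [apply el|]. intros i Hi Hc. exfalso. eauto. }
    apply in_prod in Hq. destruct Hq as (X & xi & HX & Hxi & ->). unfold code in Hc0. rewrite fst_opair, snd_opair in Hc0.
    destruct Hc0 as [EX HXy]. apply in_Pw in HX.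
    assert (NX : ~ J X) by (rewrite EX; auto).
    pose (h := lam X (fun y => ap (ap sy y) (ap xi y))).
    assert (Eh : forall y, y ∈ X -> ap h y = ap (ap sy y) (ap xi y)) by (intros y Hy; unfold h; rewrite ap_lam; auto; df).
    destruct (HQN j X h Hj HX NX) as (i & Hi & NI).
    { intros y Hy. rewrite Eh; auto. apply in_suc. left. apply HXy; auto. }
    (* The covering pieces are small without a common bound. Sorting the points by the first
       [ap kp n] that bounds the piece would split a positive set into countably many parts, so some
       bound already holds on a positive part. *)
    assert (Hn : exists n, n ∈ omega /\ ~ sep X (fun y => ap h y ∈ ap (ap Q (opair j X)) i /\ le (ap (ap PP (ap (E j) y)) (ap h y)) (ap kp n)) ∈ I).
    { apply NNPP. intro N. apply NI.
      apply (proj2 (proj2 Id)) with (c := lam omega (fun n => sep X (fun y => ap h y ∈ ap (ap Q (opair j X)) i /\ le (ap (ap PP (ap (E j) y)) (ap h y)) (ap kp n)))).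
      - intros y Hy. apply in_sep in Hy; [|df]. destruct Hy as [Hy _]. apply A2Y, HX, Hy.
      - intros n Hn. rewrite ap_lam; auto; [|df]. apply NNPP. intro N1. apply N. eauto.
      - intros y Hy. apply in_sep in Hy; [|df]. destruct Hy as [Hy Hy2]. assert (Hy' := HX _ Hy).
        destruct (HPP _ (proj2 (EO j y Hj Hy')) (proj2 (proj2 (EP j y Hj Hy')))) as [Sp _].
        destruct (@Sm_kp (ap (ap PP (ap (E j) y)) (ap h y))) as (n & Hn & Hle).
        { apply Sp. rewrite Eh; auto. apply HXy; auto. }
        exists n. split; auto. rewrite ap_lam; auto; [|df]. apply in_sep. df. auto. }
    destruct Hn as (n & Hn & NC). set (C := sep X _) in NC.
    assert (HC : forall y, y ∈ C -> y ∈ X /\ ap h y ∈ ap (ap Q (opair j X)) i /\ le (ap (ap PP (ap (E j) y)) (ap h y)) (ap kp n)).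
    { intros y Hy. apply in_sep in Hy; [auto|df]. }
    clearbody C.
    destruct (HPS j X i C n) as (k & Hk & Ek); auto. { intros y Hy. apply HX. apply HC; auto. }
    exists k. split; auto. intros i1 Hi1 Hc1. rewrite Ek. apply inS. split; auto. intros y Hy.
    destruct (HC y Hy) as (H3 & H4 & H5). unfold code in Hc1. rewrite fst_opair, snd_opair in Hc1. destruct Hc1 as [_ Hc1].
    destruct (Hc1 y H3) as (H6 & H7 & H8). exists (ap h y). rewrite <- (Eh y H3) in H7, H8. auto. }
  destruct (@reindex _ _ _ k1 (ap kk) ltac:(df) Lk1) as (s & Hs & _).
  destruct (Hunc s) as (i & Hi & Hi').
  pose (X := sep A2 (fun y => ap (G (ap u i)) y ∈ suc (ap (B j) y))).
  assert (XA : subset X A2) by (intros y Hy; apply in_sep in Hy; [tauto|df]).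
  (* The selector of the code takes the least index of a piece that covers the value at [y]. *)
  pose (xi := lam A2 (fun y => mu (fun k => k ∈ ap kp n0 /\ ap (ap sy y) k ∈ ap (E j) y /\
     (ap (G (ap u i)) y ∈ ap (E j) y -> ap (G (ap u i)) y ∈ ap (ap PP (ap (E j) y)) (ap (ap sy y) k))))).
  assert (Hxi : forall y, y ∈ A2 -> ap xi y ∈ ap kp n0 /\ ap (ap sy y) (ap xi y) ∈ ap (E j) y /\
     (ap (G (ap u i)) y ∈ ap (E j) y -> ap (G (ap u i)) y ∈ ap (ap PP (ap (E j) y)) (ap (ap sy y) (ap xi y)))).
  { intros y Hy. unfold xi. rewrite ap_lam; auto; [|df]. destruct (Hsy y Hy i Hi) as (k & Hk).
    destruct (@mu_spec _ _ (fun k => k ∈ ap kp n0 /\ ap (ap sy y) k ∈ ap (E j) y /\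
     (ap (G (ap u i)) y ∈ ap (E j) y -> ap (G (ap u i)) y ∈ ap (ap PP (ap (E j) y)) (ap (ap sy y) k))) k) as (_ & Hm & _).
    - df.
    - apply Ord_in with (2 := proj1 Hk). apply Ord_in with m; auto.
    - exact Hk.
    - exact Hm. }
  assert (Hxf : xi ∈ fnset A2 (ap kp n0)).
  { apply in_fnset. split; [|intros y Hy; apply Hxi; auto]. unfold xi at 1. apply lam_ext; [|df|df].
    intros y Hy. unfold xi. rewrite ap_lam; auto. df. }
  assert (Hq : opair X xi ∈ prod (Pw A2) (fnset A2 (ap kp n0))) by (apply opair_prod; rewrite in_Pw; auto).
  destruct (Hkk _ Hq) as [K1 K2]. destruct (Hs _ Hq) as (k & Hk & Ek). apply (Hi' k Hk); rewrite Ek; auto.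
  apply K2; auto. unfold code. rewrite fst_opair, snd_opair. split; auto. intros y Hy. destruct (Hxi y (XA y Hy)) as (H1 & H2 & H3).
  split; auto. split; auto. apply H3. destruct (EP j y Hj (XA y Hy)) as (E1 & E2 & E3). apply in_sep in Hy; [|df]. destruct Hy as [Hy Hy2].
  apply in_suc in Hy2. destruct Hy2 as [Hy2| ->]; auto. apply Ord_trans with (2 := Hy2); auto. apply EO; auto.
Qed.
End Final.
Lemma node_false : False.
Proof. destruct good_part_ex as (n & A2 & Hn & H1 & H2 & H3). apply (@good_part_false n A2); auto; intros y Hy; apply H3; auto. Qed.
End Node.
Lemma ideal_false : False.
Proof. destruct node_ex as (A & b & H1 & H2). apply (node_false H1 H2). Qed.
End Ideal.
Lemma bad_false : False.
Proof. destruct ideal_ex as (Y & I & HY & HI & H). apply (ideal_false HY HI H). Qed.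
End Bad.

Theorem RGCH a : Ord a -> exists k, k ∈ m /\ Good k a.
Proof.
  intro Oa. apply NNPP. intro N.
  destruct (@Ord_least _ _ (fun a => ~ exists k, k ∈ m /\ Good k a) a) as (l & Ol & Hl & Ll); auto. df.
  assert (Lg : forall a, a ∈ l -> exists k, k ∈ m /\ Good k a) by (intros c Hc; apply NNPP; auto).
  assert (separated : forall k, k ∈ m -> ~ Good k l) by (intros k Hk HG; apply Hl; eauto).
  assert (E1 : suc emp ∈ m).
  { apply (@Ord_trans _ m (suc emp) omega); auto. apply lim_omega, emp_lim, lim_omega. }
  (* An [l] inside [m] would be covered by a single piece. *)
  assert (ml : subset m l).
  { apply Ord_nlt; auto. intro Hm. apply (separated _ E1). apply Good_Sm; auto. apply Sm_in; auto. }
  assert (wl : omega ∈ l) by auto.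
  apply (@bad_false l); auto.
  apply square_le; auto. apply Ord_sub; auto using Ord_omega.
Qed.

Lemma Ord_sub_m a c : Ord a -> subset m a -> c ∈ m -> subset c a.
Proof. intros Oa Ha Hc. apply Ord_sub; eauto using Ord_in. Qed.
(** Prepares the final count. For each index there are fewer than [m] partial graphs from [t] into
    its piece, and [a] absorbs its square, so pairs of an index and a partial graph are coded
    injectively by members of [a]. *)
Theorem RGCH_code a : Ord a -> subset m a -> exists k, k ∈ m /\ forall t, t ∈ m -> exists P e, Covers a P t k /\
  forall j w, j ∈ a -> subset w (prod t (ap P j)) -> ap e (opair j w) ∈ a /\
  forall j' w', j' ∈ a -> subset w' (prod t (ap P j')) -> ap e (opair j w) = ap e (opair j' w') -> j = j' /\ w = w'.
Proof.
  intros Oa Ha. destruct (RGCH Oa) as (k & Hk & HG). exists k. split; auto. intros t Ht. destruct (HG t Ht) as (P & HP & HC).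
  destruct (@AC (fun j e => (forall w, w ∈ Pw (prod t (ap P j)) -> ap e w ∈ a) /\
    forall w w', w ∈ Pw (prod t (ap P j)) -> w' ∈ Pw (prod t (ap P j)) -> ap e w = ap e w' -> w = w') a) as (E & HE). df.
  { intros j Hj. assert (HS : Sm (Pw (prod t (ap P j)))).
    { apply Sm_Pw; auto. apply Sm_prod; auto. apply Sm_in; auto. }
    destruct HS as (c & Hc & L). destruct (le_trans L (le_sub (Ord_sub_m Oa Ha Hc))) as (e & H1 & H2). exists e. split; auto. }
  assert (SQ : le (prod a a) a) by (apply square_le; auto; apply Ord_sub; auto using Ord_omega).
  destruct SQ as (q & Q1 & Q2).
  set (D0 := prod a (Pw (prod t (Un (image a (ap P)))))).
  exists P, (lam D0 (fun z => ap q (opair (fst z) (ap (ap E (fst z)) (snd z))))). split; auto.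
  assert (IN : forall j w, j ∈ a -> subset w (prod t (ap P j)) -> opair j w ∈ D0 /\ w ∈ Pw (prod t (ap P j))).
  { intros j w Hj Hw. split; [|apply in_Pw; auto]. apply opair_prod. split; auto. apply in_Pw. intros z Hz. apply Hw in Hz.
    apply in_prod in Hz. destruct Hz as (x & y & Hx & Hy & ->). apply opair_prod. split; auto. apply in_Un. exists (ap P j). split; auto.
    apply in_image. df. eauto. }
  assert (EV : forall j w, j ∈ a -> subset w (prod t (ap P j)) ->
    ap (lam D0 (fun z => ap q (opair (fst z) (ap (ap E (fst z)) (snd z))))) (opair j w) = ap q (opair j (ap (ap E j) w))).
  { intros j w Hj Hw. rewrite ap_lam; [|df|apply IN; auto]. rewrite fst_opair, snd_opair. reflexivity. }
  assert (IQ : forall j w, j ∈ a -> subset w (prod t (ap P j)) -> opair j (ap (ap E j) w) ∈ prod a a).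
  { intros j w Hj Hw. apply opair_prod. split; auto. apply (HE j Hj). apply in_Pw. auto. }
  intros j w Hj Hw. rewrite EV by auto. split; [apply Q1; auto|]. intros j' w' Hj' Hw'. rewrite EV by auto. intro E'.
  apply Q2 in E'; auto. apply opair_inj in E'. destruct E' as [<- E2]. split; auto. apply (HE j Hj); auto; apply in_Pw; auto.
Qed.
End RGCH.

(** * Transfer from the inner model *)

Section Collapse.
Context {M : structure} {Z : ZF M}.
Implicit Types (K : M -> Prop) (a b c x y z A B C f g h : M) (F G : M -> M).
Transparent ap the.
Lemma ap_none f x : ~ (exists! y, opair x y ∈ f) -> ap f x = emp.
Proof. intro H. unfold ap, the. split_if; tauto. Qed.
Opaque ap the.

(** Mostowski collapse: for a set [R] of ordinals, the order type of the part of [R] below [a]. *)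
Definition col R a := Rec (fun h => image (sep h (fun z => fst z ∈ R)) snd) a.
Lemma DT_col K s t : DT K s -> DT K t -> DT K (fun e => col (s e) (t e)).
Proof. apply DT_op2. change (DT K (fun e => col (e 0) (e 1))). unfold col. df. Qed.
Hint Resolve DT_col : df.
Lemma in_col R a x : Ord a -> x ∈ col R a <-> exists b, b ∈ a /\ b ∈ R /\ x = col R b.
Proof.
  intro Oa. unfold col at 1. rewrite Rec_eq; [|df|auto]. rewrite in_image by df. split.
  - intros (z & Hz & ->). apply in_sep in Hz; [|df]. destruct Hz as [Hz Hz']. apply in_lam in Hz; [|df].
    destruct Hz as (b & Hb & ->). rewrite fst_opair in Hz'. rewrite snd_opair. eauto.
  - intros (b & Hb & HR & ->). exists (opair b (col R b)). rewrite snd_opair. split; auto. apply in_sep. df. rewrite fst_opair. split; auto.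
    apply in_lam. df. exists b. auto.
Qed.
Lemma col_trans R a : Ord a -> transitive_set (col R a).
Proof.
  intros Oa x Hx y Hy. apply in_col in Hx; auto. destruct Hx as (b & Hb & HR & ->). apply in_col in Hy; [|eapply Ord_in; eauto].
  destruct Hy as (c & Hc & HR' & ->). apply in_col; auto. exists c. split; [exact (Ord_trans Oa Hc Hb)|auto].
Qed.
Lemma Ord_col R : (forall a, a ∈ R -> Ord a) -> Ord (image R (col R)).
Proof.
  intro H. split.
  - intros x Hx y Hy. apply in_image in Hx; [|df]. destruct Hx as (a & Ha & ->). apply in_col in Hy; auto.
    destruct Hy as (b & Hb & HR & ->). apply in_image. df. eauto.
  - intros x Hx. apply in_image in Hx; [|df]. destruct Hx as (a & Ha & ->). apply col_trans. auto.
Qed.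
Lemma col_inj R a b : (forall a, a ∈ R -> Ord a) -> a ∈ R -> b ∈ R -> col R a = col R b -> a = b.
Proof.
  intros H Ha Hb E. destruct (Ord_tri (H a Ha) (H b Hb)) as [O|[O|O]]; auto; exfalso.
  - apply (@mem_irr _ _ (col R b)). rewrite <- E at 1. apply in_col; eauto.
  - apply (@mem_irr _ _ (col R a)). rewrite E at 1. apply in_col; eauto.
Qed.
End Collapse.
#[export] Hint Resolve DT_col : df.

(** * The injection of the chain into [l] *)

Section Transfer.
Context {M : structure} {Z : ZF M}.
Implicit Types (K : M -> Prop) (a b c x y z A B C f g h : M) (F G : M -> M).

(* What is kept of the filter: members of the chain differ somewhere on one piece of every partition into
   fewer than [k] pieces. *)
Definition separated (l lp k t F : M) := F ∈ fnset lp (fnset t l) /\ forall g T, g ∈ k -> (forall i, i ∈ t -> exists x, x ∈ g /\ i ∈ ap T x) ->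
  exists x, x ∈ g /\ forall a b, a ∈ lp -> b ∈ a -> exists i, i ∈ t /\ i ∈ ap T x /\ ap (ap F a) i <> ap (ap F b) i.

Context (m KK TH ff l lp : M) (Om : Ord m) (wm : omega ∈ m) (Ol : Ord l) (ml : subset m l) (Olp : Ord lp).
Context (HK : forall n, n ∈ omega -> ap KK n ∈ m) (HT : forall n, n ∈ omega -> ap TH n ∈ m).
Context (HB : forall n, n ∈ omega -> separated l lp (ap KK n) (ap TH n) (ap ff n)).
Context (Hcof : forall c, c ∈ m -> exists n, n ∈ omega /\ c ∈ ap KK n).
Context (Hpw : forall c, c ∈ m -> exists d, d ∈ m /\ forall a e, Ord a -> (forall x, x ∈ a -> exists X, subset X c /\ ap e X = x) -> a ∈ d).
#[local] Existing Instance ZF_W.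
Let p := opair ff KK.
Notation OD := (OD p).
Notation inW := (inW p).
Notation W := (W p).
Hint Resolve OD_p up_OD : df.
Let ffE : ff = fst p. Proof. unfold p. rewrite fst_opair. reflexivity. Qed.
Let KKE : KK = snd p. Proof. unfold p. rewrite snd_opair. reflexivity. Qed.

(** Any second entry of a pair in a set of W lies in W, so unique existence of a value means the
    same inside and outside, and the default agrees too. *)
Lemma up_ap_gen (f x : W) : up (ap f x) = ap (up f) (up x).
Proof.
  destruct (classic (exists! y, opair (up x) y ∈ up f)) as [(y & Hy & Hu)|N].
  - assert (Wy : inW y).
    { apply W_in with (upair (up x) y); [|apply in_upair; auto]. apply W_in with (opair (up x) y); [|apply in_upair; auto].
      apply W_in with (up f); auto. apply up_W. }
    destruct (@up_ap _ _ p f x (mk Wy)) as [E1 E2].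
    + change (up (opair x (mk Wy)) ∈ up f). rewrite up_opair. exact Hy.
    + intros z Hz. symmetry. apply Hu. exact Hz.
    + rewrite E1, E2. reflexivity.
  - rewrite ap_none with (1 := N). rewrite ap_none; [apply up_emp|]. intros (y & Hy & Hu). apply N. exists (up y). split.
    + rewrite <- up_opair. exact Hy.
    + intros z Hz. assert (Wz : inW z).
      { apply W_in with (upair (up x) z); [|apply in_upair; auto]. apply W_in with (opair (up x) z); [|apply in_upair; auto].
        apply W_in with (up f); auto. apply up_W. }
      change z with (up (mk Wz)). f_equal. apply Hu. change (up (opair x (mk Wz)) ∈ up f). rewrite up_opair. exact Hz.
Qed.
Lemma up_subset (x y : W) : subset x y <-> subset (up x) (up y).
Proof.
  split.
  - intros H z Hz. destruct (up_down Hz) as (z' & <-). apply H. exact Hz.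
  - intros H z Hz. apply (H (up z)). exact Hz.
Qed.

(** Least codes order the subsets in W but may be large ordinals; the collapse brings them below
    [d]. The collapsing map is definable from [c] and [p], so W itself sees the injection. *)
Lemma Hpow_W (c : W) : up c ∈ m -> exists d : W, up d ∈ m /\ le (Pw c) d.
Proof.
  intro Hc. destruct (Hpw Hc) as (d & Hd & H). assert (Od := Ord_in Om Hd). exists (mk (W_Ord p Od)). split; auto.
  pose (rk := fun X => mu (fun a => En p a = X)).
  assert (Hrk : forall X, inW X -> Ord (rk X) /\ En p (rk X) = X).
  { intros X HX. destruct (W_OD HX) as (a & Oa & Ea). destruct (@mu_spec _ _ (fun a => En p a = X) a) as (H1 & H2 & _); auto. df. }
  pose (R := image (sep (Pw (up c)) inW) rk).
  assert (HR : forall x, x ∈ R <-> exists X, X ∈ sep (Pw (up c)) inW /\ x = rk X). { intro x. apply in_image. unfold rk; df. }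
  assert (HS : forall X, X ∈ sep (Pw (up c)) inW <-> subset X (up c) /\ inW X). { intro X. rewrite in_sep by df. rewrite in_Pw. tauto. }
  assert (OR : forall a, a ∈ R -> Ord a). { intros a Ha. apply HR in Ha. destruct Ha as (X & HX & ->). apply Hrk. apply HS. auto. }
  assert (Dl : image R (col R) ∈ d).
  { apply H with (e := lam (Pw (up c)) (fun X => col R (rk X))). apply Ord_col; auto.
    intros x Hx. apply in_image in Hx; [|df]. destruct Hx as (a & Ha & ->). apply HR in Ha. destruct Ha as (X & HX & ->).
    apply HS in HX. exists X. split; [tauto|]. rewrite ap_lam; [reflexivity|unfold rk; df|apply in_Pw; tauto]. }
  assert (Cd : forall X, subset X (up c) -> inW X -> col R (rk X) ∈ d).
  { intros X H1 H2. apply (Ord_trans Od) with (2 := Dl). apply in_image. df. exists (rk X). split; auto. apply HR. exists X. split; auto. apply HS. auto. }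
  destruct (@W_ex _ _ p (fun z => exists X, X ∈ Pw (up c) /\ inW X /\ z = opair X (col R (rk X))) (lam (Pw (up c)) (fun X => col R (rk X)))) as (f & _ & Hf).
  - assert (A1 := up_OD c). assert (A2 := OD_p p). unfold R, rk. df.
  - intros z (X & HX & WX & ->). split; [apply in_lam; [unfold rk; df|eauto]|]. apply in_Pw in HX. apply W_opair; auto.
    apply W_in with d; [apply W_Ord; auto|]. auto.
  - assert (Ef : forall X : W, X ∈ Pw c -> up (ap f X) = col R (rk (up X))).
    { intros X HX. apply in_Pw in HX. apply up_subset in HX. rewrite up_ap_gen. apply ap_eq.
      - apply Hf. exists (up X). split; [apply in_Pw; auto|]. split; [apply up_W|auto].
      - intros z Hz. apply Hf in Hz. destruct Hz as (X' & _ & _ & E). apply opair_inj in E. destruct E as [<- ->]. auto. }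
    exists f. split.
    + intros X HX. change (up (ap f X) ∈ d). rewrite Ef by auto. apply in_Pw in HX. apply up_subset in HX. apply Cd; auto using up_W.
    + intros X Y HX HY E. assert (EX := Ef X HX). rewrite E, (Ef Y HY) in EX. apply in_Pw in HX, HY. apply up_subset in HX, HY.
      apply col_inj in EX; auto.
      * apply up_inj. destruct (Hrk _ (up_W X)) as [_ <-]. destruct (Hrk _ (up_W Y)) as [_ <-]. rewrite EX. auto.
      * apply HR. exists (up Y). split; auto. apply HS. auto using up_W.
      * apply HR. exists (up X). split; auto. apply HS. auto using up_W.
Qed.
Lemma f_fun n a : n ∈ omega -> a ∈ lp -> ap (ap ff n) a ∈ fnset (ap TH n) l.
Proof. intros Hn Ha. destruct (HB Hn) as [H _]. apply in_fnset in H. destruct H as [_ H]. auto. Qed.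
Lemma fnset_mem A B f z : f ∈ fnset A B -> z ∈ f <-> exists i, i ∈ A /\ z = opair i (ap f i).
Proof. intro H. apply in_fnset in H. destruct H as [E _]. rewrite E at 1. apply in_lam. df. Qed.
(** Its elements are pairs of ordinals and it is definable from [p], [n] and [a]. *)
Lemma f_W n a : n ∈ omega -> a ∈ lp -> inW (ap (ap ff n) a).
Proof.
  intros Hn Ha. assert (Hf := f_fun Hn Ha). assert (OT := Ord_in Om (HT Hn)).
  assert (A1 := OD_p p). assert (A2 := OD_Ord p (Ord_n Hn)). assert (A3 := OD_Ord p (Ord_in Olp Ha)).
  assert (E : ap (ap ff n) a = sep (prod (ap TH n) l) (fun z => z ∈ ap (ap (fst p) n) a)).
  { apply ext. intro z. rewrite in_sep by df. rewrite <- ffE. rewrite (fnset_mem z Hf). split; [|tauto].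
    intros (i & Hi & ->). split; [|eauto]. apply opair_prod. split; auto. apply in_fnset in Hf. apply Hf. auto. }
  rewrite E. apply W_sep. df. intros z Hz. rewrite <- ffE in Hz. apply (fnset_mem z Hf) in Hz. destruct Hz as (i & Hi & ->).
  assert (Hl : ap (ap (ap ff n) a) i ∈ l) by (apply in_fnset in Hf; apply Hf; auto).
  split; [apply opair_prod; auto|]. apply W_opair; apply W_Ord; eauto using Ord_in.
Qed.

Context (lp2 : suc emp ∈ lp).
Lemma chain_le : le lp l.
Proof.
  (* The sequence of the kappa_n as an element of W, where it witnesses the countable cofinality of
     [m]. *)
  destruct (@W_ex _ _ p (fun z => exists n, n ∈ omega /\ z = opair n (ap KK n)) (lam omega (ap KK))) as (kp & _ & Hkp).
  { assert (A1 := OD_p p). rewrite KKE. df. }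
  { intros z (n & Hn & ->). split; [apply in_lam; [df|eauto]|]. apply W_opair; apply W_Ord; eauto using Ord_n, Ord_in. }
  assert (Ekp : forall n : W, n ∈ omega -> up n ∈ omega /\ up (ap kp n) = ap KK (up n)).
  { intros n Hn. assert (Hn' : up n ∈ omega) by (rewrite <- (up_omega p); exact Hn). split; auto. rewrite up_ap_gen. apply ap_eq.
    - apply Hkp. eauto.
    - intros z Hz. apply Hkp in Hz. destruct Hz as (n' & _ & E). apply opair_inj in E. destruct E as [<- ->]. auto. }
  pose (mW := mk (W_Ord p Om)). pose (lW := mk (W_Ord p Ol)).
  destruct (@RGCH_code W _ (@Choice_W _ _ p) mW) with (kp := kp) (a := lW) as (k & Hk & HG).
  { apply up_Ord. exact Om. }
  { change (up (@omega W _) ∈ m). rewrite up_omega. exact wm. }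
  { intros c Hc. destruct (Hpow_W (c := c) Hc) as (d & Hd & H). exists d. split; auto. }
  { intros n Hn. destruct (Ekp n Hn) as [H1 H2]. change (up (ap kp n) ∈ m). rewrite H2. auto. }
  { intros c Hc. destruct (Hcof (c := up c) Hc) as (n & Hn & Hcn). exists (mk (W_Ord p (Ord_n Hn))).
    assert (Hn' : mk (W_Ord p (Ord_n Hn)) ∈ omega) by (change (n ∈ up (@omega W _)); rewrite up_omega; auto).
    split; auto. apply up_subset. rewrite (proj2 (Ekp _ Hn')). change (subset (up c) (ap KK n)).
    assert (OK := Ord_in Om (HK Hn)). apply Ord_sub; auto. apply (Ord_in OK Hcn). }
  { apply up_Ord. exact Ol. }
  { apply up_subset. exact ml. }
  destruct (Hcof (c := up k) Hk) as (n & Hn & Hkn).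
  assert (OT := Ord_in Om (HT Hn)). set (th := ap TH n) in *.
  destruct (HG (mk (W_Ord p OT))) as (P & e & HC & HE). { exact (HT Hn). }
  pose (f := fun a => ap (ap ff n) a).
  assert (Df' : DTf f) by (unfold f; df). opdf f.
  assert (Hff : forall a, a ∈ lp -> f a ∈ fnset th l) by (intros a Ha; apply f_fun; auto).
  assert (HfW : forall a, a ∈ lp -> inW (f a)) by (intros a Ha; apply f_W; auto).
  assert (Hfl : forall a i, a ∈ lp -> i ∈ th -> ap (f a) i ∈ l).
  { intros a i Ha Hi. assert (H := Hff a Ha). apply in_fnset in H. apply H. auto. }
  assert (HBn : forall g T, g ∈ ap KK n -> (forall i, i ∈ th -> exists x, x ∈ g /\ i ∈ ap T x) ->
    exists x, x ∈ g /\ forall a b, a ∈ lp -> b ∈ a -> exists i, i ∈ th /\ i ∈ ap T x /\ ap (f a) i <> ap (f b) i) by apply (HB Hn).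
  clearbody f.
  (* Positivity of a piece without the filter: any two members of the chain differ somewhere on
     it. *)
  pose (P0 := up P). pose (Pos := fun a j => j ∈ l /\ forall c d, c ∈ lp -> d ∈ c -> exists i, i ∈ th /\ ap (f a) i ∈ ap P0 j /\ ap (f c) i <> ap (f d) i).
  pose (jj := fun a => mu (Pos a)).
  assert (Hjj : forall a, a ∈ lp -> Pos a (jj a)).
  { intros a Ha. assert (Hj : exists j, Pos a j).
    2: { destruct Hj as (j & Hj). unfold jj. destruct (@mu_spec _ _ (Pos a) j) as (_ & H & _); auto. unfold Pos; df. apply Ord_in with l; auto. apply Hj. }
    destruct (HC (mk (HfW a Ha))) as (s & Hs).
    { intros i Hi. change (up (ap (mk (HfW a Ha)) i) ∈ l). rewrite up_ap_gen. apply Hfl; auto. }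
    (* The arguments are grouped by the covering piece that contains their value; there are [k]
       groups, fewer than kappa_n. *)
    destruct (HBn (up k) (lam (up k) (fun x => sep th (fun i => ap (up s) x ∈ l /\ ap (f a) i ∈ ap P0 (ap (up s) x)))) Hkn) as (x & Hx & Hx').
    { intros i Hi. destruct (Hs (mk (W_Ord p (Ord_in OT Hi)))) as (j & Hj & H1 & H2). { exact Hi. }
      exists (up j). split; [exact Hj|]. rewrite ap_lam; [|df|exact Hj]. apply in_sep. df. split; auto. split.
      - rewrite <- up_ap_gen. exact H1.
      - change (up (ap (mk (HfW a Ha)) (mk (W_Ord p (Ord_in OT Hi)))) ∈ up (ap P (ap s j))) in H2. rewrite !up_ap_gen in H2. exact H2. }
    exists (ap (up s) x). split.
    (* Members 1 and 0 of the chain differ on the group, so it is nonempty, and any of its points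
       shows that the index belongs to [l]. *)
    - destruct (Hx' (suc emp) emp lp2) as (i & Hi & Hi' & _). { apply in_suc. auto. }
      rewrite ap_lam in Hi'; auto; [|df]. apply in_sep in Hi'; [tauto|df].
    - intros c d Hc Hd. destruct (Hx' c d Hc Hd) as (i & Hi & Hi' & Hi2). exists i. split; auto. split; auto.
      rewrite ap_lam in Hi'; auto; [|df]. apply in_sep in Hi'; [tauto|df]. }
  assert (Djj : DTf jj) by (unfold jj, Pos; df). opdf jj.
  pose (ww := fun a => sep (f a) (fun z => z ∈ f a /\ snd z ∈ ap P0 (jj a))).
  assert (Dww : DTf ww) by (unfold ww; df). opdf ww.
  assert (inww : forall a z, a ∈ lp -> z ∈ ww a <-> exists i, i ∈ th /\ z = opair i (ap (f a) i) /\ ap (f a) i ∈ ap P0 (jj a)).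
  { intros a z Ha. unfold ww. rewrite in_sep by df. rewrite (fnset_mem z (Hff a Ha)). split.
    - intros ((i & Hi & ->) & _ & H). rewrite snd_opair in H. eauto.
    - intros (i & Hi & -> & H). rewrite snd_opair. split; [exists i; auto|]. split; [exists i; auto|exact H]. }
  (* Only each single restriction has to lie in W, to be given a code there; the map from [lp] to
     codes is formed outside. *)
  assert (Www : forall a, a ∈ lp -> inW (ww a)).
  { intros a Ha. assert (A1 := W_OD (HfW a Ha)). assert (A2 := up_OD P). fold P0 in A2.
    assert (A3 : OD (jj a)) by (apply OD_Ord; eapply Ord_in; [exact Ol|apply Hjj; auto]).
    unfold ww. clear - A1 A2 A3 HfW Ha. assert (HW := HfW a Ha). clear HfW. set (fa := f a) in *. set (ja := jj a) in *. clearbody fa ja P0.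
    apply W_sep; [df|]. intros x [Hx _]. split; [exact Hx|]. apply (W_in HW Hx). }
  assert (Code : forall a, a ∈ lp -> exists (j w : W), up j = jj a /\ up w = ww a /\ j ∈ lW /\ subset w (prod (mk (W_Ord p OT)) (ap P j)) /\
    up (ap e (opair j w)) = ap (up e) (opair (jj a) (ww a))).
  { intros a Ha. assert (Wj : inW (jj a)) by (apply W_Ord; eapply Ord_in; [exact Ol|apply Hjj; auto]).
    exists (mk Wj), (mk (Www a Ha)). split; auto. split; auto. split; [|split].
    - change (jj a ∈ l). apply Hjj. auto.
    - intros z Hz. change (up z ∈ ww a) in Hz. apply inww in Hz; auto. destruct Hz as (i & Hi & Ez & Hy).
      assert (Wi : inW i) by (apply W_Ord; eapply Ord_in; eauto).
      assert (Wy : inW (ap (f a) i)) by (apply W_Ord; eapply Ord_in; [exact Ol|auto]).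
      assert (Ez' : z = opair (mk Wi) (mk Wy)) by (apply up_inj; rewrite up_opair; exact Ez).
      rewrite Ez'. apply opair_prod. split; [exact Hi|]. change (ap (f a) i ∈ up (ap P (mk Wj))). rewrite up_ap_gen. exact Hy.
    - rewrite up_ap_gen, up_opair. reflexivity. }
  apply (@le_intro _ _ _ _ (fun a => ap (up e) (opair (jj a) (ww a)))). df.
  - intros a Ha. destruct (Code a Ha) as (j & w & Ej & Ew & Hj & Hw & E). rewrite <- E. apply (HE j w Hj Hw).
  - assert (G : forall a b, b ∈ a -> a ∈ lp -> b ∈ lp -> ap (up e) (opair (jj a) (ww a)) = ap (up e) (opair (jj b) (ww b)) -> False).
    { intros a b Hba Ha Hb E0. destruct (Code a Ha) as (j & w & Ej & Ew & Hj & Hw & E). destruct (Code b Hb) as (j' & w' & Ej' & Ew' & Hj' & Hw' & E').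
      rewrite <- E, <- E' in E0. apply up_inj in E0. destruct (HE j w Hj Hw) as [_ HI]. destruct (HI j' w' Hj' Hw' E0) as [<- <-].
      (* Members [a] and [b] differ somewhere on the piece of [a], whereas equal codes make their
         restrictions to it coincide. *)
      destruct (Hjj a Ha) as [_ HP]. destruct (HP a b Ha Hba) as (i & Hi & H1 & H2).
      assert (Hz : opair i (ap (f a) i) ∈ ww a) by (apply inww; eauto). rewrite <- Ew, Ew' in Hz. apply inww in Hz; auto.
      destruct Hz as (i' & _ & Ei & _). apply opair_inj in Ei. destruct Ei as [<- Ei]. exact (H2 Ei). }
    intros a b Ha Hb E. destruct (Ord_tri (Ord_in Olp Ha) (Ord_in Olp Hb)) as [O|[O|O]]; auto; exfalso.
    + apply (G b a O Hb Ha). symmetry. exact E.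
    + apply (G a b O Ha Hb). exact E.
Qed.
End Transfer.

(** * Set-theoretic notions inside a model *)

Section Bridge.
Context {M : structure} {Z : ZF M}.
Implicit Types (K : M -> Prop) (a b c x y z A B C f g h : M) (F G : M -> M).

Lemma is_upair_iff c a b : is_upair c a b <-> c = upair a b.
Proof.
  split; [|intros ->; intro x; apply in_upair]. intro H. apply ext. intro x. rewrite in_upair. apply H.
Qed.
Lemma is_opair_iff c a b : is_opair c a b <-> c = opair a b.
Proof.
  split.
  - intros (s & t & H1 & H2 & H3). apply is_upair_iff in H1, H2, H3. rewrite H3, H1, H2. reflexivity.
  - intros ->. exists (sing a), (upair a b). rewrite !is_upair_iff. auto.
Qed.
Lemma app_iff f x y : app f x y <-> opair x y ∈ f.
Proof.
  split.
  - intros (c & H1 & H2). apply is_opair_iff in H1. rewrite <- H1. exact H2.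
  - intro H. exists (opair x y). rewrite is_opair_iff. auto.
Qed.
Lemma is_fun_iff f A B : is_fun f A B <-> f ∈ fnset A B.
Proof.
  split.
  - intros [H1 H2].
    assert (G : forall x, x ∈ A -> opair x (ap f x) ∈ f /\ forall y, opair x y ∈ f -> y = ap f x).
    { intros x Hx. destruct (H2 x Hx) as (y & Hy & Hu). apply app_iff in Hy.
      assert (E : ap f x = y). { apply ap_eq; auto. intros z Hz. symmetry. apply Hu. apply app_iff. exact Hz. }
      rewrite E. split; auto. intros z Hz. symmetry. apply Hu. apply app_iff. exact Hz. }
    apply in_fnset. split.
    + apply ext. intro z. rewrite in_lam by df. split.
      * intro Hz. destruct (H1 z Hz) as (x & y & Hx & Hy & E). apply is_opair_iff in E. exists x. split; auto. rewrite E.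
        f_equal. apply (G x Hx). rewrite <- E. exact Hz.
      * intros (x & Hx & ->). apply (G x Hx).
    + intros x Hx. destruct (G x Hx) as [Hz _]. destruct (H1 _ Hz) as (x' & y & Hx' & Hy & E). apply is_opair_iff, opair_inj in E.
      destruct E as [_ E]. rewrite E. exact Hy.
  - intro Hf. assert (E := fnset_mem (f := f) (A := A) (B := B)). apply in_fnset in Hf as Hf'. destruct Hf' as [_ Hf']. split.
    + intros c Hc. apply E in Hc; auto. destruct Hc as (i & Hi & ->). exists i, (ap f i). rewrite is_opair_iff. auto.
    + intros x Hx. exists (ap f x). split.
      * apply app_iff. apply E; eauto.
      * intros y Hy. apply app_iff, E in Hy; auto. destruct Hy as (i & _ & Ei). apply opair_inj in Ei. destruct Ei as [<- Ei]. auto.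
Qed.
Lemma app_fnset A B f x y : f ∈ fnset A B -> app f x y <-> x ∈ A /\ y = ap f x.
Proof.
  intro Hf. rewrite app_iff, (fnset_mem _ Hf). split.
  - intros (i & Hi & E). apply opair_inj in E. destruct E as [<- E]. auto.
  - intros [Hx ->]. eauto.
Qed.
Lemma is_ordinal_iff a : is_ordinal a <-> Ord a.
Proof.
  split.
  - intros [H1 (_ & H2 & _)]. split; auto. intros x Hx y Hy z Hz. apply (H2 z y x); auto. apply (H1 y); auto. apply (H1 x); auto. apply (H1 x); auto.
  - intro Oa. split; [exact (proj1 Oa)|]. split; [|split; [|split]].
    + intros x _. apply mem_irr.
    + intros x y z _ _ Hz Hxy Hyz. apply (@Ord_trans _ z x y); auto. eapply Ord_in; eauto.
    + intros x y Hx Hy. apply Ord_tri; eapply Ord_in; eauto.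
    + intros S HS (x & Hx). destruct (@foundation _ _ S x Hx) as (k & Hk & H). exists k. split; auto. intros y Hy.
      destruct (@Ord_tri _ _ k y) as [O|[O|O]]; auto; [eapply Ord_in; eauto|eapply Ord_in; eauto|]. destruct (H y O Hy).
Qed.
Lemma is_succ_iff b a : is_succ b a <-> b = suc a.
Proof.
  split; [|intros ->; intro x; apply in_suc]. intro H. apply ext. intro x. rewrite in_suc. apply H.
Qed.
Lemma is_limit_iff a : is_limit a <-> lim a.
Proof.
  unfold is_limit, lim. rewrite is_ordinal_iff. split; intros (H1 & H2 & H3); split; auto; split; auto; intros x Hx.
  - destruct (H3 x Hx) as (y & E & Hy). apply is_succ_iff in E. rewrite <- E. exact Hy.
  - exists (suc x). rewrite is_succ_iff. auto.
Qed.
Lemma is_omega_iff w : is_omega w <-> w = omega.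
Proof.
  split.
  - intros [H1 H2]. apply is_limit_iff in H1. assert (S := omega_least H1). apply Ord_sub in S; [|apply Ord_omega|apply H1].
    destruct S as [S|S]; auto. destruct (H2 _ S). apply is_limit_iff, lim_omega.
  - intros ->. split; [apply is_limit_iff, lim_omega|]. intros x Hx Hl. apply is_limit_iff in Hl. apply omega_least in Hl.
    apply (@mem_irr _ _ x). apply Hl. exact Hx.
Qed.

(** Initial ordinals in terms of injections; the passage to bijections is the Cantor-Bernstein
    theorem, proved for this case in [is_cardinal_iff]. *)
Definition Card k := Ord k /\ subset omega k /\ forall a, a ∈ k -> ~ le k a.
Lemma D_Card K s : DT K s -> D K (fun e => Card (s e)).
Proof. apply D_pred1. unfold Card. df. Qed.
Hint Resolve D_Card : df.

Lemma bij_equinumerous A B F : DTf F -> (forall x, x ∈ A -> F x ∈ B) -> (forall x y, x ∈ A -> y ∈ A -> F x = F y -> x = y) ->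
  (forall y, y ∈ B -> exists x, x ∈ A /\ F x = y) -> equinumerous A B.
Proof.
  intros HF H1 H2 H3. assert (L := lam_fnset HF H1). exists (lam A F). split; [split|].
  - apply is_fun_iff. exact L.
  - intros y Hy. destruct (H3 y Hy) as (x & Hx & E). exists x. split; auto. apply (app_fnset _ _ L). split; auto. rewrite ap_lam; auto.
  - intros x x' y Hx Hx'. apply (app_fnset _ _ L) in Hx, Hx'. destruct Hx as [Hx ->], Hx' as [Hx' E]. rewrite !ap_lam in E; auto.
Qed.
Lemma is_cardinal_iff k : is_cardinal k <-> Card k.
Proof.
  split.
  - intros (H1 & (w & Hw & H2) & H3). apply is_ordinal_iff in H1. apply is_omega_iff in Hw. rewrite Hw in H2. split; auto. split; auto.
    intros a Ha (e & E1 & E2). apply (H3 a Ha). assert (Sa : subset a k) by (apply Ord_sub; eauto using Ord_in).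
    (* Cantor-Bernstein *)
    pose (C := sep k (fun x => forall X, (forall y, y ∈ k -> ~ y ∈ a -> y ∈ X) -> (forall y, y ∈ k -> y ∈ X -> ap e y ∈ X) -> x ∈ X)).
    assert (inC : forall x, x ∈ C <-> x ∈ k /\ forall X, (forall y, y ∈ k -> ~ y ∈ a -> y ∈ X) -> (forall y, y ∈ k -> y ∈ X -> ap e y ∈ X) -> x ∈ X)
      by (intro x; unfold C; rewrite in_sep by df; tauto).
    assert (C1 : forall y, y ∈ k -> ~ y ∈ a -> y ∈ C) by (intros y Hy Ny; apply inC; auto).
    assert (C2 : forall y, y ∈ C -> ap e y ∈ C).
    { intros y Hy. apply inC in Hy. destruct Hy as [Hy HX]. apply inC. split; auto. }
    assert (C3 : forall y, y ∈ C -> y ∈ a -> exists x, x ∈ C /\ ap e x = y).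
    { intros y Hy Hya. apply NNPP. intro N. apply inC in Hy. destruct Hy as [Hy HX].
      apply (@mem_irr _ _ y). assert (Hd : y ∈ diff C (sing y)).
      { apply HX.
        - intros z Hz Nz. apply in_diff. rewrite in_sing. split; auto. intros ->. auto.
        - intros z Hz Hz'. apply in_diff in Hz'. apply in_diff. rewrite in_sing. destruct Hz' as [Hz' _]. split; auto.
          intro E. apply N. eauto. }
      apply in_diff in Hd. rewrite in_sing in Hd. tauto. }
    pose (h := fun y => If y ∈ C then ap e y else y).
    assert (Dh : DTf h) by (unfold h; df).
    assert (Hh : forall y, y ∈ k -> h y ∈ a).
    { intros y Hy. unfold h. split_if; auto. apply NNPP. intro N. auto. }
    assert (Ih : forall x y, x ∈ k -> y ∈ k -> h x = h y -> x = y).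
    { intros x y Hx Hy. unfold h.
      destruct (excluded_middle_informative (x ∈ C)) as [c1|c1], (excluded_middle_informative (y ∈ C)) as [c2|c2]; intro E.
      - apply E2; auto.
      - exfalso. apply c2. rewrite <- E. auto.
      - exfalso. apply c1. rewrite E. auto.
      - exact E. }
    assert (Oh : forall y, y ∈ a -> exists x, x ∈ k /\ h x = y).
    { intros y Hy. destruct (classic (y ∈ C)) as [Hc|Hc].
      - destruct (C3 y Hc Hy) as (x & Hx & Ex). exists x. split; [apply inC in Hx; tauto|]. unfold h. split_if; tauto.
      - exists y. split; auto. unfold h. split_if; tauto. }
    apply (@bij_equinumerous a k (fun y => mu (fun x => x ∈ k /\ h x = y))).
    + clearbody h. opdf h. df.
    + intros y Hy. destruct (Oh y Hy) as (x & Hx). destruct (@mu_spec _ _ (fun x => x ∈ k /\ h x = y) x) as (_ & [Hm _] & _); auto.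
      * clearbody h. opdf h. df.
      * eapply Ord_in; [exact H1|apply Hx].
    + assert (G : forall y, y ∈ a -> h (mu (fun x => x ∈ k /\ h x = y)) = y).
      { intros y Hy. destruct (Oh y Hy) as (x & Hx). destruct (@mu_spec _ _ (fun x => x ∈ k /\ h x = y) x) as (_ & [_ Hm] & _); auto.
        - clearbody h. opdf h. df.
        - eapply Ord_in; [exact H1|apply Hx]. }
      intros x y Hx Hy E. rewrite <- (G x Hx), <- (G y Hy), E. reflexivity.
    + intros x Hx. exists (h x). split; auto. destruct (@mu_spec _ _ (fun x' => x' ∈ k /\ h x' = h x) x) as (_ & [H4 H5] & _); auto.
      * clearbody h. opdf h. df.
      * eapply Ord_in; eauto.
  - intros (H1 & H2 & H3). split; [apply is_ordinal_iff; auto|]. split; [exists omega; rewrite is_omega_iff; auto|].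
    intros a Ha (f & [Hf Hs] & Hi). apply (H3 a Ha). apply is_fun_iff in Hf. assert (Oa := Ord_in H1 Ha).
    assert (G : forall y, y ∈ k -> mu (fun x => x ∈ a /\ ap f x = y) ∈ a /\ ap f (mu (fun x => x ∈ a /\ ap f x = y)) = y).
    { intros y Hy. destruct (Hs y Hy) as (x & Hx & Hxy). apply (app_fnset _ _ Hf) in Hxy.
      destruct (@mu_spec _ _ (fun x => x ∈ a /\ ap f x = y) x) as (_ & Hm & _); auto.
      - df.
      - eapply Ord_in; eauto.
      - split; auto. symmetry. apply Hxy. }
    apply (@le_intro _ _ _ _ (fun y => mu (fun x => x ∈ a /\ ap f x = y))). df.
    + intros y Hy. apply G. auto.
    + intros x y Hx Hy E. destruct (G x Hx) as [_ <-]. destruct (G y Hy) as [_ <-]. rewrite E at 1. reflexivity.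
Qed.
Lemma Card_omega : Card omega.
Proof.
  split; [apply Ord_omega|]. split; [intro; auto|]. intros a Ha L. apply not_Fin_omega. exists a. auto.
Qed.

(** Values outside [a] are allowed, and an omitted element makes [a] nonempty; the least such
    ordinal is hrtg of the power set of [t]. *)
Definition NotIm t a := forall e, exists x, x ∈ a /\ forall X, subset X t -> ap e X <> x.
Definition hrtg_Pw t := mu (NotIm t).
Lemma D_NotIm K s t : DT K s -> DT K t -> D K (fun e => NotIm (s e) (t e)).
Proof. apply D_pred2. unfold NotIm. df. Qed.
Hint Resolve D_NotIm : df.
Lemma DT_hrtg_Pw K s : DT K s -> DT K (fun e => hrtg_Pw (s e)).
Proof. apply DT_op1. change (DT K (fun e => hrtg_Pw (e 0))). unfold hrtg_Pw. df. Qed.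
Hint Resolve DT_hrtg_Pw : df.
Lemma hrtg_NotIm t P h : is_power P t -> is_hrtg h P -> Ord h /\ NotIm t h.
Proof.
  intros HP [(H1 & (x0 & H2) & H3) _]. apply is_ordinal_iff in H1. split; auto. intro e. apply NNPP. intro N. apply H3.
  assert (L : lam P (fun X => If ap e X ∈ h then ap e X else x0) ∈ fnset P h).
  { apply lam_fnset. df. intros X HX. split_if; auto. }
  eexists. split; [apply is_fun_iff, L|]. intros y Hy. apply NNPP. intro N1. apply N. exists y. split; auto. intros X HX E. apply N1.
  exists X. assert (HXP : X ∈ P) by (apply HP; exact HX). split; auto. apply (app_fnset _ _ L). split; auto.
  rewrite ap_lam; auto; [|df]. rewrite E. split_if; tauto.
Qed.
Lemma hrtg_Pw_spec t h : Ord h -> NotIm t h -> Ord (hrtg_Pw t) /\ NotIm t (hrtg_Pw t) /\ subset (hrtg_Pw t) h /\ forall b, b ∈ hrtg_Pw t -> ~ NotIm t b.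
Proof.
  intros Oh Hh. destruct (@mu_spec _ _ (NotIm t) h) as (H1 & H2 & H3); auto. { df. } split; [exact H1|]. split; [exact H2|].
  split; [apply H3; assumption|]. intros b Hb Nb. exact (mem_irr (H3 b (Ord_in H1 Hb) Nb b Hb)).
Qed.
(** Union sends singletons to their elements, so it maps the power set of [t] onto any ordinal
    contained in [t]. *)
Lemma hrtg_Pw_lt t h : Ord t -> Ord h -> NotIm t h -> t ∈ hrtg_Pw t.
Proof.
  intros Ot Oh Hh. destruct (hrtg_Pw_spec Oh Hh) as (H1 & H2 & _). apply NNPP. intro N. assert (S := Ord_nlt Ot H1 N).
  destruct (H2 (lam (Pw t) Un)) as (x & Hx & HX). apply (HX (sing x)).
  - intros y Hy. apply in_sing in Hy. rewrite Hy. auto.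
  - rewrite ap_lam.
    + apply ext. intro y. rewrite in_Un. split; [intros (u & Hu & Hy); apply in_sing in Hu; rewrite <- Hu; exact Hy|].
      intro Hy. exists x. rewrite in_sing. auto.
    + df.
    + apply in_Pw. intros y Hy. apply in_sing in Hy. rewrite Hy. auto.
Qed.
(** A smaller [a] is an image of the power set of [t]; pulling that map back along an injection of
    [hrtg_Pw t] into [a] would make [hrtg_Pw t] an image as well. *)
Lemma Card_hrtg_Pw t h : Ord t -> subset omega t -> Ord h -> NotIm t h -> Card (hrtg_Pw t).
Proof.
  intros Ot wt Oh Hh. destruct (hrtg_Pw_spec Oh Hh) as (H1 & H2 & _ & H3). assert (H4 := hrtg_Pw_lt Ot Oh Hh).
  split; [exact H1|]. split.
  - intros x Hx. apply (Ord_trans H1 (wt x Hx) H4).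
  - intros a Ha (i & I1 & I2). apply (H3 a Ha). intro e. apply NNPP. intro N.
    destruct (H2 (lam (Pw t) (fun X => mu (fun y => y ∈ hrtg_Pw t /\ ap i y = ap e X)))) as (y & Hy & HX).
    apply N. exists (ap i y). split; auto. intros X HXt E. apply (HX X HXt). rewrite ap_lam; [|df|apply in_Pw; exact HXt].
    destruct (@mu_spec _ _ (fun y => y ∈ hrtg_Pw t /\ ap i y = ap e X) y) as (_ & [G1 G2] & _).
    + df.
    + eapply Ord_in; eauto.
    + auto.
    + apply I2; auto. rewrite G2. exact E.
Qed.

Lemma D_separated l lp s t u : DT (fun _ => True) s -> DT (fun _ => True) t -> DT (fun _ => True) u ->
  D (fun _ => True) (fun e => separated l lp (s e) (t e) (u e)).
Proof. apply (D_pred3 (R := separated l lp)). unfold separated. df. Qed.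
Hint Resolve D_separated : df.

(** Suppose each part of the cover has two members of the sequence that agree on it. Its complement
    then contains the set where one lies below the other, hence is in the filter. By completeness so
    is the intersection of the complements, which is empty. *)
Lemma seq_separated (k t l lp D0 funs F : M) : Ord lp -> is_filter D0 t -> is_complete k D0 t -> is_funset funs t l ->
  is_increasing_seq D0 t F lp funs -> separated l lp k t F.
Proof.
  intros Olp (F1 & _ & F3 & F4 & _) HC HS [HF Hinc].
  assert (E : funs = fnset t l). { apply ext. intro f. rewrite <- is_fun_iff. apply HS. }
  rewrite E in HF. apply is_fun_iff in HF. split; auto. intros g T Hg Hcov. apply NNPP. intro N.
  assert (HF' := HF). apply in_fnset in HF'. destruct HF' as [_ HF'].
  assert (HD : forall x, x ∈ g -> sep t (fun i => ~ i ∈ ap T x) ∈ D0).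
  { intros x Hx. apply NNPP. intro N1. apply N. exists x. split; auto. intros a b Ha Hb. apply NNPP. intro N2. apply N1.
    assert (Hb' := Ord_trans Olp Hb Ha).
    destruct (Hinc b a (ap F b) (ap F a) Hb' Ha Hb) as (C & HCD & HCi); try (apply (app_fnset _ _ HF); auto).
    assert (Fa := HF' a Ha). assert (Fb := HF' b Hb').
    apply F4 with (S := C); auto.
    - intros i Hi. apply HCi in Hi. destruct Hi as (Hi & x1 & y1 & H1 & H2 & H3). apply in_sep. df. split; auto. intro HiT. apply N2.
      exists i. split; auto. split; auto. intro E'. apply (app_fnset _ _ Fb) in H1. apply (app_fnset _ _ Fa) in H2.
      destruct H1 as [_ ->], H2 as [_ ->]. rewrite E' in H3. exact (mem_irr H3).
    - intros i Hi. apply in_sep in Hi; [tauto|df]. }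
  assert (L : lam g (fun x => sep t (fun i => ~ i ∈ ap T x)) ∈ fnset g D0) by (apply lam_fnset; [df|exact HD]).
  destruct (HC g _ Hg (proj2 (is_fun_iff _ _ _) L)) as (C & HCD & HCi).
  apply (F3 C); auto. intros i Hi. apply HCi in Hi. destruct Hi as [Hi Hi2]. destruct (Hcov i Hi) as (x & Hx & HxT).
  specialize (Hi2 x (ap (lam g (fun x => sep t (fun i => ~ i ∈ ap T x))) x) Hx). rewrite (app_fnset _ _ L) in Hi2.
  specialize (Hi2 (conj Hx eq_refl)). rewrite ap_lam in Hi2; auto; [|df]. apply in_sep in Hi2; [tauto|df].
Qed.
End Bridge.
#[export] Hint Resolve D_Card D_NotIm DT_hrtg_Pw D_separated : df.

(** * The sequence of least counterexamples *)

Section Main.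
Context {M : structure} {Z : ZF M} (hAC : AC_aleph0 M).
Implicit Types (K : M -> Prop) (a b c x y z A B C f g h : M).
Context (u l lp : M) (Cu : Card u) (wu : omega ∈ u) (Cl : Card l) (ul : u ∈ l) (Clp : Card lp) (llp : l ∈ lp).
Context (Hht : forall t, Card t -> t ∈ u -> exists h, Ord h /\ h ∈ u /\ NotIm t h).

Definition next_bad (k t : M) := Card t /\ k ∈ t /\ t ∈ u /\ exists F, separated l lp k t F.
Context (Hbad : forall k, Card k -> k ∈ u -> exists t, next_bad k t).
Lemma D_next_bad s t : DT (fun _ => True) s -> DT (fun _ => True) t -> D (fun _ => True) (fun e => next_bad (s e) (t e)).
Proof. apply D_pred2. unfold next_bad. df. Qed.
Hint Resolve D_next_bad : df.

Lemma no_bad : False.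
Proof.
  assert (Ou : Ord u) by apply Cu. assert (Ol : Ord l) by apply Cl. assert (Olp : Ord lp) by apply Clp.
  (* Taking least counterexamples spends no choice on the cardinals; only the chains remain to be
     chosen. *)
  pose (th := fun k => mu (next_bad k)).
  assert (Dth : DTf th) by (unfold th; df).
  assert (Hth : forall k, Card k -> k ∈ u -> next_bad k (th k)).
  { intros k Ck Hk. destruct (Hbad Ck Hk) as (t & Ht). unfold th. destruct (@mu_spec _ _ (next_bad k) t) as (_ & Hm & _); auto. df. apply Ht. }
  clearbody th. opdf th.
  (* Written as a union over earlier values so as to make sense at every ordinal; on omega it starts
     with omega and continues with hrtg of the power set of theta_n. *)
  pose (kk := Rec (fun h => cup omega (Un (image h (fun z => hrtg_Pw (th (snd z))))))).
  assert (Dkk : DTf kk) by (unfold kk; df).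
  assert (inkk : forall a x, Ord a -> x ∈ kk a <-> x ∈ omega \/ exists b, b ∈ a /\ x ∈ hrtg_Pw (th (kk b))).
  { intros a x Oa. unfold kk at 1. rewrite Rec_eq; [|df|auto]. fold kk. rewrite in_cup, in_Un. split.
    - intros [H|(y & Hy & Hx)]; auto. apply in_image in Hy; [|df]. destruct Hy as (z & Hz & ->). apply in_lam in Hz; auto.
      destruct Hz as (b & Hb & ->). rewrite snd_opair in Hx. eauto.
    - intros [H|(b & Hb & Hx)]; auto. right. exists (hrtg_Pw (th (kk b))). split; auto. apply in_image. df. exists (opair b (kk b)).
      rewrite snd_opair. split; auto. apply in_lam; eauto. }
  clearbody kk. opdf kk.
  assert (Step : forall k, Card k -> k ∈ u -> Card (hrtg_Pw (th k)) /\ hrtg_Pw (th k) ∈ u /\ th k ∈ hrtg_Pw (th k) /\ NotIm (th k) (hrtg_Pw (th k))).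
  { intros k Ck Hk. destruct (Hth k Ck Hk) as (C1 & H1 & H2 & _). destruct (Hht C1 H2) as (h & Oh & Hh & NI).
    destruct (hrtg_Pw_spec Oh NI) as (O1 & N1 & S1 & _). destruct C1 as (O2 & w2 & _).
    split; [apply Card_hrtg_Pw with h; auto|]. split; [apply Ord_sub_in with h; auto|]. split; [apply hrtg_Pw_lt with h; auto|exact N1]. }
  assert (kk0 : kk emp = omega).
  { apply ext. intro x. rewrite inkk by apply Ord_emp. split; auto. intros [H|(b & Hb & _)]; auto. destruct (in_emp Hb). }
  assert (kkS : forall n, n ∈ omega -> Card (kk n) -> kk n ∈ u -> kk (suc n) = hrtg_Pw (th (kk n))).
  { intros n Hn Ck Hk. assert (On := Ord_n Hn). destruct (Step _ Ck Hk) as (C1 & H1 & H2 & _). destruct (Hth _ Ck Hk) as (C2 & H3 & _).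
    assert (Oh : Ord (hrtg_Pw (th (kk n)))) by apply C1.
    apply ext. intro x. rewrite inkk by auto using Ord_suc. split.
    - assert (G : x ∈ kk n -> x ∈ hrtg_Pw (th (kk n))).
      { intro Hx. apply (Ord_trans Oh) with (2 := H2). apply (Ord_trans (proj1 C2) Hx H3). }
      intros [H|(b & Hb & Hx)].
      + apply G. apply inkk; auto.
      + apply in_suc in Hb. destruct Hb as [Hb|Hb]; [|rewrite Hb in Hx; exact Hx]. apply G. apply inkk; eauto.
    - intro Hx. right. exists n. split; auto. apply in_suc. auto. }
  assert (Hkk : forall n, n ∈ omega -> Card (kk n) /\ kk n ∈ u).
  { apply (omega_ind (P := fun n => Card (kk n) /\ kk n ∈ u)). df.
    - rewrite kk0. split; [apply Card_omega|exact wu].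
    - intros n Hn [C1 H1]. rewrite (kkS n Hn C1 H1). destruct (Step _ C1 H1) as (C2 & H2 & _). auto. }
  assert (HS : forall n, n ∈ omega -> kk (suc n) = hrtg_Pw (th (kk n))) by (intros n Hn; apply kkS; auto; apply Hkk; auto).
  assert (Ht : forall n, n ∈ omega -> next_bad (kk n) (th (kk n))) by (intros n Hn; apply Hth; apply Hkk; auto).
  assert (Hts : forall n, n ∈ omega -> th (kk n) ∈ kk (suc n)).
  { intros n Hn. destruct (Hkk n Hn) as [C1 H1]. rewrite HS by exact Hn. apply Step; auto. }
  assert (Hks : forall n, n ∈ omega -> kk n ∈ kk (suc n)).
  { intros n Hn. destruct (Ht n Hn) as (_ & H1 & _). assert (Hn' : suc n ∈ omega) by (apply lim_omega; auto).
    apply (Ord_trans (proj1 (proj1 (Hkk _ Hn'))) H1). auto. }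
  set (m := Un (image omega kk)).
  assert (inm : forall x, x ∈ m <-> exists n, n ∈ omega /\ x ∈ kk n).
  { intro x. unfold m. rewrite in_Un. split.
    - intros (y & Hy & Hx). apply in_image in Hy; auto. destruct Hy as (n & Hn & ->). eauto.
    - intros (n & Hn & Hx). exists (kk n). split; auto. apply in_image; eauto. }
  assert (Om : Ord m).
  { apply Ord_Un. intros x Hx. apply in_image in Hx; auto. destruct Hx as (n & Hn & ->). apply (Hkk n Hn). }
  clearbody m.
  assert (E0 : emp ∈ omega) by (apply emp_lim, lim_omega).
  assert (Sw : forall n, n ∈ omega -> suc n ∈ omega) by (intros; apply lim_omega; auto).
  assert (wm : omega ∈ m). { apply inm. exists (suc emp). split; auto. rewrite <- kk0. auto. }
  assert (ml : subset m l).
  { intros x Hx. apply inm in Hx. destruct Hx as (n & Hn & Hx). apply (Ord_trans Ol) with (2 := ul).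
    apply (Ord_trans Ou Hx). apply (Hkk n Hn). }
  pose (TH := lam omega (fun n => th (kk n))).
  assert (ETH : forall n, n ∈ omega -> ap TH n = th (kk n)) by (intros n Hn; unfold TH; rewrite ap_lam; auto).
  pose (S := fun n => sep (fnset lp (fnset (th (kk n)) l)) (separated l lp (kk n) (th (kk n)))).
  assert (inS : forall n F, F ∈ S n <-> separated l lp (kk n) (th (kk n)) F).
  { intros n F. unfold S. rewrite in_sep by df. split; [tauto|]. intro H. split; auto. apply H. }
  assert (DS : DTf S) by (unfold S; df). clearbody S.
  assert (LS : lam omega S ∈ fnset omega (image omega S)).
  { apply lam_fnset; auto. intros n Hn. apply in_image; eauto. }
  (* The single appeal to countable choice: one chain for each n. *)
  destruct (hAC (w := omega) (B := image omega S) (F := lam omega S)) as (ff & C & Hff & Hch).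
  { apply is_omega_iff. reflexivity. }
  { apply is_fun_iff. exact LS. }
  { intros n X Hn HX. apply (app_fnset _ _ LS) in HX. destruct HX as [_ ->]. rewrite ap_lam; auto.
    destruct (Ht n Hn) as (_ & _ & _ & F & HF). exists F. apply inS. exact HF. }
  apply is_fun_iff in Hff.
  assert (HB : forall n, n ∈ omega -> separated l lp (kk n) (th (kk n)) (ap ff n)).
  { intros n Hn. apply inS. apply (Hch n (S n) (ap ff n)); auto.
    - apply (app_fnset _ _ LS). split; auto. rewrite ap_lam; auto.
    - apply (app_fnset _ _ Hff). auto. }
  apply ((proj2 (proj2 Clp)) l llp).
  apply (@chain_le _ _ m (lam omega kk) TH ff l lp); auto.
  - intros n Hn. rewrite ap_lam; auto. apply inm. eauto.
  - intros n Hn. rewrite ETH by exact Hn. apply inm. eauto.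
  - intros n Hn. rewrite ETH, ap_lam by auto. auto.
  - intros c Hc. apply inm in Hc. destruct Hc as (n & Hn & Hc). exists n. split; auto. rewrite ap_lam; auto.
  (* Subsets of a [c] below kappa_n are subsets of theta_n, and kappa_(n+1) is not an image of
     these, so it exceeds every ordinal that is. *)
  - intros c Hc. apply inm in Hc. destruct Hc as (n & Hn & Hc). exists (kk (suc n)). split; [apply inm; exists (suc (suc n)); auto|].
    intros a e Oa He. apply NNPP. intro N.
    destruct (Hkk n Hn) as [C1 H1]. destruct (Step _ C1 H1) as (C2 & _ & _ & NI). rewrite <- HS in NI, C2 by exact Hn.
    destruct (NI e) as (x & Hx & HX). destruct (He x (Ord_nlt Oa (proj1 C2) N Hx)) as (X & HXc & E). apply (HX X); auto.
    intros y Hy. destruct (Ht n Hn) as (C3 & H3 & _). apply (Ord_trans (proj1 C3)) with (2 := H3). apply (Ord_trans (proj1 C1) (HXc y Hy) Hc).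
  - destruct Clp as (_ & H & _). auto.
Qed.
End Main.

Theorem theorem0p19 (M : structure) (hZF : ZF M) (hAC : AC_aleph0 M)
    (aleph0 mu : M) (haleph0 : is_omega aleph0)
    (hmu : is_cardinal mu) (hmu0 : aleph0 ∈ mu)
    (hmuP : forall chi : M, is_cardinal chi -> chi ∈ mu ->
       exists P h : M, is_power P chi /\ is_hrtg h P /\ h ∈ mu) :
  forall lambda : M, is_cardinal lambda -> mu ∈ lambda ->
  exists kappa : M, is_cardinal kappa /\ kappa ∈ mu /\
  forall theta D : M,
    is_cardinal theta -> kappa ∈ theta -> theta ∈ mu ->
    is_filter D theta -> is_complete kappa D theta ->
  forall lambda_plus funs : M,
    is_succ_cardinal lambda_plus lambda ->
    is_funset funs theta lambda ->
    ~ exists F : M, is_increasing_seq D theta F lambda_plus funs.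
Proof.
  intros l Cl Hl. apply NNPP. intro N.
  apply is_omega_iff in haleph0. rewrite haleph0 in hmu0.
  assert (B : forall k, is_cardinal k -> k ∈ mu -> exists t lp, is_cardinal t /\ k ∈ t /\ t ∈ mu /\ is_succ_cardinal lp l /\
    exists F, separated l lp k t F).
  { intros k Ck Hk. apply NNPP. intro N1. apply N. exists k. split; [exact Ck|]. split; [exact Hk|].
    intros t D Ct Hkt Htm HD HC lp funs Hlp Hfuns (F & HF). apply N1. exists t, lp. do 4 (split; [assumption|]).
    exists F. apply (@seq_separated _ _ k t l lp D funs F); auto. apply is_ordinal_iff. apply Hlp. }
  (* The successor of [l] is part of each failure; it is read off from the failure at omega, and its
     uniqueness makes all failures speak of the same [lp]. *)
  destruct (B omega) as (t0 & lp & _ & _ & _ & Hlp & _). { apply is_cardinal_iff, Card_omega. } { exact hmu0. }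
  assert (U : forall lp', is_succ_cardinal lp' l -> lp' = lp).
  { intros lp' (C1 & H1 & H2). destruct Hlp as (C3 & H3 & H4). destruct (H2 lp C3 H3) as [E|E]; auto.
    destruct (H4 lp' C1 H1) as [E'|E']; auto. destruct (mem_asym E E'). }
  apply (@no_bad M hZF hAC mu l lp); auto.
  - apply is_cardinal_iff. exact hmu.
  - apply is_cardinal_iff. exact Cl.
  - apply is_cardinal_iff. apply Hlp.
  - apply Hlp.
  - intros t Ct Ht. destruct (hmuP t) as (P & h & HP & Hh & Hhm). { apply is_cardinal_iff. exact Ct. } { exact Ht. }
    exists h. destruct (hrtg_NotIm HP Hh) as [Oh NI]. auto.
  - intros k Ck Hk. destruct (B k) as (t & lp' & H1 & H2 & H3 & H4 & H5). { apply is_cardinal_iff. exact Ck. } { exact Hk. }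
    rewrite (U lp' H4) in H5. exists t. split; [apply is_cardinal_iff; exact H1|]. auto.
Qed.
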